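(* Let $\mathbf{H}$ be the collection of all Hörmander phase functions in $\mathbb{R}^n$, $n\ge3$, and let $\mathbf{C}_l\subset\mathbf{H}$ be the subset of phase functions with contact order $\le l$ at the origin. For any integer $l\ge A(n)$, the set $\mathbf{C}_l$ is open in $\mathbf{H}$. Moreover, $\mathbf{C}_l$ is dense in $(\mathbf{H},\tau)$, where $\tau$ denotes the topology induced by the family of seminorms $\phi\mapsto\|\partial^\alpha\phi\|_\infty$ with multi-indices $\alpha\in\{0,1,2,\dots\}^{2n-1}$.
   Context: $B_r^m$ is the ball of radius $r$ centred at the origin in $\mathbb{R}^m$. A small constant $0<\varepsilon_0\ll1$ is fixed throughout. Write $\mathbf{x}=(x,t)\in\mathbb{R}^{n-1}\times\mathbb{R}$. Hörmander phase function: $\phi\in C^\infty(B_{\varepsilon_0}^{n-1}\times B_{\varepsilon_0}^1\times B_{\varepsilon_0}^{n-1})$, $\phi=\phi(\mathbf{x};y)$, such that at every $(\mathbf{x},y)$ of the domain: ($H_1$) $\operatorname{rank}\nabla_{\mathbf{x}}\nabla_y\phi(\mathbf{x};y)=n-1$; and ($H_2$) with $G_0(\mathbf{x};y):=\bigwedge_{j=1}^{n-1}\partial_{y_j}\nabla_{\mathbf{x}}\phi(\mathbf{x};y)$ (identified with a vector in $\mathbb{R}^n$), one has $\det\big[\nabla_{y'}^2\langle\nabla_{\mathbf{x}}\phi(\mathbf{x};y'),G_0(\mathbf{x};y)\rangle\big]_{y'=y}\ne0$. By a standard reduction such a phase is taken, without loss of generality, in the normal form $\phi(\mathbf{x};y)=\langle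 x,y\rangle+t\langle y,My\rangle+O(|\mathbf{x}|^2|y|^2+|t||y|^3)$ on $B_{\varepsilon_\phi}^{n-1}\times B_{\varepsilon_\phi}^1\times B_{\varepsilon_\phi}^{n-1}$ for some $\varepsilon_\phi\in(0,\varepsilon_0]$, with $M$ a non-degenerate matrix. The integer $A(n)$ is defined by $$A(n)=1+\sum_{k=1}^{n-2}\Bigg[\binom{n-1}{k}\frac{k!+I(k)}{2}+\sum_{i=0}^{k-1}\frac{\binom{n-1}{i}\binom{n-1-i}{k-i}\binom{n-1-k}{k-i}}{2}\Big(k!-(k-i)!\,\frac{i!-I(i)}{2}\Big)\Bigg],$$ where $I(k)$ is the number of involutions (elements equal to their own inverse) in the symmetric group $S(k)$, so $I(k)=I(k-1)+(k-1)I(k-2)$, $I(0)=I(1)=1$. The formula is intended as the number of rows of the matrix $\mathcal{D}$ below; $A(3)=4$. Contact order: for a point $(x_0,t_0;y_0)\in B_{\varepsilon_\phi}^{n-1}\times B_{\varepsilon_\phi}^1\times B_{\varepsilon_\phi}^{n-1}$, Hörmander's non-degeneracy condition gives a unique curve $t\mapsto(X_0(t),t)$ with $\nabla_y\phi(X_0(t)+x_0,t+t_0;y_0)=\nabla_y\phi(x_0,t_0;y_0)$. Put $\phi_0(x,t;y)=\phi(x+x_0,t+t_0;y+y_0)-\phi(x_0,t_0;y+y_0)$, $D_{i,j}(t)=\partial_{y_i}\partial_{y_j}\phi_0(X_0(t),t;0)$ for $1\le i,j\le n-1$, and $\mathbf{D}(t)=\det(D_{i,j}(t))_{1\le i,j\le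 n-1}$. For an integer $l\ge1$ let $\mathcal{D}$ be the matrix with $l$ columns whose rows are the row $(\mathbf{D}^{(h)}(0))_{1\le h\le l}$ and, for each $1\le k\le n-2$ and all indices $i_1,\dots,i_k$ pairwise distinct and $j_1,\dots,j_k$ pairwise distinct in $\{1,\dots,n-1\}$, the row $\big((D_{i_1,j_1}\cdots D_{i_k,j_k})^{(h)}(0)\big)_{1\le h\le l}$, where $(\cdot)^{(h)}$ is the $h$-th $t$-derivative and duplicate rows (which occur because $D_{i,j}=D_{j,i}$) are removed. For an integer $l\ge A(n)$, $\phi$ has contact order at most $l$ (contact order $\le l$) at $(x_0,t_0;y_0)$ if $\mathcal{D}$ has row rank $A(n)$. ''At the origin'' means at $(0,0;0)$.
   Formalization: A(n) is taken to be the number of distinct rows of the matrix D instead of the printed formula; they agree for n=3,4, but at n=5 the formula gives 109 while D has only 106 distinct rows, so row rank A(n) would be impossible and density false. *)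

(* Defs.v *)
From HB Require Import structures.
From mathcomp Require Import all_boot all_order all_algebra.
From mathcomp Require Import all_classical all_reals all_analysis.
Set Implicit Arguments.
Unset Strict Implicit.
Unset Printing Implicit Defensive.
Import Order.TTheory GRing.Theory Num.Theory numFieldNormedType.Exports.
Local Open Scope classical_set_scope.
Local Open Scope ring_scope.

(* Throughout, m stands for n - 1. A point (x, t; y) of R^(n-1) * R * R^(n-1)
   is the row vector (x, t, y) of length 2n - 1 = (m + 1) + m, whose first
   block (x, t) is the bold x of R^n. *)

Section Coordinates.
Context {R : realType} {m : nat}.

Definition pt (x : 'rV[R]_m) (t : R) (y : 'rV[R]_m) : 'rV[R]_(m + 1 + m) :=
  row_mx (row_mx x (const_mx t)) y.
Definition bxpart (z : 'rV[R]_(m + 1 + m)) : 'rV[R]_(m + 1) := lsubmx z.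
Definition xpart (z : 'rV[R]_(m + 1 + m)) : 'rV[R]_m := lsubmx (bxpart z).
Definition tpart (z : 'rV[R]_(m + 1 + m)) : R := rsubmx (bxpart z) 0 0.
Definition ypart (z : 'rV[R]_(m + 1 + m)) : 'rV[R]_m := rsubmx z.

Definition bxi (a : 'I_(m + 1)) : 'I_(m + 1 + m) := lshift m a.
Definition yi (j : 'I_m) : 'I_(m + 1 + m) := rshift (m + 1) j.

(* The library norm on row vectors is the sup norm, hence this definition. *)
Definition enorm {k : nat} (v : 'rV[R]_k) : R :=
  Num.sqrt (\sum_i v 0 i ^+ 2).

Definition dotp {k : nat} (u v : 'rV[R]_k) : R := \sum_i u 0 i * v 0 i.

Definition box (e : R) : set 'rV[R]_(m + 1 + m) :=
  [set z | [/\ enorm (xpart z) < e, `|tpart z| < e & enorm (ypart z) < e]].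

End Coordinates.

Section Smooth.
Context {R : realType} {N : nat}.

Definition pd (i : 'I_N) (f : 'rV[R]_N -> R) : 'rV[R]_N -> R :=
  fun z => 'D_(delta_mx 0 i) f z.

Definition pds (s : seq 'I_N) (f : 'rV[R]_N -> R) : 'rV[R]_N -> R :=
  foldr pd f s.

Definition pd_multi (alpha : {ffun 'I_N -> nat}) : ('rV[R]_N -> R) ->
    'rV[R]_N -> R :=
  pds (flatten [seq nseq (alpha i) i | i <- enum 'I_N]).

Definition smooth_on (U : set 'rV[R]_N) (f : 'rV[R]_N -> R) : Prop :=
  forall (s : seq 'I_N) (z : 'rV[R]_N), U z ->
    {for z, continuous (pds s f)} /\
    (forall i, derivable (pds s f) z (delta_mx 0 i)).

Definition supnorm (U : set 'rV[R]_N) (f : 'rV[R]_N -> R) : \bar R :=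
  ereal_sup [set `|f z|%:E | z in U].

End Smooth.

(* C^oo of the (open) box. The values of the underlying total function outside
   the box are irrelevant: neither the topology nor the conditions below
   depend on them. *)
Record Cinfty (R : realType) (m : nat) (e : R) := MkCinfty {
  Cinfty_fun :> 'rV[R]_(m + 1 + m) -> R ;
  Cinfty_smooth : smooth_on (box e) Cinfty_fun }.

Section Topology.
Variables (R : realType) (m : nat) (e : R).

(* The seminorms may be infinite, but differences of two functions are tested,
   so they still define a topology, of which these balls form a subbase. *)
Definition seminorm_ball (phi : Cinfty m e)
    (alpha : {ffun 'I_(m + 1 + m) -> nat}) (r : R) : set (Cinfty m e) :=
  [set psi : Cinfty m e |
    (supnorm (box e) (pd_multi alpha (fun z => psi z - phi z)%R) < r%:E)%E].

HB.instance Definition _ := gen_eqMixin (Cinfty m e).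
HB.instance Definition _ := gen_choiceMixin (Cinfty m e).
HB.instance Definition _ := @isSubBaseTopological.Build (Cinfty m e)
  (set (Cinfty m e))
  [set B | exists phi alpha r, 0 < r /\ B = seminorm_ball phi alpha r] id.

End Topology.

Section Hormander.
Context {R : realType} {m : nat}.
Implicit Types (phi : 'rV[R]_(m + 1 + m) -> R) (z : 'rV[R]_(m + 1 + m)).

Definition mixed_hessian phi z : 'M[R]_(m, m + 1) :=
  \matrix_(j, a) pd (yi j) (pd (bxi a) phi) z.

(* The wedge v_1 /\ ... /\ v_(n-1) of the rows of the mixed Hessian is
   identified with the vector G such that <G, w> = det (v_1, ..., v_(n-1), w)
   for every w. *)
Definition G0 phi z : 'rV[R]_(m + 1) :=
  \row_a \det (col_mx (mixed_hessian phi z) (delta_mx 0 a)).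

Definition grad_bx phi z : 'rV[R]_(m + 1) := \row_a pd (bxi a) phi z.

Definition H1 phi z : Prop := \rank (mixed_hessian phi z) = m.

Definition H2 phi z : Prop :=
  \det (\matrix_(j < m, k < m)
    pd (yi j) (pd (yi k) (fun z' => dotp (grad_bx phi z') (G0 phi z))) z) != 0.

Definition normal_form (e0 : R) phi : Prop :=
  exists M : 'M[R]_m, M \in unitmx /\
  exists e C : R, 0 < e <= e0 /\
    forall z, box e z ->
      `|phi z - (dotp (xpart z) (ypart z)
                 + tpart z * dotp (ypart z) (ypart z *m M^T))|
      <= C * (enorm (bxpart z) ^+ 2 * enorm (ypart z) ^+ 2
              + `|tpart z| * enorm (ypart z) ^+ 3).

End Hormander.

Definition Hormander_phases (R : realType) (m : nat) (e0 : R) :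
    set (Cinfty m e0) :=
  [set phi : Cinfty m e0 | forall z, box e0 z -> H1 phi z /\ H2 phi z].
Arguments Hormander_phases {R} m e0 _.

(* The coordinates of a phase may be chosen so that it is in normal form near
   the origin; this is the subclass of the phases already reduced. *)
Definition normal_phases (R : realType) (m : nat) (e0 : R) :
    set (Cinfty m e0) :=
  Hormander_phases m e0 `&` [set phi : Cinfty m e0 | normal_form e0 phi].
Arguments normal_phases {R} m e0 _.

Section Rows.

(* The product D_(i_1, j_1) ... D_(i_k, j_k), as a monomial in the entries
   D_(p, q), p <= q, of a symmetric matrix: the exponent of each entry. *)
Definition monomial (m k : nat) (i j : {ffun 'I_k -> 'I_m}) :
    {ffun 'I_m * 'I_m -> nat} :=
  [ffun p : 'I_m * 'I_m => if (p.1 <= p.2)%N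
    then #|[pred a | ((i a, j a) == p) || ((j a, i a) == p)]| else 0%N].

Definition index_pairs (m k : nat) :
    seq ({ffun 'I_k -> 'I_m} * {ffun 'I_k -> 'I_m}) :=
  [seq ij : {ffun 'I_k -> 'I_m} * {ffun 'I_k -> 'I_m} <- enum predT
    | injectiveb ij.1 && injectiveb ij.2].

(* k ranges over 1, ..., m - 1 = n - 2. *)
Definition monomials (m : nat) : seq {ffun 'I_m * 'I_m -> nat} :=
  undup (flatten [seq [seq monomial ij.1 ij.2 | ij <- index_pairs m k]
                  | k <- iota 1 m.-1]).

(* The number of distinct rows of the contact matrix in dimension n. The closed
   formula
     1 + sum_(1 <= k <= n-2) [ C(n-1,k) (k! + I(k)) / 2 + sum_(i < k) ... ]
   (I(k) the number of involutions of k letters), meant to give this number,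
   agrees with it for n = 3, 4 (values 4, 19) but from n = 5 on counts some equal
   products several times: D_12 D_34 arises from the row and column sets {1,3},
   {2,4} and also from {1,4}, {2,3}. For n = 5 it gives 109, a rank which
   the matrix, with its 106 distinct rows, never attains. *)
Definition A (n : nat) : nat := 1 + size (monomials n.-1).

End Rows.

Section Contact.
Context {R : realType} {m : nat}.
Implicit Types (phi : 'rV[R]_(m + 1 + m) -> R) (x y : 'rV[R]_m) (t : R)
  (X : R -> 'rV[R]_m).

(* The germ at 0 of a smooth curve with these properties is unique when phi
   satisfies H1: differentiating the equation shows that it forces the square
   matrix of the derivatives in x and y to be invertible. Conversely
   this invertibility, which normal form ensures at the origin, gives the
   curve by the implicit function theorem. *)
Definition contact_curve phi x0 t0 y0 X : Prop :=
  X 0 = 0 /\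
  \forall t \near (0 : R),
    (forall (k : nat) (i : 'I_m),
       derivable (derive1n k (fun s => X s 0 i)) t 1) /\
    (forall j : 'I_m,
       pd (yi j) phi (pt (X t + x0) (t + t0) y0) = pd (yi j) phi (pt x0 t0 y0)).

Definition phi0 phi x0 t0 y0 : 'rV[R]_(m + 1 + m) -> R :=
  fun z => phi (pt (xpart z + x0) (tpart z + t0) (ypart z + y0))
           - phi (pt x0 t0 (ypart z + y0)).

Definition Dentry phi x0 t0 y0 X (i j : 'I_m) : R -> R :=
  fun t => pd (yi i) (pd (yi j) (phi0 phi x0 t0 y0)) (pt (X t) t 0).

Definition Ddet phi x0 t0 y0 X : R -> R :=
  fun t => \det (\matrix_(i, j) Dentry phi x0 t0 y0 X i j t).

Definition Dmonomial phi x0 t0 y0 X (e : {ffun 'I_m * 'I_m -> nat}) : R -> R :=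
  fun t => \prod_p Dentry phi x0 t0 y0 X p.1 p.2 t ^+ e p.

Definition contact_matrix (l : nat) phi x0 t0 y0 X :
    'M[R]_(1 + size (monomials m), l) :=
  col_mx (\row_h derive1n h.+1 (Ddet phi x0 t0 y0 X) 0)
    (\matrix_(r, h)
       derive1n h.+1
         (Dmonomial phi x0 t0 y0 X (tnth (in_tuple (monomials m)) r)) 0).

Definition contact_order_le (l : nat) phi x0 t0 y0 : Prop :=
  exists X, contact_curve phi x0 t0 y0 X /\
    \rank (contact_matrix l phi x0 t0 y0 X) = A m.+1.

End Contact.

Definition contact_class (R : realType) (m : nat) (e0 : R) (l : nat)
    (H : set (Cinfty m e0)) : set (Cinfty m e0) :=
  H `&` [set phi : Cinfty m e0 | contact_order_le l phi 0 0 0].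

(* Main.v *)
Require Import Defs.
From mathcomp Require Import all_boot all_order all_algebra.
From mathcomp Require Import all_classical all_reals all_analysis.
From mathcomp Require Import ring lra fingroup perm finmap.
Import Order.TTheory GRing.Theory Num.Theory.
Local Open Scope ring_scope.
Set Implicit Arguments.
Unset Strict Implicit.
Unset Printing Implicit Defensive.

(** Everything about the contact order of a phase can be read off from its
    derivatives at the origin. If a contact curve [X] exists, differentiating
    its equation and using [H1] show that the matrix [B] of the derivatives
    [d_x d_y phi] at the origin is invertible; conversely, an invertible [B]
    gives the curve by the implicit function theorem, and [X'] is a rational
    expression in the derivatives of [phi] along the curve, with denominators
    [det B]. Hence so are all [t]-derivatives of the [D_ij], and the
    contact order is at most [l] exactly when [B] is invertible and a matrix
    whose entries are fixed rational expressions in finitely many derivatives of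
    [phi] at the origin has maximal rank ([contact_order_leE]). Both conditions
    survive small changes of these derivatives, which the seminorms control:
    the class is relatively open in any set of Hormander phases
    ([open_contact_class]).

    For the density, a phase is perturbed to [phi + s g] with [g] a
    polynomial multiplied by a cut-off function. Such perturbations
    converge to [phi] as [s] tends to [0], and keep [H1] and [H2] for small
    [s], by compactness of the support of [g] ([near_Hormander]). With
    [g = <x, y>] near the origin, [B] becomes [B + s], which is invertible for
    small [s <> 0]; so [B] may be supposed invertible, and in normal form
    it is the identity. With [g = 1/2 sum_ij r_ij(t) y_i y_j] near the origin,
    [r_ij(0) = 0], the gradient in [y] at [y = 0] does not change, so the
    contact curve remains the same, and [D_ij] becomes [D_ij + s r_ij]. The choice
    [r = q - T], with [T] the Taylor polynomials of the [D_ij], moves the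
    jets along the segment from [T] to a given [q]. The minors of the contact
    matrix are polynomials in [s] along that segment, so if it has maximal
    rank at [q], it has maximal rank for all small [s <> 0]
    ([near_row_free_segment]). In normal form, the linear part of [r] in
    [t] is absorbed in the matrix [M] and the rest in the error term
    ([near_normal_form]).

    What remains is one jet [q] with a contact matrix of maximal rank
    ([generic_jets]), that is, with linearly independent distinct monomials and
    determinant. It is found among the [q_ij = v_ij (exp (lam_ij t) - 1)]:
    the products of the exponentials are exponentials with different exponents,
    and linear independence becomes a statement on the roots of a polynomial. *)

(** * Monomials in the entries of a symmetric matrix *)

Section Monomials.
Context {m k : nat}.
Implicit Types (i j : {ffun 'I_k -> 'I_m}).

(** [monomial] records the entries [(i a, j a)] up to transposition, as pairs
    with ordered components. *)
Definition sortp (p : 'I_m * 'I_m) : 'I_m * 'I_m :=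
  if (p.1 <= p.2)%N then p else (p.2, p.1).

Lemma monomialE i j p : monomial i j p = (\sum_a (sortp (i a, j a) == p))%N.
Proof.
rewrite /monomial ffunE -sum1_card; case: ifPn => [p12|p12]; last first.
  symmetry; apply/eqP; rewrite sum_nat_eq0; apply/forallP => a; apply/implyP => _.
  rewrite eqb0; apply: contra p12 => /eqP <-; rewrite /sortp /=.
  by case: (leqP (i a) (j a)) => //= /ltnW.
rewrite big_mkcond; apply: eq_bigr => a _; rewrite inE /=.
suff -> : ((i a, j a) == p) || ((j a, i a) == p) = (sortp (i a, j a) == p) by case: eqP.
rewrite /sortp /=; case: leqP => [ij|ij].
  apply/orP/idP => [[//|/eqP E]|->]; last by left.
  move: p12; rewrite -E /= => ji.
  have -> : i a = j a by apply/val_inj/eqP; rewrite eqn_leq ij ji.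
  by [].
apply/orP/idP => [[/eqP E|//]|->]; last by right.
by move: p12; rewrite -E /= leqNgt ij.
Qed.

Lemma sum_monomial (V : nmodType) (F : 'I_m * 'I_m -> V) i j :
  \sum_p F p *+ monomial i j p = \sum_a F (sortp (i a, j a)).
Proof.
under eq_bigr => p _ do rewrite monomialE -sumrMnr.
rewrite exchange_big; apply: eq_bigr => a _ /=.
rewrite (bigD1 (sortp (i a, j a))) //= eqxx mulr1n big1 ?addr0 // => p.
by rewrite eq_sym => /negbTE ->.
Qed.

Lemma prod_monomial (V : comPzRingType) (F : 'I_m * 'I_m -> V) i j :
  \prod_p F p ^+ monomial i j p = \prod_a F (sortp (i a, j a)).
Proof.
under eq_bigr => p _ do rewrite monomialE -prodrXr.
rewrite exchange_big; apply: eq_bigr => a _ /=.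
rewrite (bigD1 (sortp (i a, j a))) //= eqxx expr1 big1 ?mulr1 // => p.
by rewrite eq_sym => /negbTE ->.
Qed.

Lemma monomial_degree i j : (\sum_p monomial i j p)%N = k.
Proof.
transitivity (\sum_(a < k) 1)%N; last by rewrite sum_nat_const card_ord muln1.
rewrite -[RHS]/(\sum_(a < k) (fun=> 1%N) (sortp (i a, j a)))%N -[RHS]sum_monomial.
by apply: eq_bigr => p _; rewrite -[RHS]/(1%N *+ _) natn.
Qed.

Lemma monomial_mem i j : (0 < k < m)%N -> injective i -> injective j ->
  monomial i j \in monomials m.
Proof.
move=> /andP[k0 km] ii ij; rewrite mem_undup; apply/flattenP => /=.
exists [seq monomial ij.1 ij.2 | ij <- index_pairs m k].
  apply/mapP; exists k => //; rewrite mem_iota k0 add1n prednK //.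
  exact: leq_ltn_trans km.
apply/mapP; exists (i, j) => //.
by rewrite mem_filter mem_enum andbT; apply/andP; split; apply/injectiveP.
Qed.

End Monomials.

Lemma monomialsP (m : nat) al : al \in monomials m ->
  exists k (i j : {ffun 'I_k -> 'I_m}),
    [/\ (0 < k < m)%N, injective i, injective j & al = monomial i j].
Proof.
rewrite mem_undup => /flattenP[s /mapP[k]].
rewrite mem_iota => /andP[k1 km] -> /mapP[[i j]].
rewrite mem_filter => /andP[/andP[/= /injectiveP ii /injectiveP ij] _] ->.
exists k, i, j; split=> //; rewrite k1 /=.
by move: k1 km; clear=> k1 km; case: m km => [|m'] //; case: k k1.
Qed.

(** * Jets with a contact matrix of maximal rank *)

Section PolynomialTools.
Context {R : realFieldType}.

Lemma mul_shuffle (a b c d : R) : a * (b * c * d) = b * (d * (a * c)).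
Proof. by ring. Qed.

Lemma poly_nonroot (p : {poly R}) : p != 0 -> exists x, p.[x] != 0.
Proof.
move=> p0; pose rs := [seq i%:R : R | i <- iota 0 (size p)].
have urs : uniq rs.
  rewrite map_inj_uniq ?iota_uniq // => i j /eqP.
  by rewrite eqr_nat => /eqP.
have [/allP h|/allPn[x _ hx]] := boolP (all (root p) rs); last by exists x.
have := max_poly_roots p0 (introT allP h) urs.
by rewrite size_map size_iota ltnn.
Qed.

End PolynomialTools.

Section GenericJets.
Context {R : realFieldType} {m : nat}.
Local Notation a := (1 + size (monomials m))%N.

(** The contact matrix of the Taylor polynomials [q] of the entries [D_ij]. *)
Definition jetmx (l : nat) (q : 'I_m -> 'I_m -> {poly R}) : 'M[R]_(a, l) :=
  col_mx (\row_h ((\det (\matrix_(i, j) q i j))`_h.+1 *+ h.+1`!))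
    (\matrix_(r, h) ((\prod_p q p.1 p.2 ^+ tnth (in_tuple (monomials m)) r p)`_h.+1
       *+ h.+1`!)).

(** [p] agrees with [exp (mu X)] up to order [a]. *)
Definition expjet (p : {poly R}) (mu : R) : Prop :=
  forall k, (k <= a)%N -> p`_k = mu ^+ k / k`!%:R.

Lemma factr_neq0 k : k`!%:R != 0 :> R.
Proof. by rewrite pnatr_eq0 -lt0n fact_gt0. Qed.

Lemma expjet1 : expjet 1 0.
Proof.
move=> [|k] _; first by rewrite coefC expr0 divr1.
by rewrite coefC /= expr0n mul0r.
Qed.

Lemma expjetM p q mu nu : expjet p mu -> expjet q nu -> expjet (p * q) (mu + nu).
Proof.
move=> hp hq k ka; rewrite coefM addrC exprDn mulr_suml.
apply: eq_bigr => i _; have ik : (i <= k)%N by rewrite -ltnS.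
rewrite hp ?(leq_trans ik) // hq ?(leq_trans (leq_subr _ _)) //.
rewrite -(bin_fact ik) !natrM -mulr_natr.
have b0 : 'C(k, i)%:R != 0 :> R by rewrite pnatr_eq0 -lt0n bin_gt0.
have h1 := factr_neq0 i; have h2 := factr_neq0 (k - i).
by field; rewrite b0 h1 h2.
Qed.

Lemma expjet_prod (I : Type) (s : seq I) (P : pred I) (p : I -> {poly R}) mu :
  (forall x, expjet (p x) (mu x)) ->
  expjet (\prod_(x <- s | P x) p x) (\sum_(x <- s | P x) mu x).
Proof.
move=> h; apply: (big_rec2 (fun q nu => expjet q nu)); first exact: expjet1.
by move=> x q nu _; exact: expjetM.
Qed.

Definition truncexp (mu : R) : {poly R} := \poly_(k < a.+1) (mu ^+ k / k`!%:R).

Lemma truncexpP mu : expjet (truncexp mu) mu.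
Proof. by move=> k ka; rewrite coef_poly ltnS ka. Qed.

(** Shifting the factors of a product by constants does not change a linear
    functional that vanishes on the shorter products. This is the translation
    invariance of the span of the rows, together with the constants. *)
Lemma shift_prod (I : finType) (q e : I -> {poly R}) (v : I -> R)
    (f : {poly R} -> R) (n : nat) :
  {morph f : x y / x + y} -> (forall c x, f (c *: x) = c * f x) ->
  (forall x, e x = q x + (v x)%:P) ->
  (forall W : {set I}, (#|W| < n)%N -> f (\prod_(x in W) q x) = 0) ->
  forall T W : {set I}, [disjoint T & W] -> (#|T| + #|W| <= n)%N ->
    f (\prod_(x in T) e x * \prod_(x in W) q x) = f (\prod_(x in T :|: W) q x).
Proof.
move=> fD fZ eE f0 T; move: {2}#|T| (erefl #|T|) => t.
elim: t T => [|t IH] T Tt W dTW sz.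
  by rewrite (cards0_eq Tt) big_set0 mul1r finset.set0U.
have /card_gt0P[x xT] : (0 < #|T|)%N by rewrite Tt.
have xW : x \notin W by move/pred0P: dTW => /(_ x) /=; rewrite xT /= => ->.
have Tx : #|T :\ x| = t by move: Tt; rewrite (cardsD1 x) xT => -[].
have dW : [disjoint T :\ x & W] by apply: disjointWl dTW; exact: subsetDl.
rewrite (big_setD1 x) //= eE mulrDl mulrDl fD.
have -> : q x * \prod_(y in T :\ x) e y * \prod_(y in W) q y =
   \prod_(y in T :\ x) e y * \prod_(y in x |: W) q y.
  by rewrite big_setU1 //=; ring.
rewrite IH //; last 2 first.
- apply/pred0P => y; rewrite !inE; have [//|_] /= := eqVneq y x.
  by have := pred0P dTW y.
- by rewrite Tx cardsU1 xW -[(true + _)%N]/(#|W|.+1) addnS -addSn -Tt.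
have -> : T :\ x :|: (x |: W) = T :|: W by rewrite finset.setUCA finset.setUA finset.setD1K.
rewrite -mulrA mul_polyC fZ IH //; last by rewrite Tx (leq_trans _ sz) // Tt leqnSn.
have -> : f (\prod_(y in T :\ x :|: W) q y) = 0; last by rewrite mulr0 addr0.
apply: f0; apply: leq_ltn_trans (leq_of_leqif (leq_card_setU _ _)) _.
by rewrite Tx; move: sz; rewrite Tt.
Qed.

(** The exponents of the exponentials are powers of a generic number [x], so
    that different monomials receive different exponents. *)
Lemma generic_weights (s : seq {ffun 'I_m * 'I_m -> nat}) : uniq s ->
  exists x : R, {in s &, injective
    (fun al : {ffun 'I_m * 'I_m -> nat} => \sum_p x ^+ enum_rank p *+ al p)}.
Proof.
move=> us; pose P (al : {ffun 'I_m * 'I_m -> nat}) : {poly R} := \sum_p 'X^(enum_rank p) *+ al p.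
have PE al x : (P al).[x] = \sum_p x ^+ enum_rank p *+ al p.
  by rewrite /P horner_sum; apply: eq_bigr => p _; rewrite hornerMn hornerXn.
have Pinj : injective P.
  move=> al be E; apply/ffunP => p.
  have co (ga : {ffun 'I_m * 'I_m -> nat}) : (P ga)`_(enum_rank p) = (ga p)%:R.
    rewrite /P coef_sum (bigD1 p) //= coefMn coefXn eqxx big1 ?addr0 // => p' p'p.
    by rewrite coefMn coefXn eqn_leq -eqn_leq (inj_eq val_inj) (inj_eq enum_rank_inj) eq_sym (negbTE p'p) mul0rn.
  by have := congr1 (fun q : {poly R} => q`_(enum_rank p)) E; rewrite !co => /eqP; rewrite eqr_nat => /eqP.
pose Q : {poly R} := \prod_(al <- s) \prod_(be <- s | al != be) (P al - P be).
have Q0 : Q != 0.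
  rewrite prodf_seq_neq0; apply/allP => al _ /=.
  rewrite prodf_seq_neq0; apply/allP => be _; apply/implyP => ab.
  by rewrite subr_eq0; apply: contra ab => /eqP/Pinj ->.
have [x xP] := poly_nonroot Q0; exists x => al be als bes; rewrite -!PE => E.
apply/eqP; apply/negPn/negP => ab; move: xP.
rewrite /Q horner_prod (big_rem al) //= horner_prod (big_rem be) //= ab.
by rewrite hornerD hornerN E subrr !mul0r eqxx.
Qed.

(** Take [q_ij = v_ij (E_ij - 1)] with [E_ij] the truncation of [exp (lam_ij X)].
    A vanishing combination of the columns is a linear functional [f] on
    jets that kills constants and all rows. By [shift_prod], [f] takes the same
    value on the products of the [v_ij E_ij] with at most [m] factors as on those of
    the [q_ij]. On an exponential [exp (mu X)] it is a polynomial [P mu] in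
    the exponent, of degree at most the number [a] of rows, and it vanishes at [0] and
    at the exponents of the [a - 1] monomials, which are pairwise different. So [P] is a
    multiple of the product [P0] of the corresponding linear factors. Then the
    row of the determinant gives, up to this multiple, the alternating sum over the
    permutations of the products of the [v_ij] times the values of [P0]; for small
    off-diagonal [v_ij] the identity dominates, and [P0] is not [0] at its
    exponent, because the monomials have degree less than [m]. *)
Theorem generic_jets (l : nat) : (0 < m)%N -> (a <= l)%N ->
  exists q : 'I_m -> 'I_m -> {poly R}, [/\ forall i j, q i j = q j i,
    forall i j, (q i j)`_0 = 0 & row_free (jetmx l q)].
Proof.
move=> m0 al.
pose idm : {ffun 'I_m -> 'I_m} := [ffun i => i].
have idm_inj : injective idm by move=> i j; rewrite !ffunE.
pose al1 := monomial idm idm.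
pose al0 : {ffun 'I_m * 'I_m -> nat} := [ffun=> 0%N].
have deg_mon be : be \in monomials m -> (0 < \sum_p be p < m)%N.
  by move=> /monomialsP[k [i [j [km _ _ ->]]]]; rewrite monomial_degree.
have us : uniq [:: al0, al1 & monomials m].
  rewrite /= undup_uniq andbT inE negb_or; apply/andP; split; last first.
    by apply/negP => /deg_mon; rewrite monomial_degree ltnn andbF.
  have d0 : (\sum_p al0 p)%N = 0%N by apply: big1 => p _; rewrite ffunE.
  apply/andP; split.
    by apply/eqP => E; move: m0; rewrite -(monomial_degree idm idm) -/al1 -E d0.
  by apply/negP => /deg_mon; rewrite d0.
have [x x_inj] := generic_weights us.
pose lam (p : 'I_m * 'I_m) : R := x ^+ enum_rank (sortp p).
pose mu (be : {ffun 'I_m * 'I_m -> nat}) : R := \sum_p x ^+ enum_rank p *+ be p.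
have muE k (i j : {ffun 'I_k -> 'I_m}) : \sum_b lam (i b, j b) = mu (monomial i j).
  by rewrite /mu sum_monomial.
pose rs : seq R := 0 :: [seq mu be | be <- monomials m].
have mu0 : mu al0 = 0 by apply: big1 => p _; rewrite ffunE mulr0n.
have urs : uniq rs.
  have -> : rs = map mu (al0 :: monomials m) by rewrite /= mu0.
  rewrite map_inj_in_uniq.
    by move: us; rewrite /= inE negb_or -andbA => /and4P[_ -> _ ->].
  have sub b : b \in al0 :: monomials m -> b \in [:: al0, al1 & monomials m].
    by rewrite !inE => /orP[->|->]; rewrite ?orbT.
  by move=> b1 b2 /sub h1 /sub h2; exact: x_inj.
pose P0 : {poly R} := \prod_(r <- rs) ('X - r%:P).
have P0id : P0.[mu al1] != 0.
  rewrite horner_prod prodf_seq_neq0; apply/allP => r rrs /=.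
  rewrite hornerXsubC subr_eq0; apply/eqP => E.
  have : r \in map mu (al0 :: monomials m) by rewrite /= mu0.
  move=> /mapP[be hbe rE]; have /x_inj E2 : mu al1 = mu be by rewrite E.
  have [] : al1 \in [:: al0, al1 & monomials m] /\ be \in [:: al0, al1 & monomials m].
    split; first by rewrite !inE eqxx orbT.
    by move: hbe; rewrite !inE => /orP[->|->]; rewrite ?orbT.
  move=> h1 h2; have E3 := E2 h1 h2.
  move: us; rewrite /= inE negb_or -andbA => /and4P[n1 _ n2 _].
  by move: hbe; rewrite -E3 inE eq_sym (negbTE n1) (negbTE n2).
(* The off-diagonal [v_ij] are all equal to one number, the variable of [Q]:
   only the identity permutation contributes to the constant term. *)
pose Q : {poly R} := \sum_(s : {perm 'I_m}) ((-1) ^+ s * P0.[mu (monomial idm [ffun i => s i])])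
   *: \prod_i (if i == s i then 1 else 'X).
have Q0 : Q.[0] = P0.[mu al1].
  rewrite horner_sum (bigD1 1%g) //= hornerZ odd_perm1 expr0 mul1r.
  have -> : [ffun i => (1%g : {perm 'I_m}) i] = idm by apply/ffunP => i; rewrite !ffunE perm1.
  rewrite big1 => [|i _]; last by rewrite perm1 eqxx.
  rewrite hornerC mulr1 big1 ?addr0 // => s s1.
  have [i si] : exists i, i != s i.
    apply/existsP; rewrite -negb_forall; apply: contra s1 => /forallP h.
    by apply/eqP/permP => i; rewrite perm1; apply/eqP; rewrite eq_sym.
  have Z : (if i == s i then 1 else 'X : {poly R}).[0] = 0 by rewrite (negbTE si) hornerX.
  by rewrite hornerZ [X in _ * X]horner_prod [X in _ * X](bigD1 i) //= Z mul0r mulr0.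
have [s0 s0P] : exists s, (Q * 'X).[s] != 0.
  apply: poly_nonroot; rewrite mulf_neq0 ?polyX_eq0 //.
  by apply/eqP => QE; move: P0id; rewrite -Q0 QE horner0 eqxx.
have [Qs sn0] : Q.[s0] != 0 /\ s0 != 0.
  by move: s0P; rewrite hornerM hornerX mulf_eq0 negb_or => /andP[].
pose v (p : 'I_m * 'I_m) : R := if p.1 == p.2 then 1 else s0.
pose e (p : 'I_m * 'I_m) : {poly R} := v p *: truncexp (lam p).
pose q i j : {poly R} := e (i, j) - (v (i, j))%:P.
have sortC i j : sortp (i, j) = sortp (j, i) :> ('I_m * 'I_m).
  rewrite /sortp /=; case: ltngtP => // ij.
  by have -> : i = j by apply/val_inj.
have qC i j : q i j = q j i.
  by rewrite /q /e /v /lam sortC /= eq_sym.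
exists q; split=> // [i j|].
  rewrite coefB coefZ (truncexpP (lam (i, j))) // coefC eqxx expr0 fact0 divr1.
  by rewrite mulr1 subrr.
(* The first [a] columns are already independent. *)
suff ua : jetmx a q \in unitmx.
  have E : jetmx a q = colsub (widen_ord al) (jetmx l q).
    by apply/matrixP => r h; rewrite !mxE; case: splitP => r' _; rewrite !mxE.
  rewrite /row_free eqn_leq rank_leq_row /= -{1}(mxrank_unit ua) E.
  by rewrite -{1}[jetmx l q]mulmx1 -mulmx_colsub mxrankM_maxl.
rewrite unitmxE unitfE -det_tr; apply/negP => /det0P[c c0 cM].
pose f (p : {poly R}) : R := \sum_(h < a) c 0 h * (p`_h.+1 *+ h.+1`!).
have fD : {morph f : p r / p + r}.
  move=> p r; rewrite /f -big_split; apply: eq_bigr => h _ /=.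
  by rewrite coefD mulrnDl mulrDr.
have fZ (d : R) p : f (d *: p) = d * f p.
  rewrite /f mulr_sumr; apply: eq_bigr => h _.
  by rewrite coefZ -mulrnAr mulrCA.
have row0 r : \sum_h c 0 h * jetmx a q r h = 0.
  have := congr1 (fun M : 'rV[R]_a => M 0 r) cM; rewrite mxE [RHS]mxE => E.
  by rewrite -[RHS]E; apply: eq_bigr => h _; rewrite [in RHS]mxE.
have fdet : f (\det (\matrix_(i, j) q i j)) = 0.
  rewrite -[RHS](row0 (lshift _ 0)); apply: eq_bigr => h _.
  by rewrite /jetmx col_mxEu mxE.
have fmon be : be \in monomials m -> f (\prod_p q p.1 p.2 ^+ be p) = 0.
  move=> /(tnthP (in_tuple (monomials m)))[r ->].
  rewrite -[RHS](row0 (rshift 1 r)); apply: eq_bigr => h _.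
  by rewrite /jetmx col_mxEd mxE.
have f1 : f 1 = 0.
  by rewrite /f big1 // => h _; rewrite coefC /= mul0rn mulr0.
have qsort p : q (sortp p).1 (sortp p).2 = q p.1 p.2.
  by rewrite /sortp; case: ifP.
have fW k (i j : {ffun 'I_k -> 'I_m}) (W : {set 'I_k}) : injective i -> injective j ->
    (#|W| < m)%N -> f (\prod_(b in W) q (i b) (j b)) = 0.
  move=> ii ij Wm; have [W0|W0] := posnP #|W|.
    by rewrite (cards0_eq W0) big_set0.
  pose i' : {ffun 'I_#|W| -> 'I_m} := [ffun b => i (enum_val b)].
  pose j' : {ffun 'I_#|W| -> 'I_m} := [ffun b => j (enum_val b)].
  have inji : injective i' by move=> b1 b2; rewrite !ffunE => /ii/enum_val_inj.
  have injj : injective j' by move=> b1 b2; rewrite !ffunE => /ij/enum_val_inj.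
  have /fmon : monomial i' j' \in monomials m by apply: monomial_mem; rewrite ?W0.
  rewrite (prod_monomial (fun p => q p.1 p.2)) => <-; congr (f _).
  by rewrite big_enum_val; apply: eq_bigr => b _; rewrite qsort /= !ffunE.
have fE k (i j : {ffun 'I_k -> 'I_m}) : injective i -> injective j -> (k <= m)%N ->
    f (\prod_b e (i b, j b)) = f (\prod_b q (i b) (j b)).
  move=> ii ij km.
  have dT : [disjoint [set: 'I_k] & finset.set0] by rewrite -setI_eq0 finset.setI0.
  have := @shift_prod 'I_k (fun b => q (i b) (j b)) (fun b => e (i b, j b))
    (fun b => v (i b, j b)) f m fD fZ _ (fun W => fW k i j W ii ij) _ _ dT.
  rewrite cardsT card_ord cards0 addn0 big_set0 mulr1 finset.setU0.
  under eq_bigl do rewrite inE; under [in RHS]eq_bigl do rewrite inE.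
  by apply=> // b; rewrite /q subrK.
(* [f (exp (mu X))], as a polynomial in [mu]. *)
pose P : {poly R} := \poly_(h < a.+1) (if h is h'.+1 then
   (if insub h' is Some h'' then c 0 h'' else 0) else 0).
have PE y : P.[y] = \sum_(h < a) c 0 h * y ^+ h.+1.
  rewrite /P horner_poly big_ord_recl /= mul0r add0r.
  by apply: eq_bigr => h _; rewrite add0n valK.
have fP p y : expjet p y -> f p = P.[y].
  move=> hp; rewrite PE; apply: eq_bigr => h _; rewrite hp ?ltn_ord //.
  by rewrite -[_ *+ h.+1`!]mulr_natr divfK ?factr_neq0.
have fexp k (i j : {ffun 'I_k -> 'I_m}) :
    f (\prod_b e (i b, j b)) = (\prod_b v (i b, j b)) * P.[mu (monomial i j)].
  rewrite scaler_prod fZ; congr (_ * _); rewrite -muE; apply: fP.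
  by apply: expjet_prod => b; exact: truncexpP.
have vn0 p : v p != 0 by rewrite /v; case: ifP => _; rewrite ?oner_eq0.
have Pmu be : be \in monomials m -> P.[mu be] = 0.
  move=> hbe; have /monomialsP[k [i [j [/andP[k0 km] ii ij E]]]] := hbe.
  have := fexp k i j; rewrite fE // ?(ltnW km) //.
  have -> : \prod_b q (i b) (j b) = \prod_p q p.1 p.2 ^+ be p.
    by rewrite E (prod_monomial (fun p => q p.1 p.2)); apply: eq_bigr => b _; rewrite qsort.
  rewrite fmon // -E => /esym/eqP; rewrite mulf_eq0 prodf_seq_eq0.
  by case/orP => [/hasP[b _]|/eqP //]; rewrite /= (negbTE (vn0 _)).
have Pn0 : P != 0.
  apply: contraNneq c0 => P00; apply/eqP/rowP => h; rewrite mxE.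
  have : P`_h.+1 = 0 by rewrite P00 coef0.
  by rewrite coef_poly ltnS ltn_ord valK.
have Proots : all (root P) rs.
  apply/allP => r; rewrite inE => /orP[/eqP ->|/mapP[be hbe ->]]; last first.
    by rewrite /root Pmu.
  by rewrite /root PE big1 // => h _; rewrite expr0n mulr0.
have sP : size P = (size rs).+1.
  apply/eqP; rewrite eqn_leq (max_poly_roots Pn0 Proots urs) andbT.
  by rewrite /rs /= size_map -add1n; exact: size_poly.
pose lc := lead_coef P.
have lc0 : lc != 0 by rewrite lead_coef_eq0.
have PP0 : P = lc *: P0.
  by apply: all_roots_prod_XsubC => //; rewrite uniq_rootsE.
have : lc * Q.[s0] = 0.
  rewrite -[RHS]fdet /determinant.
  have fsum (I : finType) (F : I -> {poly R}) : f (\sum_b F b) = \sum_b f (F b).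
    by apply: (big_morph f fD); rewrite /f big1 // => h _; rewrite coef0 mul0rn mulr0.
  rewrite fsum horner_sum mulr_sumr; apply: eq_bigr => s _.
  pose sf : {ffun 'I_m -> 'I_m} := [ffun i => s i].
  have -> : (-1) ^+ s * \prod_i (\matrix_(i, j) q i j) i (s i) =
      ((-1) ^+ s : R) *: \prod_i q (idm i) (sf i).
    rewrite -mul_polyC; congr (_ * _); first by rewrite rmorph_sign.
    by apply: eq_bigr => i _; rewrite mxE !ffunE.
  rewrite fZ -fE //; last by move=> i j; rewrite !ffunE => /perm_inj.
  rewrite fexp PP0 !hornerZ -/sf.
  have V : (\prod_(i < m) (if i == s i then 1 else 'X : {poly R})).[s0] = \prod_b v (idm b, sf b).
    rewrite horner_prod; apply: eq_bigr => i _; rewrite !ffunE /v /=.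
    by case: eqP => _; rewrite ?hornerC ?hornerX.
  rewrite V; exact: mul_shuffle.
by move/eqP; rewrite mulf_eq0 (negbTE lc0) (negbTE Qs).
Qed.

End GenericJets.

Import numFieldNormedType.Exports.
Local Open Scope classical_set_scope.
Local Open Scope ring_scope.

(** * Partial derivatives and smooth functions *)

Section RowTopology.
Context {R : realType} {N : nat}.
Implicit Types (z w a b c : 'rV[R]_N).

Lemma nbhs_cubeP z (B : set 'rV[R]_N) :
  nbhs z B <-> exists2 r : R, 0 < r &
    forall w, (forall i, `|w 0 i - z 0 i| < r) -> B w.
Proof.
split=> [/nbhs_ballP[r /= r0 rB]|[r r0 rB]].
  exists r => // w wz; apply: rB; split=> // i j.
  by rewrite (ord1 i) /ball /= distrC.
apply/nbhs_ballP; exists r => //= w [_ wz]; apply: rB => i.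
by have := wz 0 i; rewrite /ball /= distrC.
Qed.

Lemma cvg_rowP (T : Type) (F : set_system T) (FF : Filter F)
    (g : T -> 'rV[R]_N) z :
  g @ F --> z <-> forall i, (fun t => g t 0 i) @ F --> z 0 i.
Proof.
split=> [gz i|gz].
  apply/cvgrPdist_lt => r r0.
  have : nbhs z (fun w => forall i, `|w 0 i - z 0 i| < r).
    by apply/nbhs_cubeP; exists r.
  move=> /gz H; near=> t.
  have : forall i, `|g t 0 i - z 0 i| < r by near: t.
  by move=> /(_ i); rewrite distrC.
move=> B /nbhs_cubeP[r r0 rB].
have : \forall t \near F, forall i, `|g t 0 i - z 0 i| < r.
  apply: filter_forall => i.
  have /cvgrPdist_lt /(_ _ r0) := gz i.
  by apply: filterS => t; rewrite distrC.
by apply: filterS => t; exact: rB.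
Unshelve. all: by end_near. Qed.

End RowTopology.

Section MeanValue.
Context {R : realType}.

Lemma cvg_dist_lt (T : Type) (F : set_system T) (FF : Filter F) (g : T -> R)
    (l eps : R) :
  g @ F --> l -> 0 < eps -> \forall t \near F, `|g t - l| < eps.
Proof. by move=> gl eps0; apply: cvgr_distC_lt. Qed.

Lemma cvg_shift0 (t : R) : (fun h : R => h + t) @ 0^' --> t.
Proof.
have : (fun h : R => h + t) @ 0 --> 0 + t by apply: cvgD; [exact: cvg_id|exact: cvg_cst].
by rewrite add0r => /cvg_within_filter; apply.
Qed.

Definition betw (x y u : R) : Prop := Num.min x y <= u <= Num.max x y.

Lemma betw_sym x y u : betw x y u -> betw y x u.
Proof. by rewrite /betw minC maxC. Qed.

Lemma betw_dist x y z u (r : R) :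
  betw x y u -> `|x - z| < r -> `|y - z| < r -> `|u - z| < r.
Proof.
rewrite /betw !ltr_norml; move=> /andP[].
by case: (leP x y) => h *; lra.
Qed.

Lemma dist_half (q a b eps : R) :
  `|q - a| < eps / 2 -> `|q - b| < eps / 2 -> `|b - a| < eps.
Proof. by rewrite !ltr_norml; lra. Qed.

Lemma mvt_betw (g dg : R -> R) x y :
  (forall u, betw x y u -> is_derive u 1 g (dg u)) ->
  exists2 u, betw x y u & g y - g x = dg u * (y - x).
Proof.
wlog xy : x y / x <= y => [hw|] H.
  have [xy|/ltW yx] := leP x y; first exact: hw.
  have [u uyx E] := hw y x yx (fun u h => H u (betw_sym h)).
  exists u; first exact: betw_sym.
  by rewrite -(opprB x y) mulrN -E opprB.
have B u : u \in `[x, y] -> betw x y u.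
  by rewrite in_itv /= /betw min_l // max_r.
have D u : u \in `]x, y[ -> is_derive u 1 g (dg u).
  by move=> h; apply/H/B; apply: subset_itv_oo_cc.
have [|u uxy E] := MVT_segment xy D.
  apply: derivable_within_continuous => u uxy.
  by have := H u (B _ uxy) => -[].
by exists u => //; apply: B.
Qed.

End MeanValue.

Section PartialDerivatives.
Context {R : realType} {N : nat}.
Implicit Types (z w a b c : 'rV[R]_N) (f g : 'rV[R]_N -> R).
Local Notation e i := (delta_mx 0 i : 'rV[R]_N).

Lemma addeE z u i j : (z + u *: e i) 0 j = z 0 j + u * (j == i)%:R.
Proof. by rewrite !mxE eqxx. Qed.

Lemma is_derive_line f z i u : derivable f (z + u *: e i) (e i) ->
  is_derive u 1 (fun s => f (z + s *: e i)) (pd i f (z + u *: e i)).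
Proof.
have E : (fun h : R => h^-1 *: (f (h *: e i + (z + u *: e i))
                          - f (z + u *: e i))) =
   (fun h : R => h^-1 *: (f (z + (h *: (1:R) + u) *: e i) - f (z + u *: e i))).
  apply/funext => h; congr (_ *: (f _ - _)).
  by rewrite -[h%:A]/(h * 1) mulr1 scalerDl addrCA.
rewrite /derivable /= E => D; apply: DeriveDef; first exact: D.
by rewrite /pd /derive /= E.
Qed.

Definition hull a b c : Prop := forall i, betw (a 0 i) (b 0 i) (c 0 i).

(** Moving from [a] to [b] one coordinate at a time reduces the mean value
    theorem in several variables to the one in a single variable, where
    only partial derivatives enter. *)
Lemma mvt_pd f a b :
  (forall c i, hull a b c -> derivable f c (e i)) ->
  exists2 zeta : 'I_N -> 'rV[R]_N, (forall i, hull a b (zeta i)) &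
    f b - f a = \sum_i pd i f (zeta i) * (b 0 i - a 0 i).
Proof.
move=> df.
pose c k : 'rV[R]_N := \row_i (if (i < k)%N then b 0 i else a 0 i).
have cE (k : 'I_N) : c k.+1 = c k + (b 0 k - a 0 k) *: e k.
  apply/rowP => i; rewrite addeE !mxE ltnS leq_eqVlt.
  have [->|ik] := eqVneq i k; first by rewrite eqxx ltnn mulr1 addrC subrK.
  by rewrite (negbTE ik : (i == k :> nat) = false) mulr0 addr0.
have c0 : c 0%N = a by apply/rowP => i; rewrite mxE.
have cN : c N = b by apply/rowP => i; rewrite mxE ltn_ord.
have [zeta zP] : exists zeta : 'I_N -> 'rV[R]_N, forall k, hull a b (zeta k) /\
   f (c k.+1) - f (c k) = pd k f (zeta k) * (b 0 k - a 0 k).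
  suff S (k : 'I_N) : exists z, hull a b z /\
     f (c k.+1) - f (c k) = pd k f z * (b 0 k - a 0 k) by have [g gP] := boolp.choice S; exists g.
  have hl u : betw 0 (b 0 k - a 0 k) u -> hull a b (c k + u *: e k).
    move=> hu i; rewrite addeE !mxE.
    have [->|ik] := eqVneq i k.
      rewrite ltnn mulr1; move: hu; rewrite /betw.
      by case: (leP 0 (b 0 k - a 0 k)); case: (leP (a 0 k) (b 0 k)); lra.
    rewrite mulr0 addr0 /betw; case: ifP => _.
      by rewrite ge_min le_max !lexx !orbT.
    by rewrite ge_min le_max !lexx.
  have [u hu E] := @mvt_betw R (fun u => f (c k + u *: e k))
     (fun u => pd k f (c k + u *: e k)) 0 (b 0 k - a 0 k)
     (fun u hu => is_derive_line (df _ k (hl u hu))).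
  exists (c k + u *: e k); split; first exact: hl.
  by move: E; rewrite -cE scale0r addr0 subr0.
exists zeta; first by move=> i; case: (zP i).
rewrite -[in LHS]cN -[in LHS]c0 -(@telescope_sumr _ 0 N (f \o c)) //.
by rewrite big_mkord; apply: eq_bigr => k _; case: (zP k).
Qed.

Lemma hull_dist a b c z r : hull a b c ->
  (forall i, `|a 0 i - z 0 i| < r) -> (forall i, `|b 0 i - z 0 i| < r) ->
  forall i, `|c 0 i - z 0 i| < r.
Proof. by move=> h ha hb i; apply: betw_dist (h i) (ha i) (hb i). Qed.

Lemma cvg_hull (T : Type) (F : set_system T) (FF : Filter F)
   (a b c : T -> 'rV[R]_N) z : a @ F --> z -> b @ F --> z ->
   (\forall t \near F, hull (a t) (b t) (c t)) -> c @ F --> z.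
Proof.
move=> az bz abc B /nbhs_cubeP[r r0 rB].
have az' : \forall t \near F, forall i, `|a t 0 i - z 0 i| < r.
  by apply: (az (fun w => forall i, `|w 0 i - z 0 i| < r)); apply/nbhs_cubeP; exists r.
have bz' : \forall t \near F, forall i, `|b t 0 i - z 0 i| < r.
  by apply: (bz (fun w => forall i, `|w 0 i - z 0 i| < r)); apply/nbhs_cubeP; exists r.
suff : \forall t \near F, B (c t) by [].
near=> t; apply: rB.
apply: (@hull_dist (a t) (b t)); [by near: t|by near: t|by near: t].
Unshelve. all: by end_near. Qed.

(** The points supplied by the mean value theorem converge to [gam t], and the
    partial derivatives are continuous there. *)
Lemma is_derive_curve f (gam : R -> 'rV[R]_N) (dgam : 'rV[R]_N) t :
  (\forall w \near gam t, forall i, derivable f w (e i)) ->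
  (forall i, {for gam t, continuous (pd i f)}) ->
  (forall i, is_derive t 1 (fun s => gam s 0 i) (dgam 0 i)) ->
  is_derive t 1 (fun s => f (gam s)) (\sum_i pd i f (gam t) * dgam 0 i).
Proof.
move=> df cf dg.
have gc : gam @ t --> gam t.
  apply/cvg_rowP => i.
  have /derivable1_diffP/differentiable_continuous : derivable (fun s => gam s 0 i) t 1 by case: (dg i).
  by [].
have shc := @cvg_shift0 R t.
have ghc : (fun h => gam (h + t)) @ 0^' --> gam t by apply: cvg_comp shc gc.
have [r r0 rdf] := (nbhs_cubeP _ _).1 df.
pose P (h : R) (zeta : 'I_N -> 'rV[R]_N) := (forall i, hull (gam t) (gam (h + t)) (zeta i)) /\
    f (gam (h + t)) - f (gam t) = \sum_i pd i f (zeta i) * (gam (h + t) 0 i - gam t 0 i).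
pose zet h := if pselect (exists zeta, P h zeta) is left H then projT1 (cid H) else fun=> 0.
have Pz : \forall h \near 0^', P h (zet h).
  have near1 : \forall h \near 0^', forall i, `|gam (h + t) 0 i - gam t 0 i| < r.
    by apply: (ghc (fun w => forall i, `|w 0 i - gam t 0 i| < r)); apply/nbhs_cubeP; exists r.
  near=> h; rewrite /zet; case: pselect => [H|]; first exact: projT2 (cid H).
  case; have [|zeta z1 z2] := @mvt_pd f (gam t) (gam (h + t)).
    move=> c i hc; apply: rdf; apply: (hull_dist hc) => {}i.
      by rewrite subrr normr0.
    exact: (near near1 h).
  by exists zeta.
have zc i : (fun h => zet h i) @ 0^' --> gam t.
  apply: (@cvg_hull _ _ _ (fun=> gam t) (fun h => gam (h + t))) => //.
    exact: cvg_cst.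
  by apply: filterS Pz => h [/(_ i)].
have main : (fun h : R => h^-1 *: (f (gam (h *: (1:R) + t)) - f (gam t))) @ 0^' -->
    \sum_i pd i f (gam t) * dgam 0 i.
  pose G h : R := \sum_i pd i f (zet h i) * (h^-1 *: (gam (h *: (1:R) + t) 0 i - gam t 0 i)).
  have GE : {near 0^', G =1 (fun h : R => h^-1 *: (f (gam (h *: (1:R) + t)) - f (gam t)))}.
    near=> h; rewrite /G.
    have [_ E] : P h (zet h) by near: h.
    rewrite -[h%:A]/(h * 1) mulr1 E -[_ *: _]/(_ * _) mulr_sumr.
    by apply: eq_bigr => i _; rewrite -[_ *: _]/(_ * _) mulrCA.
  apply: cvg_trans (near_eq_cvg GE) _ => /=.
  apply: cvg_big => [|i _]; first exact: add_continuous.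
  apply: cvgM.
    exact: (cvg_comp _ _ (zc i) (cf i)).
  have [d1 d2] := dg i.
  by move: d1; rewrite -d2 /derivable /derive /=; apply.
apply: DeriveDef.
  by apply/cvg_ex; exists (\sum_i pd i f (gam t) * dgam 0 i).
by apply/cvg_lim.
Unshelve. all: by end_near. Qed.

End PartialDerivatives.

Section SmoothOn.
Context {R : realType} {N : nat}.
Implicit Types (z w a b c : 'rV[R]_N) (f g : 'rV[R]_N -> R) (U : set 'rV[R]_N).
Local Notation e i := (delta_mx 0 i : 'rV[R]_N).

Lemma pds_cat s1 s2 f : pds (s1 ++ s2) f = pds s1 (pds s2 f).
Proof. by rewrite /pds foldr_cat. Qed.

Lemma smooth_pds U s f : smooth_on U f -> smooth_on U (pds s f).
Proof. by move=> fU s' z; rewrite -pds_cat; exact: fU. Qed.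

Lemma smooth_pd U i f : smooth_on U f -> smooth_on U (pd i f).
Proof. exact: (@smooth_pds U [:: i]). Qed.

Lemma smooth_derivable U f z i : smooth_on U f -> U z -> derivable f z (e i).
Proof. by move=> fU Uz; case: (fU [::] z Uz) => _; apply. Qed.

Arguments smooth_derivable {U f z} i _ _.

Lemma smooth_continuous U f z : smooth_on U f -> U z -> {for z, continuous f}.
Proof. by move=> fU Uz; case: (fU [::] z Uz). Qed.

Lemma eq_pd_open U f g i z : open U -> {in U, f =1 g} -> U z -> pd i f z = pd i g z.
Proof.
move=> oU fg Uz; apply: near_eq_derive.
by apply: filterS (open_nbhs_nbhs (conj oU Uz)) => w Uw; apply/fg/mem_set.
Qed.

Lemma eq_pds_open U f g s : open U -> {in U, f =1 g} ->
  {in U, pds s f =1 pds s g}.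
Proof.
move=> oU fg; elim: s => [//|i s IH] z /set_mem Uz.
exact: eq_pd_open IH Uz.
Qed.

Lemma pdsDZ U f g (k : R) s : open U -> smooth_on U f -> smooth_on U g ->
  {in U, pds s (fun z => f z + k * g z) =1 (fun z => pds s f z + k * pds s g z)}.
Proof.
move=> oU fU gU; elim: s => [//|i s IH] z /set_mem Uz.
rewrite /= (eq_pd_open i oU IH Uz) /pd.
have df := smooth_derivable i (smooth_pds s fU) Uz.
have dg := smooth_derivable i (smooth_pds s gU) Uz.
by rewrite (deriveD df (derivableZ (k := k) dg)) deriveZ.
Qed.

Lemma smoothDZ U f g (k : R) : open U -> smooth_on U f -> smooth_on U g ->
  smooth_on U (fun z => f z + k * g z).
Proof.
move=> oU fU gU s z Uz.
have nE : {near z, (fun z => pds s f z + k * pds s g z) =1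
               pds s (fun z => f z + k * g z)}.
  apply: filterS (open_nbhs_nbhs (conj oU Uz)) => w /mem_set Uw.
  by rewrite (pdsDZ k s oU fU gU).
have [cf df] := fU s z Uz; have [cg dg] := gU s z Uz.
split=> [|i].
  rewrite /prop_for /continuous_at -(nbhs_singleton nE).
  apply: cvg_trans (near_eq_cvg nE) _.
  by apply: cvgD => //; apply: cvgM => //; exact: cvg_cst.
by apply: near_eq_derivable nE _; apply: derivableD => //; apply: derivableZ.
Qed.

(** Both orders of differentiation are limits of the same second difference
    quotient. *)
Lemma schwarz U f i j z : open U -> smooth_on U f -> U z ->
  pd i (pd j f) z = pd j (pd i f) z.
Proof.
move=> oU fU Uz.
have key (k : 'I_N) (l : 'I_N) (eps : R) : 0 < eps -> exists2 del : R, 0 < del &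
    forall h, 0 < h < del ->
     `|(f (z + h *: e k + h *: e l) - f (z + h *: e k) - f (z + h *: e l) + f z) / (h * h) - pd l (pd k f) z| < eps.
  move=> eps0.
  have cc : {for z, continuous (pd l (pd k f))} by exact: smooth_continuous (smooth_pds [:: l; k] fU) Uz.
  have : \forall w \near z, U w /\ `|pd l (pd k f) w - pd l (pd k f) z| < eps.
    apply: filterI; first exact: open_nbhs_nbhs.
    exact: cvg_dist_lt cc eps0.
  move=> /nbhs_cubeP[r r0 rP].
  exists (r / 2) => [|h /andP[h0 hr]]; first lra.
  have inr (s t : R) : betw 0 h s -> betw 0 h t -> forall m, `|(z + s *: e k + t *: e l) 0 m - z 0 m| < r.
    rewrite /betw !min_l ?max_r; try lra.
    move=> /andP[s0 sh] /andP[t0 th] m; rewrite !addeE.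
    rewrite (_ : _ - _ = s * (m == k)%:R + t * (m == l)%:R); last by ring.
    have b1 (b : bool) (x : R) : 0 <= x <= h -> 0 <= x * b%:R <= h by case: b => /=; lra.
    have := b1 (m == k) s; have := b1 (m == l) t.
    by rewrite s0 sh t0 th => /(_ isT) ? /(_ isT) ?; rewrite ltr_norml; lra.
  have b0 : betw 0 h 0 by rewrite /betw min_l ?max_r; lra.
  have bh : betw 0 h h by rewrite /betw min_l ?max_r; lra.
  pose g (s : R) := f (z + h *: e l + s *: e k) - f (z + s *: e k).
  have Dg s : betw 0 h s -> is_derive s 1 g (pd k f (z + h *: e l + s *: e k) - pd k f (z + s *: e k)).
    move=> hs; apply: is_deriveB; apply: is_derive_line.
      apply: (smooth_derivable k fU).
      by rewrite addrAC; case: (rP _ (inr s h hs bh)).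
    apply: (smooth_derivable k fU).
    by have := inr s 0 hs b0; rewrite scale0r addr0 => /rP[].
  have [s hs Es] := mvt_betw Dg.
  have Dk t : betw 0 h t -> is_derive t 1 (fun t => pd k f (z + s *: e k + t *: e l)) (pd l (pd k f) (z + s *: e k + t *: e l)).
    move=> ht; apply: is_derive_line.
    apply: (smooth_derivable l (smooth_pd k fU)).
    by case: (rP _ (inr s t hs ht)).
  have [t ht Et] := mvt_betw Dk.
  have [_] := rP _ (inr s t hs ht); congr (`|_ - _| < _).
  apply: (canRL (mulfK _)); first by rewrite mulf_neq0 // gt_eqF.
  move: Es Et; rewrite /g !subr0 !scale0r !addr0 (addrAC z (h *: e l)) => Es Et.
  rewrite (addrAC z (h *: e l)) Et in Es.
  by rewrite mulrA -Es opprB addrA addrAC.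
apply/eqP; rewrite -subr_eq0; apply/negPn/negP => ne0.
set D := _ - _ in ne0.
have D0 : 0 < `|D| / 2 by rewrite divr_gt0 // normr_gt0.
have [d1 d10 P1] := key i j _ D0.
have [d2 d20 P2] := key j i _ D0.
pose h := Num.min d1 d2 / 2.
have h0 : 0 < h by rewrite /h divr_gt0 // lt_min d10.
have hm : h < Num.min d1 d2 by rewrite /h ltr_pdivrMr // ltr_pMr ?lt_min ?d10 //; lra.
move: hm; rewrite lt_min => /andP[hd1 hd2].
have := P1 h; rewrite h0 hd1 => /(_ isT) Q1.
have := P2 h; rewrite h0 hd2 => /(_ isT).
rewrite (addrAC z) [in X in X / _](addrAC (f _)) => Q2.
by have := dist_half Q1 Q2; rewrite ltxx.
Qed.

Lemma pds_swap U f i s : open U -> smooth_on U f ->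
  {in U, pds (i :: s) f =1 pds (rcons s i) f}.
Proof.
move=> oU fU; elim: s => [//|j s IH] z /set_mem Uz.
rewrite [LHS](schwarz _ _ oU (smooth_pds s fU) Uz).
exact: eq_pd_open IH Uz.
Qed.

Lemma pds_perm U f s t : open U -> smooth_on U f -> perm_eq s t ->
  {in U, pds s f =1 pds t f}.
Proof.
move=> oU fU; elim: s t => [|i s IH] t st z Uz.
  by rewrite perm_sym in st; rewrite (perm_small_eq _ st).
have it : i \in t by rewrite -(perm_mem st) mem_head.
case/path.splitPr: it st => t1 t2; rewrite perm_sym -cat1s perm_catCA perm_cons => st.
rewrite perm_sym in st.
rewrite [LHS](eq_pd_open i oU (IH _ st) (set_mem Uz)) pds_cat.
rewrite -[LHS]/(pds (i :: t1) (pds t2 f) z) (pds_swap i t1 oU (smooth_pds t2 fU) Uz).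
by rewrite -cats1 -!pds_cat catA.
Qed.

(** The seminorms only know multi-indices: the order of differentiation must
    be seen to be irrelevant. *)
Lemma pd_multiE U f s : open U -> smooth_on U f ->
  {in U, pds s f =1 pd_multi [ffun i => count_mem i s] f}.
Proof.
move=> oU fU; apply: (pds_perm oU fU).
apply/allP => x _; apply/eqP; rewrite count_flatten -map_comp.
rewrite sumnE big_map big_enum /= (bigD1 x) //=.
rewrite count_nseq /=  ffunE eqxx mul1n.
rewrite big1 ?addn0 // => i ix.
by rewrite count_nseq /= (negbTE ix).
Qed.

End SmoothOn.
Arguments smooth_derivable {R N U f z} i _ _.
Arguments smooth_pd {R N U} i {f} _.
Arguments smooth_pds {R N U} s {f} _.
Arguments smooth_continuous {R N U f z} _ _.

(** * Limits of matrices *)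

Section MatrixLimits.
Context {R : realType} {T : Type} {F : set_system T} {FF : Filter F}.

Lemma cvg_sumR (I : Type) (r : seq I) (P : pred I) (f : I -> T -> R) (l : I -> R) :
  (forall i, P i -> f i @ F --> l i) ->
  (fun t => \sum_(i <- r | P i) f i t) @ F --> \sum_(i <- r | P i) l i.
Proof. by move=> h; apply: cvg_big => //; exact: add_continuous. Qed.

Lemma cvg_prodR (I : Type) (r : seq I) (P : pred I) (f : I -> T -> R) (l : I -> R) :
  (forall i, P i -> f i @ F --> l i) ->
  (fun t => \prod_(i <- r | P i) f i t) @ F --> \prod_(i <- r | P i) l i.
Proof. by move=> h; apply: cvg_big => //; exact: mul_continuous. Qed.

Lemma cvg_det k (M : T -> 'M[R]_k) (M0 : 'M[R]_k) :
  (forall i j, (fun t => M t i j) @ F --> M0 i j) ->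
  (fun t => \det (M t)) @ F --> \det M0.
Proof.
move=> h; rewrite /determinant; apply: cvg_sumR => s _.
by apply: cvgM; [exact: cvg_cst|apply: cvg_prodR => i _; exact: h].
Qed.

Lemma cvg_mulmx a b c (M : T -> 'M[R]_(a, b)) (N : T -> 'M[R]_(b, c)) (M0 : 'M[R]_(a, b))
    (N0 : 'M[R]_(b, c)) :
  (forall i j, (fun t => M t i j) @ F --> M0 i j) ->
  (forall i j, (fun t => N t i j) @ F --> N0 i j) ->
  forall i j, (fun t => (M t *m N t) i j) @ F --> (M0 *m N0) i j.
Proof.
move=> hM hN i j; rewrite mxE; under eq_cvg do rewrite mxE.
by apply: cvg_sumR => k _; apply: cvgM; [exact: hM|exact: hN].
Qed.

Lemma cvg_one_sub_mul k (M : T -> 'M[R]_k) (M0 C : 'M[R]_k) :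
  (forall i j, (fun t => M t i j) @ F --> M0 i j) ->
  forall i j, (fun t => (1%:M - C *m M t) i j) @ F --> (1%:M - C *m M0) i j.
Proof.
move=> hM i j.
have E (A : 'M[R]_k) : (1%:M - C *m A) i j = (1%:M : 'M[R]_k) i j - (C *m A) i j.
  by rewrite [LHS]mxE [X in _ + X]mxE.
rewrite E; under eq_cvg do rewrite E.
apply: cvgB; first exact: cvg_cst.
by apply: cvg_mulmx => // *; exact: cvg_cst.
Qed.

Lemma near_unitmx k (M : T -> 'M[R]_k) (M0 : 'M[R]_k) :
  (forall i j, (fun t => M t i j) @ F --> M0 i j) -> M0 \in unitmx ->
  \forall t \near F, M t \in unitmx.
Proof.
move=> h; rewrite unitmxE unitfE => d0.
apply: filterS (cvgr_neq0 _ (cvg_det h) d0) => t.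
by rewrite unitmxE unitfE.
Qed.

Lemma cvg_invmx k (M : T -> 'M[R]_k) (M0 : 'M[R]_k) :
  (forall i j, (fun t => M t i j) @ F --> M0 i j) -> M0 \in unitmx ->
  forall i j, (fun t => invmx (M t) i j) @ F --> invmx M0 i j.
Proof.
move=> h uM i j.
have E : {near F, (fun t => (\det (M t))^-1 * cofactor (M t) j i) =1
                  (fun t => invmx (M t) i j)}.
  apply: filterS (near_unitmx h uM) => t ut.
  by rewrite /invmx ut !mxE.
apply: cvg_trans (near_eq_cvg E) _.
rewrite /invmx uM !mxE; apply: cvgM.
  apply: cvgV; last exact: cvg_det.
  by move: uM; rewrite unitmxE unitfE.
rewrite /cofactor; apply: cvgM; first exact: cvg_cst.
apply: cvg_det => a b; rewrite !mxE; under eq_cvg do rewrite !mxE.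
exact: h.
Qed.

End MatrixLimits.
Arguments cvg_invmx {R T F FF k M M0} _ _ i j.
Arguments cvg_mulmx {R T F FF a b c M N M0 N0} _ _ i j.
Arguments cvg_one_sub_mul {R T F FF k M M0} C _ i j.

(** * The coordinates [(x, t; y)] *)

Section Coordinates.
Context {R : realType} {m : nat}.
Implicit Types (z w : 'rV[R]_(m + 1 + m)) (x y : 'rV[R]_m).

Definition xi (i : 'I_m) : 'I_(m + 1 + m) := bxi (lshift 1 i).
Definition ti : 'I_(m + 1 + m) := bxi (rshift m 0).

Lemma pt_x x (t : R) y i : pt x t y 0 (xi i) = x 0 i.
Proof. by rewrite /pt /xi /bxi !row_mxEl. Qed.

Lemma pt_t x (t : R) y : pt x t y 0 ti = t.
Proof. by rewrite /pt /ti /bxi row_mxEl row_mxEr mxE. Qed.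

Lemma pt_y x (t : R) y j : pt x t y 0 (yi j) = y 0 j.
Proof. by rewrite /pt /yi row_mxEr. Qed.

Lemma xpartE z i : xpart z 0 i = z 0 (xi i).
Proof. by rewrite /xpart /bxpart !mxE. Qed.

Lemma tpartE z : tpart z = z 0 ti.
Proof. by rewrite /tpart /bxpart !mxE. Qed.

Lemma ypartE z j : ypart z 0 j = z 0 (yi j).
Proof. by rewrite /ypart mxE. Qed.

Lemma coord_ind (P : 'I_(m + 1 + m) -> Prop) :
  (forall i, P (xi i)) -> P ti -> (forall j, P (yi j)) -> forall a, P a.
Proof.
move=> Px Pt Py a; rewrite -(splitK a); case: (fintype.split a) => [b|j] /=; last exact: Py.
rewrite -(splitK b); case: (fintype.split b) => [i|k] /=; first exact: Px.
by rewrite (ord1 k); exact: Pt.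
Qed.

Lemma ptK z : pt (xpart z) (tpart z) (ypart z) = z.
Proof.
apply/rowP; apply: coord_ind => [i||j].
- by rewrite pt_x xpartE.
- by rewrite pt_t tpartE.
- by rewrite pt_y ypartE.
Qed.

Lemma xpart_pt x (t : R) y : xpart (pt x t y) = x.
Proof. by apply/rowP => i; rewrite xpartE pt_x. Qed.
Lemma tpart_pt x (t : R) y : tpart (pt x t y) = t.
Proof. by rewrite tpartE pt_t. Qed.
Lemma ypart_pt x (t : R) y : ypart (pt x t y) = y.
Proof. by apply/rowP => i; rewrite ypartE pt_y. Qed.

Lemma pt0 : pt (0 : 'rV[R]_m) (0 : R) 0 = 0.
Proof.
apply/rowP; apply: coord_ind => [i||j].
- by rewrite pt_x !mxE.
- by rewrite pt_t !mxE.
- by rewrite pt_y !mxE.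
Qed.

Lemma sum_coord (V : nmodType) (G : 'I_(m + 1 + m) -> V) :
  \sum_a G a = \sum_i G (xi i) + G ti + \sum_j G (yi j).
Proof. by rewrite !big_split_ord /= big_ord1. Qed.

Lemma cvg_enorm (T : Type) (F : set_system T) (FF : Filter F) k
    (v : T -> 'rV[R]_k) (v0 : 'rV[R]_k) :
  (forall i, (fun t => v t 0 i) @ F --> v0 0 i) ->
  (fun t => enorm (v t)) @ F --> enorm v0.
Proof.
move=> h; apply: (@cvg_comp _ _ _ _ (@Num.sqrt R) F (nbhs (\sum_i v0 0 i ^+ 2))).
  apply: cvg_sumR => i _; rewrite expr2; under eq_cvg do rewrite expr2.
  by apply: cvgM; exact: h.
exact: sqrt_continuous.
Qed.

Lemma open_box (e : R) : open (box e : set 'rV[R]_(m + 1 + m)).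
Proof.
rewrite openE => z [zx zt zy]; rewrite /interior.
have cz i : (fun w : 'rV[R]_(m + 1 + m) => w 0 i) @ z --> z 0 i.
  by have /cvg_rowP := @cvg_id _ (nbhs z); apply.
have c1 : (fun w : 'rV[R]_(m + 1 + m) => enorm (xpart w)) @ z --> enorm (xpart z).
  by apply: (@cvg_enorm _ (nbhs z) (nbhs_filter z)) => i; rewrite xpartE; under eq_cvg do rewrite xpartE; exact: cz.
have c2 : (fun w : 'rV[R]_(m + 1 + m) => enorm (ypart w)) @ z --> enorm (ypart z).
  by apply: (@cvg_enorm _ (nbhs z) (nbhs_filter z)) => i; rewrite ypartE; under eq_cvg do rewrite ypartE; exact: cz.
have c3 : (fun w : 'rV[R]_(m + 1 + m) => `|tpart w|) @ z --> `|tpart z|.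
  by rewrite tpartE; under eq_cvg do rewrite tpartE; exact: cvg_norm (cz ti).
have h1 := cvgr_lt _ c1 _ zx.
have h2 := cvgr_lt _ c2 _ zy.
have h3 := cvgr_lt _ c3 _ zt.
by apply: filterS3 (h1 _) (h2 _) (h3 _) => w.
Qed.

Lemma enorm0 k : enorm (0 : 'rV[R]_k) = 0.
Proof. by rewrite /enorm big1 ?sqrtr0 // => i _; rewrite mxE expr0n. Qed.

Lemma box0 (e : R) : 0 < e -> box e (0 : 'rV[R]_(m + 1 + m)).
Proof.
move=> e0; rewrite -pt0 /box /= xpart_pt tpart_pt ypart_pt !enorm0 normr0.
by split.
Qed.

Lemma cvg_pt (T : Type) (F : set_system T) (FF : Filter F) (x : T -> 'rV[R]_m)
    (t : T -> R) (y : T -> 'rV[R]_m) (x0 : 'rV[R]_m) (t0 : R)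
    (y0 : 'rV[R]_m) :
  (forall i, (fun s => x s 0 i) @ F --> x0 0 i) -> t @ F --> t0 ->
  (forall i, (fun s => y s 0 i) @ F --> y0 0 i) ->
  (fun s => pt (x s) (t s) (y s)) @ F --> pt x0 t0 y0.
Proof.
move=> hx ht hy; apply/cvg_rowP; apply: coord_ind => [i||j].
- by rewrite pt_x; under eq_cvg do rewrite pt_x; apply: hx.
- by rewrite pt_t; under eq_cvg do rewrite pt_t; apply: ht.
- by rewrite pt_y; under eq_cvg do rewrite pt_y; apply: hy.
Qed.

Lemma pt_bound x (t r : R) : 0 < r -> (forall i, `|x 0 i| < r) -> `|t| < r ->
  forall a, `|(pt x t (0 : 'rV[R]_m)) 0 a - (0 : 'rV[R]_(m + 1 + m)) 0 a| < r.
Proof.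
move=> r0 hx ht a; rewrite [X in _ - X]mxE subr0; move: a.
apply: coord_ind => [i||j]; first by rewrite pt_x.
  by rewrite pt_t.
by rewrite pt_y mxE normr0.
Qed.

(** For the points [(x, t, 0)] the mean value theorem involves no derivative
    in [y]. *)
Lemma mvt_xt (f : 'rV[R]_(m + 1 + m) -> R) x t x' t' :
  (forall c i, hull (pt x t 0) (pt x' t' 0) c -> derivable f c (delta_mx 0 i)) ->
  exists2 zeta : 'I_(m + 1 + m) -> 'rV[R]_(m + 1 + m),
    forall a, hull (pt x t 0) (pt x' t' 0) (zeta a) &
    f (pt x' t' 0) - f (pt x t 0) =
      \sum_i pd (xi i) f (zeta (xi i)) * (x' 0 i - x 0 i)
      + pd ti f (zeta ti) * (t' - t).
Proof.
move=> /mvt_pd[zeta h E]; exists zeta => //.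
rewrite E sum_coord [X in _ + X]big1 ?addr0; last first.
  by move=> j _; rewrite !pt_y subrr mulr0.
by rewrite !pt_t; congr (_ + _); apply: eq_bigr => i _; rewrite !pt_x.
Qed.

End Coordinates.

(** * The implicit curve *)

Lemma near_forall (X : topologicalType) (x : X) (I : finType)
    (P : I -> X -> Prop) :
  (forall i, \forall w \near x, P i w) -> \forall w \near x, forall i, P i w.
Proof. exact: filter_forall. Qed.

Lemma near_norm_lt (R : realType) (X : topologicalType) (x : X) (g : X -> R)
    (l K : R) :
  g @ x --> l -> `|l| < K -> \forall w \near x, `|g w| < K.
Proof. by move=> /cvg_norm gl; apply: cvgr_lt. Qed.

Lemma near_dist_lt (R : realType) (X : topologicalType) (x : X) (g : X -> R)
    (l eps : R) :
  g @ x --> l -> 0 < eps -> \forall w \near x, `|g w - l| < eps.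
Proof. exact: cvg_dist_lt. Qed.

Section RowNorm.
Context {R : realType} {k : nat}.

Lemma row_norm_le (v : 'rV[R]_k) (d : R) : 0 <= d ->
  (forall i, `|v 0 i| <= d) -> `|v| <= d.
Proof.
move=> d0 h; rewrite [leLHS]/Num.norm /= mx_normrE.
by apply/bigmax_leP; split=> // -[a b] _ /=; rewrite (ord1 a).
Qed.

Lemma le_row_norm (v : 'rV[R]_k) i : `|v 0 i| <= `|v|.
Proof.
rewrite [leRHS]/Num.norm /= mx_normrE.
by apply/bigmax_geP; right => /=; exists (0, i).
Qed.

Lemma compact_cube (rho : R) : compact [set x : 'rV[R]_k | forall i, `|x 0 i| <= rho].
Proof.
apply: bounded_closed_compact.
  exists `|rho|; split; first exact: num_real.
  move=> y ry x Qx /=; apply: row_norm_le.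
    exact: le_trans (normr_ge0 _) (ltW ry).
  move=> i; apply: le_trans (Qx i) _.
  exact: le_trans (ler_norm _) (ltW ry).
have -> : [set x : 'rV[R]_k | forall i, `|x 0 i| <= rho] =
    \bigcap_(i in setT) ((fun x : 'rV[R]_k => `|x 0 i|) @^-1` [set u | u <= rho]).
  by apply/seteqP; split=> x h i //; [move=> _; exact: h|exact: (h i I)].
apply: closed_bigI => i _; apply: closed_comp; last exact: closed_le.
move=> x _; have c : (fun y : 'rV[R]_k => y 0 i) @ x --> x 0 i by exact: coord_continuous.
exact: cvg_norm c.
Qed.

End RowNorm.

Section ImplicitFunction.
Context {R : realType} {m : nat}.
Local Notation N := (m + 1 + m)%N.
Variables (f : 'I_m -> 'rV[R]_N -> R) (U : set 'rV[R]_N).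
Hypotheses (oU : open U) (U0 : U 0) (fU : forall j, smooth_on U (f j)).

Definition jacx (z : 'rV[R]_N) : 'M[R]_m := \matrix_(j, i) pd (xi i) (f j) z.

Hypothesis ux : jacx 0 \in unitmx.
Let C : 'M[R]_m := invmx (jacx 0).

Lemma pd_cont j a z : U z -> {for z, continuous (pd a (f j))}.
Proof. by move=> Uz; apply: smooth_continuous (smooth_pd a (fU j)) Uz. Qed.

(** The rows of [B] are evaluated at different points, which is how the mean
    value theorem for a vector-valued map supplies them. *)
Lemma near_jac (eta : R) : 0 < eta -> exists2 r : R, 0 < r & exists K : R,
  (forall w : 'rV[R]_N, (forall a, `|w 0 a - 0| < r) -> U w) /\
  forall zeta : 'I_m -> 'I_N -> 'rV[R]_N,
    (forall j a b, `|zeta j a 0 b - 0| < r) ->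
    let B := \matrix_(j, i) pd (xi i) (f j) (zeta j (xi i)) in
    [/\ B \in unitmx, forall i k, `|(1%:M - C *m B) i k| < eta,
        forall i k, `|invmx B i k| < K & forall j, `|pd ti (f j) (zeta j ti)| < K].
Proof.
move=> eta0.
pose K : R := 1 + \sum_i \sum_j `|C i j| + \sum_j `|pd ti (f j) 0|.
have K1 i j : `|C i j| < K.
  rewrite /K (bigD1 i) //= (bigD1 j) //= -!addrA addrCA ltrDl.
  by rewrite ltr_pwDl // !addr_ge0 // ?sumr_ge0 // => *; rewrite sumr_ge0.
have K2 j : `|pd ti (f j) 0| < K.
  rewrite /K [X in _ + X](bigD1 j) //= addrCA ltrDl.
  by rewrite ltr_wpDr ?sumr_ge0 // ltr_pwDl // sumr_ge0 // => *; rewrite sumr_ge0.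
have FJ : Filter (nbhs (jacx 0)) := nbhs_filter _.
have cid i j : (fun M : 'M[R]_m => M i j) @ jacx 0 --> jacx 0 i j.
  exact: coord_continuous.
have h1 : \forall M \near jacx 0, M \in unitmx by exact: near_unitmx cid ux.
have h2 : \forall M \near jacx 0, forall ik : 'I_m * 'I_m, `|(1%:M - C *m M) ik.1 ik.2| < eta.
  apply: near_forall => -[i k] /=.
  have E : (1%:M - C *m jacx 0) i k = 0 by rewrite mulVmx // subrr mxE.
  have c := cvg_one_sub_mul C cid i k.
  rewrite E in c.
  by apply: near_norm_lt (c (nbhs_filter _)) _; rewrite normr0.
have h3 : \forall M \near jacx 0, forall ik : 'I_m * 'I_m, `|invmx M ik.1 ik.2| < K.
  apply: near_forall => -[i k] /=.
  exact: near_norm_lt (@cvg_invmx _ _ _ (nbhs_filter _) _ _ _ cid ux i k) (K1 i k).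
have [del /= del0 hdel] := (nbhs_ballP _ _).1 (filterI h1 (filterI h2 h3)).
have n1 : \forall w \near (0 : 'rV[R]_N), forall ij : 'I_m * 'I_m,
    `|pd (xi ij.1) (f ij.2) w - pd (xi ij.1) (f ij.2) 0| < del.
  by apply: near_forall => -[i j]; apply: near_dist_lt => //; exact: pd_cont.
have n2 : \forall w \near (0 : 'rV[R]_N), forall j, `|pd ti (f j) w| < K.
  apply: near_forall => j.
  exact: near_norm_lt (@pd_cont j ti 0 U0) (K2 j).
have n3 : \forall w \near (0 : 'rV[R]_N), U w by apply: open_nbhs_nbhs.
have [r r0 rP] := (nbhs_cubeP _ _).1 (filterI n1 (filterI n2 n3)).
exists r => //; exists K; split=> [w hw|zeta hz].
  by case: (rP w) => [a|_ []//]; have := hw a; rewrite mxE.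
have hz' j a b : `|zeta j a 0 b - (0 : 'rV[R]_N) 0 b| < r by rewrite mxE.
set B := \matrix_(_, _) _; have [|hB1 [hB2 hB3]] := hdel B.
  split=> // j i; rewrite /ball /= !mxE distrC.
  by have [/(_ (i, j))] := rP _ (hz' j (xi i)).
split=> //.
- by move=> i k; exact: (hB2 (i, k)).
- by move=> i k; exact: (hB3 (i, k)).
- by move=> j; have [_ []] := rP _ (hz' j ti).
Qed.

(** For fixed small [t] the Newton map [x |-> x - C (f (x, t, 0) - f 0)] with the
    frozen inverse Jacobian [C] halves distances and maps a small cube into itself.
    Its fixed point is [X t]: the point of the compact cube that is moved
    least is fixed, since its image is moved by at most half as much. *)
Lemma implicit_solution : exists r K rho del : R,
  [/\ 0 < rho < r, 0 < del < r,
   (forall w : 'rV[R]_N, (forall a, `|w 0 a - 0| < r) -> U w),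
   (forall zeta : 'I_m -> 'I_N -> 'rV[R]_N,
    (forall j a b, `|zeta j a 0 b - 0| < r) ->
    let B := \matrix_(j, i) pd (xi i) (f j) (zeta j (xi i)) in
    [/\ B \in unitmx, 
        forall i k, `|invmx B i k| < K & forall j, `|pd ti (f j) (zeta j ti)| < K]) &
   exists2 X : R -> 'rV[R]_m, X 0 = 0 &
     forall t, `|t| < del -> (forall i, `|X t 0 i| <= rho) /\
       forall j, f j (pt (X t) t 0) = f j 0].
Proof.
have eta0 : (0 : R) < (2 * m.+1%:R)^-1 by rewrite invr_gt0 mulr_gt0 // ltr0n.
have [r r0 [K [rU rB]]] := near_jac eta0.
have rU' (x : 'rV[R]_m) (t : R) : (forall i, `|x 0 i| < r) -> `|t| < r -> U (pt x t 0).
  by move=> hx ht; apply: rU => a; have := pt_bound r0 hx ht a; rewrite [X in _ - X]mxE.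
pose T t (x : 'rV[R]_m) : 'rV[R]_m :=
  \row_i (x 0 i - \sum_j C i j * (f j (pt x t 0) - f j 0)).
have contr (t : R) (x x' : 'rV[R]_m) (d : R) : `|t| < r -> (forall i, `|x 0 i| < r) -> (forall i, `|x' 0 i| < r) ->
    (forall i, `|x' 0 i - x 0 i| <= d) -> forall i, `|T t x' 0 i - T t x 0 i| <= d / 2.
  move=> ht hx hx' hd i.
  have [zeta zP] : exists zeta : 'I_m -> 'I_N -> 'rV[R]_N, forall j,
     (forall a, hull (pt x t 0) (pt x' t 0) (zeta j a)) /\
     f j (pt x' t 0) - f j (pt x t 0) =
       \sum_k pd (xi k) (f j) (zeta j (xi k)) * (x' 0 k - x 0 k).
    suff S (j : 'I_m) : exists zeta : 'I_N -> 'rV[R]_N,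
     (forall a, hull (pt x t 0) (pt x' t 0) (zeta a)) /\
     f j (pt x' t 0) - f j (pt x t 0) =
       \sum_k pd (xi k) (f j) (zeta (xi k)) * (x' 0 k - x 0 k).
      by have [g gP] := boolp.choice S; exists g.
    have [|zeta z1 z2] := @mvt_xt R m (f j) x t x' t.
      move=> c a hc; refine (smooth_derivable a (fU j) _).
      apply: rU => b; have := hull_dist hc (pt_bound r0 hx ht) (pt_bound r0 hx' ht) b.
      by rewrite [X in _ - X]mxE.
    by exists zeta; split=> //; rewrite z2 subrr mulr0 addr0.
  have hz j a b : `|zeta j a 0 b - 0| < r.
    have := hull_dist ((zP j).1 a) (pt_bound r0 hx ht) (pt_bound r0 hx' ht) b.
    by rewrite [X in _ - X]mxE.
  have [_ hB _ _] := rB zeta hz.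
  set B := \matrix_(_, _) _ in hB.
  pose D : 'cV[R]_m := \col_k (x' 0 k - x 0 k).
  have fE j : f j (pt x' t 0) - f j (pt x t 0) = (B *m D) j 0.
    by rewrite (zP j).2 mxE; apply: eq_bigr => k _; rewrite !mxE.
  have -> : T t x' 0 i - T t x 0 i = \sum_k (1%:M - C *m B) i k * (x' 0 k - x 0 k).
    transitivity (((1%:M - C *m B) *m D) i 0); last first.
      by rewrite mxE; apply: eq_bigr => k _; rewrite [D _ _]mxE.
    rewrite mulmxBl mul1mx -mulmxA [RHS]mxE [X in _ = _ + X]mxE.
    rewrite [X in _ = _ - X]mxE; under [in RHS]eq_bigr => j _ do rewrite -fE.
    rewrite [T t x' 0 i]mxE [T t x 0 i]mxE opprD opprK addrACA [D _ _]mxE; congr (_ + _).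
    rewrite addrC -sumrB -sumrN; apply: eq_bigr => j _; ring.
  apply: le_trans (ler_norm_sum _ _ _) _.
  have d0 : 0 <= d by apply: le_trans (hd i).
  apply: (@le_trans _ _ (\sum_(k < m) (2 * m.+1%:R)^-1 * d)).
    apply: ler_sum => k _; rewrite normrM.
    by apply: ler_pM => //; apply: ltW.
  rewrite sumr_const card_ord -mulrnAl mulrC ler_wpM2l //.
  rewrite invfM mulrC -mulr_natl mulrA ler_piMl // ler_pdivrMr ?ltr0n //.
  by rewrite mul1r ler_nat.
pose rho := r / 2.
have rho0 : 0 < rho by rewrite divr_gt0.
have rhor : rho < r by rewrite /rho; lra.
have [del /andP[del0 delr] hdel] : exists2 del, 0 < del < r & forall t, `|t| < del ->
    forall i, `|T t 0 0 i| <= rho / 2.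
  have cT i : (fun t => T t 0 0 i) @ (0 : R) --> (0 : R).
    rewrite [X in _ --> X](_ : _ = 0 - \sum_j C i j * (f j (pt 0 0 0) - f j 0)); last first.
      by rewrite pt0 sub0r big1 ?oppr0 // => j _; rewrite subrr mulr0.
    have E t : T t 0 0 i = 0 - \sum_j C i j * (f j (pt 0 t 0) - f j 0).
      by rewrite !mxE.
    under eq_cvg do rewrite E.
    apply: cvgB; first exact: cvg_cst.
    apply: cvg_sumR => j _; apply: cvgM; first exact: cvg_cst.
    apply: cvgB; last exact: cvg_cst.
    apply: (@cvg_comp _ _ _ (fun t : R => pt 0 t 0) (f j) _ (nbhs (pt 0 0 0))).
      by apply: cvg_pt => *; [exact: cvg_cst|exact: cvg_id|exact: cvg_cst].
    by rewrite pt0; apply: (smooth_continuous (fU j)).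
  have : \forall t \near (0 : R), forall i, `|T t 0 0 i| < rho / 2.
    apply: near_forall => i.
    by apply: near_norm_lt (cT i) _; rewrite normr0 divr_gt0.
  move=> /nbhs_ballP[d /= d0 hd]; exists (Num.min d (r / 2)).
    by rewrite lt_min d0 divr_gt0 // gt_min; apply/orP; right; lra.
  move=> t; rewrite lt_min => /andP[td _] i; apply/ltW/hd.
  by rewrite /ball /= sub0r normrN.
exists r, K, rho, del; split => //; [exact/andP|exact/andP| |].
  by move=> zeta hz B; have [? ? ? ?] := rB zeta hz.
have fix_ex t : `|t| < del -> exists x : 'rV[R]_m, (forall i, `|x 0 i| <= rho) /\
     forall j, f j (pt x t 0) = f j 0.
  move=> td; have tr : `|t| < r := lt_trans td delr.
  pose Q : set 'rV[R]_m := [set x | forall i, `|x 0 i| <= rho].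
  have Qr x : Q x -> forall i, `|x 0 i| < r by move=> Qx i; apply: le_lt_trans (Qx i) _.
  have Q0 : Q 0 by move=> i; rewrite mxE normr0 ltW.
  have TQ x : Q x -> Q (T t x).
    move=> Qx i.
    have h1 := contr t 0 x rho tr (Qr _ Q0) (Qr _ Qx).
    have h2 := hdel t td i.
    have h3 : `|T t x 0 i - T t 0 0 i| <= rho / 2.
      by apply: h1 => k; rewrite [X in _ - X]mxE subr0.
    rewrite -(subrK (T t 0 0 i) (T t x 0 i)).
    apply: le_trans (ler_normD _ _) _.
    by rewrite [leRHS]splitr lerD.
  have cQ : compact Q by exact: compact_cube.
  have cg : {within Q, continuous (fun x => `|T t x - x|)}.
    apply: continuous_in_subspaceT => x /set_mem Qx.
    suff c : (fun y => T t y - y) @ x --> T t x - x by exact: cvg_norm c.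
    apply/(@cvg_rowP _ _ _ _ (nbhs_filter x)) => i.
    have E y : (T t y - y) 0 i = - \sum_j C i j * (f j (pt y t 0) - f j 0).
      by rewrite 2!mxE [X in _ + X]mxE addrAC subrr add0r.
    rewrite E; under eq_cvg do rewrite E.
    apply: (@cvgN _ _ _ _ (nbhs_filter x)).
    apply: (@cvg_sumR _ _ _ (nbhs_filter x)) => j _.
    apply: (@cvgM _ _ _ (nbhs_filter x)); first exact: cvg_cst.
    apply: (@cvgB _ _ _ _ (nbhs_filter x)); last exact: cvg_cst.
    apply: (@cvg_comp _ _ _ (fun y : 'rV[R]_m => pt y t 0) (f j) _ (nbhs (pt x t 0))).
      apply: (@cvg_pt _ _ _ _ (nbhs_filter x)) => *; [exact: coord_continuous|exact: cvg_cst|exact: cvg_cst].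
    exact: (smooth_continuous (fU j) (rU' _ _ (Qr _ Qx) tr)).
  have [c /set_mem Qc cmin] := EVT_min_rV (ex_intro _ _ Q0) cQ cg.
  exists c; split=> //.
  have Tc : T t c = c.
    apply/eqP; rewrite -subr_eq0 -normr_eq0; apply/negPn/negP => ne0.
    have d0 : 0 < `|T t c - c| by rewrite lt_neqAle eq_sym ne0 normr_ge0.
    have := cmin _ (mem_set (TQ _ Qc)).
    apply/negP; rewrite -ltNge.
    apply: (@le_lt_trans _ _ (`|T t c - c| / 2)); last lra.
    apply: row_norm_le; first by rewrite divr_ge0.
    move=> i; rewrite mxE [X in _ + X]mxE.
    apply: (contr t c (T t c)) => //; [exact: Qr|exact/Qr/TQ|].
    by move=> k; have := le_row_norm (T t c - c) k; rewrite mxE [X in _ + X]mxE.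
  pose F : 'cV[R]_m := \col_j (f j (pt c t 0) - f j 0).
  have CF : C *m F = 0.
    apply/colP => i; rewrite !mxE.
    have := congr1 (fun v : 'rV[R]_m => v 0 i) Tc; rewrite mxE => /eqP.
    rewrite -subr_eq0 addrAC subrr add0r oppr_eq0 => /eqP S0; rewrite -[RHS]S0.
    by apply: eq_bigr => j _; rewrite mxE.
  have F0 : F = 0 by rewrite -(mulKVmx ux F) -/C CF mulmx0.
  move=> j; have := congr1 (fun v : 'cV[R]_m => v j 0) F0; rewrite !mxE.
  by move/eqP; rewrite subr_eq0 => /eqP.
have [X XP] : exists X : R -> 'rV[R]_m, forall t, (t = 0 -> X t = 0) /\
   (`|t| < del -> (forall i, `|X t 0 i| <= rho) /\ forall j, f j (pt (X t) t 0) = f j 0).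
  suff S t : exists x : 'rV[R]_m, (t = 0 -> x = 0) /\
   (`|t| < del -> (forall i, `|x 0 i| <= rho) /\ forall j, f j (pt x t 0) = f j 0).
    by have [g gP] := boolp.choice S; exists g.
  have [->|t0] := eqVneq t 0.
    exists 0; split=> // _; split=> [i|j]; last by rewrite pt0.
    by rewrite mxE normr0 ltW.
  have [td|td] := ltP `|t| del.
    have [x xP] := fix_ex t td; exists x; split=> // /eqP; by rewrite (negbTE t0).
  by exists 0; split.
exists X; first by apply: (XP 0).1.
by move=> t; apply: (XP t).2.
Qed.

(** The mean value theorem between two points of the curve expresses its
    increment through an inverse matrix of partial derivatives, which gives
    first continuity and then the derivative. *)
Lemma implicit_curve : exists (X : R -> 'rV[R]_m) (del : R), [/\ X 0 = 0, 0 < del &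
  forall t, `|t| < del -> let z := pt (X t) t 0 in
    [/\ U z, jacx z \in unitmx, forall j, f j z = f j 0 &
     forall i, is_derive t 1 (fun s => X s 0 i)
        (- \sum_j invmx (jacx z) i j * pd ti (f j) z)]].
Proof.
have [r [K [rho [del [/andP[rho0 rhor] /andP[del0 delr] rU rB [X X0 XP]]]]]] := implicit_solution.
have r0 : 0 < r := lt_trans rho0 rhor.
exists X, del; split=> // t td z.
have Xr s : `|s| < del -> forall i, `|X s 0 i| < r.
  by move=> /XP[h _] i; apply: le_lt_trans (h i) rhor.
have bnd s : `|s| < del -> forall a, `|(pt (X s) s 0) 0 a - (0 : 'rV[R]_N) 0 a| < r.
  by move=> sd; apply: pt_bound => //; [exact: Xr|exact: lt_trans sd delr].
have Uz s : `|s| < del -> U (pt (X s) s 0).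
  by move=> sd; apply: rU => a; have := bnd s sd a; rewrite [X in _ - X]mxE.
have uz : jacx z \in unitmx.
  have hz (j : 'I_m) (a b : 'I_N) : `|z 0 b - 0| < r.
    by have := bnd t td b; rewrite [X in _ - X]mxE.
  by have [] := rB (fun _ _ => z) hz.
split=> //; [exact: Uz|by case: (XP t td)|move=> i].
pose P (s : R) (zeta : 'I_m -> 'I_N -> 'rV[R]_N) :=
  [/\ forall j a, hull (pt (X t) t 0) (pt (X s) s 0) (zeta j a),
     \matrix_(j, i) pd (xi i) (f j) (zeta j (xi i)) \in unitmx,
     forall i k, `|invmx (\matrix_(j, i) pd (xi i) (f j) (zeta j (xi i))) i k| < K,
     forall j, `|pd ti (f j) (zeta j ti)| < K &
     forall i, X s 0 i - X t 0 i = - (s - t) * \sum_j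
       invmx (\matrix_(j, i) pd (xi i) (f j) (zeta j (xi i))) i j * pd ti (f j) (zeta j ti)].
have exP s : `|s| < del -> exists zeta, P s zeta.
  move=> sd.
  have S (j : 'I_m) : exists zeta : 'I_N -> 'rV[R]_N,
     (forall a, hull (pt (X t) t 0) (pt (X s) s 0) (zeta a)) /\
     0 = \sum_i pd (xi i) (f j) (zeta (xi i)) * (X s 0 i - X t 0 i)
         + pd ti (f j) (zeta ti) * (s - t).
    have [|zeta z1 z2] := @mvt_xt R m (f j) (X t) t (X s) s.
      move=> c a hc; refine (smooth_derivable a (fU j) _).
      apply: rU => b; have := hull_dist hc (bnd t td) (bnd s sd) b.
      by rewrite [X in _ - X]mxE.
    exists zeta; split=> //; rewrite -z2.
    by have [_ ->] := XP t td; have [_ ->] := XP s sd; rewrite subrr.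
  have [zeta zP] := boolp.choice S; exists zeta.
  have hz j a b : `|zeta j a 0 b - 0| < r.
    have := hull_dist ((zP j).1 a) (bnd t td) (bnd s sd) b.
    by rewrite [X in _ - X]mxE.
  have [uB hK1 hK2] := rB zeta hz.
  set B := \matrix_(_, _) _ in uB hK1.
  split=> //; first by move=> j; case: (zP j).
  move=> k; pose D : 'cV[R]_m := \col_k (X s 0 k - X t 0 k).
  pose b : 'cV[R]_m := \col_j pd ti (f j) (zeta j ti).
  have BD : B *m D = - (s - t) *: b.
    apply/colP => j; have /eqP := (zP j).2; rewrite eq_sym addr_eq0 => /eqP E.
    rewrite !mxE mulNr mulrC -E; apply: eq_bigr => l _; by rewrite !mxE.
  have : D = - (s - t) *: (invmx B *m b) by rewrite scalemxAr -BD mulKmx.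
  move=> /(congr1 (fun v : 'cV[R]_m => v k 0)); rewrite !mxE => ->.
  by congr (_ * _); apply: eq_bigr => j _; rewrite !mxE.
have [zet zetP] : exists zet : R -> 'I_m -> 'I_N -> 'rV[R]_N, forall s, `|s| < del -> P s (zet s).
  suff S s : exists zeta, `|s| < del -> P s zeta by have [g gP] := boolp.choice S; exists g.
  have [sd|sd] := ltP `|s| del; first by have [zeta] := exP s sd; exists zeta.
  by exists (fun _ _ => 0).
have shc := @cvg_shift0 R t.
have nd : \forall h \near 0^', `|h + t| < del.
  exact: (cvgr_lt _ (cvg_norm shc) _ td).
have K0 : 0 < K by have [_ _ _ /(_ i) h _] := zetP t td; apply: le_lt_trans h.
have Xc k : (fun h : R => X (h + t) 0 k) @ 0^' --> X t 0 k.
  apply/cvgrPdist_lt => e e0.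
  have c : (fun h : R => `|h| * (m.+1%:R * (K * K))) @ 0^' --> (0 : R).
    rewrite -[X in _ --> X](mul0r (m.+1%:R * (K * K))); apply: cvgM; last exact: cvg_cst.
    have : (fun h : R => `|h|) @ 0 --> `|0 : R| by apply: cvg_norm; exact: cvg_id.
    by rewrite normr0 => /cvg_within_filter; apply.
  have c' : \forall h \near (0 : R)^', `|h| * (m.+1%:R * (K * K)) < e by exact: (cvgr_lt _ c _ e0).
  near=> h.
  have hd : `|h + t| < del by near: h.
  have he : `|h| * (m.+1%:R * (K * K)) < e by near: h.
  have [_ _ b1 b2 E] := zetP _ hd.
  rewrite distrC E addrK normrM normrN; apply: le_lt_trans he.
  rewrite ler_wpM2l //; apply: le_trans (ler_norm_sum _ _ _) _.
  apply: (@le_trans _ _ (\sum_(j < m) K * K)).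
    by apply: ler_sum => j _; rewrite normrM ler_pM // ltW.
  by rewrite sumr_const card_ord -[leLHS]mulr_natl ler_wpM2r ?ler_nat // mulr_ge0 ?ltW.
have zc j a : (fun h => zet (h + t) j a) @ 0^' --> z.
  apply: (@cvg_hull _ _ _ _ _ (fun=> z) (fun h => pt (X (h + t)) (h + t) 0)).
  - exact: cvg_cst.
  - by apply: cvg_pt => *; [exact: Xc|exact: shc|exact: cvg_cst].
  - by apply: filterS nd => h hd; have [] := zetP _ hd.
pose q h : R := - \sum_j invmx (\matrix_(j, i) pd (xi i) (f j) (zet (h + t) j (xi i))) i j
       * pd ti (f j) (zet (h + t) j ti).
have qc : q @ 0^' --> - \sum_j invmx (jacx z) i j * pd ti (f j) z.
  apply: cvgN; apply: cvg_sumR => j _; apply: cvgM; last first.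
    by apply: (cvg_comp _ _ (zc j ti)); apply: pd_cont; exact: Uz.
  apply: cvg_invmx => // a b; rewrite mxE; under eq_cvg do rewrite mxE.
  by apply: (cvg_comp _ _ (zc a (xi b))); apply: pd_cont; exact: Uz.
have main : (fun h : R => h^-1 *: (X (h *: (1:R) + t) 0 i - X t 0 i)) @ 0^' -->
    - \sum_j invmx (jacx z) i j * pd ti (f j) z.
  apply: cvg_trans _ qc; apply: near_eq_cvg; near=> h.
  have hd : `|h + t| < del by near: h.
  have h0 : h != 0 by near: h; exact: nbhs_dnbhs_neq.
  have [_ _ _ _ E] := zetP _ hd.
  by rewrite -[h%:A]/(h * 1) mulr1 -[_ *: _]/(_ * _) E addrK mulNr mulrN mulKf.
apply: DeriveDef.
  by apply/cvg_ex; exists (- \sum_j invmx (jacx z) i j * pd ti (f j) z).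
by apply/cvg_lim.
Unshelve. all: by end_near. Qed.

End ImplicitFunction.

(** * Derivatives in one variable *)

Lemma eq_cvgl (T : Type) (V : nbhsType) (F : set_system T) (u v : T -> V) (l : V) :
  u =1 v -> v @ F --> l -> u @ F --> l.
Proof. by move=> /funext ->. Qed.

Section OneVariable.
Context {R : realType}.
Implicit Types (u v : R -> R) (t : R).

Lemma near0_lt (del : R) t : `|t| < del -> \forall s \near t, `|s| < del.
Proof. by move=> td; apply: near_norm_lt td; exact: cvg_id. Qed.

Lemma eq_derive1n u v (del : R) : (forall t, `|t| < del -> u t = v t) ->
  forall k t, `|t| < del -> derive1n k u t = derive1n k v t.
Proof.
move=> uv k; elim: k => [|k IH] t td; first exact: (uv t td).
rewrite !derive1nS !derive1E; apply: near_eq_derive.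
by apply: filterS (near0_lt td) => s; exact: IH.
Qed.

Lemma is_derive_cvg u t (d : R) :
  is_derive t 1 u d <-> (fun h : R => h^-1 * (u (h + t) - u t)) @ 0^' --> d.
Proof.
have E : (fun h : R => h^-1 *: (u (h *: (1 : R) + t) - u t)) =
         (fun h : R => h^-1 * (u (h + t) - u t)).
  by apply/funext => h; rewrite -[h%:A]/(h * 1) mulr1.
split=> [[d1 <-]|c].
  by move: d1; rewrite /derivable /derive /= E.
apply: DeriveDef; first by rewrite /derivable /= E; apply/cvg_ex; exists d.
by rewrite /derive /= E; apply/cvg_lim.
Qed.

Lemma is_derive_invmx k (M : R -> 'M[R]_k) (D : 'M[R]_k) t :
  M t \in unitmx -> (forall i j, is_derive t 1 (fun s => M s i j) (D i j)) ->
  forall i j, is_derive t 1 (fun s => invmx (M s) i j)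
    (- (invmx (M t) *m D *m invmx (M t)) i j).
Proof.
move=> uM dM i j; apply/is_derive_cvg.
have cM a b : (fun h : R => M (h + t) a b) @ 0^' --> M t a b.
  have d : derivable (fun s => M s a b) t 1 by case: (dM a b).
  have c : {for t, continuous (fun s => M s a b)}.
    exact/differentiable_continuous/derivable1_diffP.
  exact: (cvg_comp _ _ (@cvg_shift0 R t) c).
have uN : \forall h \near (0 : R)^', M (h + t) \in unitmx by exact: near_unitmx cM uM.
pose Q (h : R) : 'M[R]_k := \matrix_(a, b) (h^-1 * (M (h + t) a b - M t a b)).
have cQ a b : (fun h => Q h a b) @ 0^' --> D a b.
  under eq_cvg do rewrite mxE.
  by have /is_derive_cvg := dM a b.
have cI a b : (fun h : R => invmx (M (h + t)) a b) @ 0^' --> invmx (M t) a b.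
  exact: (cvg_invmx cM uM a b).
have cN a b : (fun h : R => invmx (M t) a b) @ 0^' --> invmx (M t) a b by exact: cvg_cst.
have c a b : (fun h : R => (invmx (M (h + t)) *m Q h) a b) @ 0^' --> (invmx (M t) *m D) a b.
  exact: (cvg_mulmx cI cQ a b).
have c' : (fun h => - (invmx (M (h + t)) *m Q h *m invmx (M t)) i j) @ 0^' -->
   - (invmx (M t) *m D *m invmx (M t)) i j.
  by apply: cvgN; exact: (cvg_mulmx c cN i j).
apply: cvg_trans _ c'; apply: near_eq_cvg; near=> h.
have uh : M (h + t) \in unitmx by near: h.
have QE : Q h = h^-1 *: (M (h + t) - M t) by apply/matrixP => a b; rewrite !mxE.
rewrite QE -scalemxAr -scalemxAl mulmxBr mulVmx // mulmxBl mul1mx -mulmxA mulmxV //.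
by rewrite mulmx1 [in LHS]mxE -mulrN !mxE opprB.
Unshelve. all: by end_near. Qed.

End OneVariable.

(** * Differential polynomials along the contact curve *)

Section Expressions.
Context {R : realType} {m : nat}.
Local Notation N := (m + 1 + m)%N.
Implicit Types (f : 'rV[R]_N -> R) (z : 'rV[R]_N) (t : R).

(** The derivatives at the origin of all quantities attached to a contact curve
    are rational expressions in the derivatives of the phase. They are handled
    syntactically, which makes both the formal derivation along the curve
    and the continuous dependence on the phase inductions on expressions.
    [Binv] stands for the entries of the inverse of the matrix of the second
    derivatives in [x] and [y]. *)
Inductive expr : Type :=
| Pd of seq 'I_N
| Pd0 of seq 'I_N
| Cst of R
| Add of expr & expr
| Mul of expr & expr
| Binv of 'I_m & 'I_m.

Definition xyblock f z : 'M[R]_m := jacx (fun j => pd (yi j) f) z.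

Lemma xyblockE f z j i : xyblock f z j i = pds [:: xi i; yi j] f z.
Proof. by rewrite mxE. Qed.

Fixpoint ev f z (e : expr) : R :=
  match e with
  | Pd s => pds s f z
  | Pd0 s => pds s f 0
  | Cst c => c
  | Add e1 e2 => ev f z e1 + ev f z e2
  | Mul e1 e2 => ev f z e1 * ev f z e2
  | Binv i j => invmx (xyblock f z) i j
  end.

Definition esum (I : Type) (s : seq I) (F : I -> expr) : expr :=
  foldr (fun i => Add (F i)) (Cst 0) s.
Definition eprod (I : Type) (s : seq I) (F : I -> expr) : expr :=
  foldr (fun i => Mul (F i)) (Cst 1) s.

Lemma eval_esum f z (I : Type) (s : seq I) (F : I -> expr) :
  ev f z (esum s F) = \sum_(i <- s) ev f z (F i).
Proof. by elim: s => [|i s IH] /=; rewrite ?big_nil ?big_cons ?IH. Qed.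

Lemma eval_eprod f z (I : Type) (s : seq I) (F : I -> expr) :
  ev f z (eprod s F) = \prod_(i <- s) ev f z (F i).
Proof. by elim: s => [|i s IH] /=; rewrite ?big_nil ?big_cons ?IH. Qed.

Definition eneg e := Mul (Cst (-1)) e.

Lemma eval_eneg f z e : ev f z (eneg e) = - ev f z e.
Proof. by rewrite /= mulN1r. Qed.

(** The velocity [X'] of the curve. *)
Definition vel (i : 'I_m) : expr :=
  eneg (esum (enum 'I_m) (fun j => Mul (Binv i j) (Pd [:: ti; yi j]))).

Lemma eval_vel f z i : ev f z (vel i) =
  - \sum_j invmx (xyblock f z) i j * pd ti (pd (yi j) f) z.
Proof. by rewrite eval_eneg eval_esum big_enum. Qed.

Definition LPd (s : seq 'I_N) : expr :=
  Add (esum (enum 'I_m) (fun i => Mul (Pd (xi i :: s)) (vel i))) (Pd (ti :: s)).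

(** The formal derivation along the curve: see [is_derive_eval]. *)
Fixpoint L (e : expr) : expr :=
  match e with
  | Pd s => LPd s
  | Pd0 _ | Cst _ => Cst 0
  | Add e1 e2 => Add (L e1) (L e2)
  | Mul e1 e2 => Add (Mul e1 (L e2)) (Mul e2 (L e1))
  | Binv i j => eneg (esum (enum 'I_m) (fun l => esum (enum 'I_m) (fun k =>
      Mul (Mul (Binv i k) (LPd [:: xi l; yi k])) (Binv l j))))
  end.

Section AlongCurve.
Variables (f : 'rV[R]_N -> R) (U : set 'rV[R]_N) (X : R -> 'rV[R]_m) (del : R).
Hypotheses (oU : open U) (fU : smooth_on U f).
Let gam t := pt (X t) t 0.
Hypothesis UX : forall t, `|t| < del -> U (gam t).
Hypothesis uX : forall t, `|t| < del -> xyblock f (gam t) \in unitmx.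
Hypothesis dX : forall t, `|t| < del -> forall i,
  is_derive t 1 (fun s => X s 0 i) (ev f (gam t) (vel i)).

Lemma is_derive_Pd s t : `|t| < del ->
  is_derive t 1 (fun u => pds s f (gam u)) (ev f (gam t) (LPd s)).
Proof.
move=> td; pose dg : 'rV[R]_N := pt (\row_i ev f (gam t) (vel i)) 1 0.
have -> : ev f (gam t) (LPd s) = \sum_a pd a (pds s f) (gam t) * dg 0 a.
  rewrite /= eval_esum big_enum sum_coord [X in _ = _ + X]big1 ?addr0; last first.
    by move=> j _; rewrite pt_y mxE mulr0.
  rewrite pt_t mulr1; congr (_ + _); apply: eq_bigr => i _.
  by rewrite pt_x mxE.
apply: is_derive_curve.
- apply: filterS (open_nbhs_nbhs (conj oU (UX td))) => w Uw i.
  exact: (smooth_derivable i (smooth_pds s fU) Uw).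
- by move=> a; apply: (smooth_continuous (smooth_pds (a :: s) fU)); exact: UX.
- apply: coord_ind => [i||j].
  + rewrite pt_x mxE; apply: is_derive_eq; last by [].
    rewrite (_ : (fun u => _) = (fun u => X u 0 i)); first exact: dX.
    by apply/funext => u; rewrite pt_x.
  + rewrite pt_t (_ : (fun u => _) = id); first exact: is_derive_id.
    by apply/funext => u; rewrite pt_t.
  + rewrite pt_y mxE (_ : (fun u => _) = cst 0); first exact: is_derive_cst.
    by apply/funext => u; rewrite pt_y mxE.
Qed.

Lemma is_derive_eval e t : `|t| < del ->
  is_derive t 1 (fun u => ev f (gam u) e) (ev f (gam t) (L e)).
Proof.
move=> td; elim: e => [s|s|c|e1 IH1 e2 IH2|e1 IH1 e2 IH2|i j].
- exact: is_derive_Pd.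
- exact: is_derive_cst.
- exact: is_derive_cst.
- exact: is_deriveD.
- exact: is_deriveM.
- pose D : 'M[R]_m := \matrix_(k, l) ev f (gam t) (LPd [:: xi l; yi k]).
  have dB k l : is_derive t 1 (fun u => xyblock f (gam u) k l) (D k l).
    rewrite mxE (_ : (fun u => _) = (fun u => pds [:: xi l; yi k] f (gam u))).
      exact: is_derive_Pd.
    by apply/funext => u; rewrite mxE.
  have := is_derive_invmx (uX td) dB i j.
  congr (is_derive _ _ _ _); rewrite [L _]lock /= -lock eval_eneg eval_esum big_enum.
  congr (- _); rewrite mxE; apply: eq_bigr => l _.
  rewrite eval_esum big_enum mxE mulr_suml; apply: eq_bigr => k _.
  by rewrite [D _ _]mxE.
Qed.

Lemma derive1n_eval e k t : `|t| < del ->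
  derive1n k (fun u => ev f (gam u) e) t = ev f (gam t) (iter k L e).
Proof.
elim: k t => [//|k IH] t td.
rewrite derive1nS derive1E.
rewrite (@near_eq_derive _ _ _ _ (fun u => ev f (gam u) (iter k L e))); last first.
  by apply: filterS (near0_lt td) => s; exact: IH.
by have [_ ->] := is_derive_eval (iter k L e) td.
Qed.

Lemma derivable_derive1n_eval e k t : `|t| < del ->
  derivable (derive1n k (fun u => ev f (gam u) e)) t 1.
Proof.
move=> td.
apply: (@near_eq_derivable _ _ _ (fun u => ev f (gam u) (iter k L e))).
  by apply: filterS (near0_lt td) => s sd; rewrite derive1n_eval.
by have [] := is_derive_eval (iter k L e) td.
Qed.

Lemma derivable_derive1n_curve i k t : `|t| < del ->
  derivable (derive1n k (fun u => X u 0 i)) t 1.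
Proof.
move=> td; case: k => [|k]; first by have [] := dX td i.
apply: (@near_eq_derivable _ _ _ (derive1n k (fun u => ev f (gam u) (vel i)))).
  apply: filterS (near0_lt td) => s sd; rewrite derive1Sn; apply: eq_derive1n sd.
  by move=> r rd; rewrite derive1E; have [_ ->] := dX rd i.
exact: derivable_derive1n_eval.
Qed.

End AlongCurve.

End Expressions.

Section ContactExpressions.
Context {R : realType} {m : nat}.
Local Notation N := (m + 1 + m)%N.
Implicit Types (f h : 'rV[R]_N -> R) (z : 'rV[R]_N) (t : R) (X : R -> 'rV[R]_m).

Definition yproj z : 'rV[R]_N := pt 0 0 (ypart z).

Lemma yprojD z j (s : R) :
  yproj (s *: delta_mx 0 (yi j) + z) = s *: delta_mx 0 (yi j) + yproj z.
Proof.
apply/rowP; rewrite /yproj; apply: coord_ind => [i||k].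
- rewrite pt_x [RHS]mxE pt_x !mxE addr0 /= (_ : xi i == yi j = false) ?mulr0 //.
  by rewrite /xi /bxi /yi eq_lrshift.
- rewrite pt_t [RHS]mxE pt_t !mxE addr0 /= (_ : ti == yi j = false) ?mulr0 //.
  by rewrite /ti /bxi /yi eq_lrshift.
- by rewrite pt_y [RHS]mxE pt_y !ypartE mxE.
Qed.

Lemma yproj_quotient h z j :
  (fun s : R => s^-1 *: (h (yproj (s *: delta_mx 0 (yi j) + z)) - h (yproj z))) =
  (fun s : R => s^-1 *: (h (s *: delta_mx 0 (yi j) + yproj z) - h (yproj z))).
Proof. by apply/funext => s; rewrite yprojD. Qed.

Lemma pd_yproj h j : pd (yi j) (h \o yproj) = pd (yi j) h \o yproj.
Proof. by apply/funext => z; rewrite /pd /derive /= yproj_quotient. Qed.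

Lemma derivable_yproj h z j : derivable h (yproj z) (delta_mx 0 (yi j)) ->
  derivable (h \o yproj) z (delta_mx 0 (yi j)).
Proof. by rewrite /derivable /= yproj_quotient. Qed.

Lemma box_yproj e0 z : box e0 z -> box e0 (yproj z).
Proof.
move=> [zx zt zy]; rewrite /box /= xpart_pt tpart_pt ypart_pt enorm0 normr0.
by split=> //; apply: le_lt_trans zt.
Qed.

Lemma pd_sub_yproj e0 f j z : smooth_on (box e0) f -> box e0 z ->
  pd (yi j) (fun w => f w - f (yproj w)) z = pd (yi j) f z - pd (yi j) f (yproj z).
Proof.
move=> sf bz; rewrite -[pd (yi j) f (yproj z)]/((pd (yi j) f \o yproj) z) -pd_yproj.
apply: deriveB; first exact: smooth_derivable sf bz.
by apply: derivable_yproj; apply: smooth_derivable sf (box_yproj bz).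
Qed.

Lemma pdyy_phi0 e0 f i j z : smooth_on (box e0) f -> box e0 z ->
  pd (yi i) (pd (yi j) (phi0 f 0 0 0)) z =
  pds [:: yi i; yi j] f z - pds [:: yi i; yi j] f (yproj z).
Proof.
move=> sf bz.
have -> : phi0 f 0 0 0 = (fun w => f w - f (yproj w)).
  by apply/funext => w; rewrite /phi0 !addr0 ptK.
rewrite -(pd_sub_yproj i (smooth_pd (yi j) sf) bz).
apply: (eq_pd_open _ (@open_box _ _ e0)) bz => w /set_mem bw.
exact: (pd_sub_yproj j sf bw).
Qed.

Definition eD (i j : 'I_m) : @expr R m :=
  Add (Pd [:: yi i; yi j]) (eneg (Pd0 [:: yi i; yi j])).

Lemma DentryE e0 f X i j t : smooth_on (box e0) f -> box e0 (pt (X t) t 0) ->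
  Dentry f 0 0 0 X i j t = ev f (pt (X t) t 0) (eD i j).
Proof.
move=> sf bz; rewrite /Dentry (pdyy_phi0 i j sf bz) [RHS]/=.
by rewrite mulN1r /yproj ypart_pt pt0.
Qed.

Definition eDet : @expr R m :=
  esum (enum {perm 'I_m}) (fun s : {perm 'I_m} => Mul (Cst ((-1) ^+ s))
     (eprod (enum 'I_m) (fun i => eD i (s i)))).

Definition eMon (e : {ffun 'I_m * 'I_m -> nat}) : @expr R m :=
  eprod (enum {: 'I_m * 'I_m}) (fun p => eprod (nseq (e p) tt) (fun=> eD p.1 p.2)).

Definition eRow (r : 'I_(1 + size (monomials m))) : @expr R m :=
  match fintype.split r with
  | inl _ => eDet
  | inr k => eMon (tnth (in_tuple (monomials m)) k)
  end.

Lemma eval_eDet f z : ev f z eDet = \det (\matrix_(i, j) ev f z (eD i j)).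
Proof.
rewrite eval_esum big_enum; apply: eq_bigr => s _ /=.
by congr (_ * _); rewrite eval_eprod big_enum; apply: eq_bigr => i _; rewrite mxE.
Qed.

Lemma eval_eMon f z e : ev f z (eMon e) = \prod_p ev f z (eD p.1 p.2) ^+ e p.
Proof.
rewrite eval_eprod big_enum; apply: eq_bigr => p _.
by rewrite eval_eprod big_nseq iter_mulr_1.
Qed.

(** The contact matrix, as a function of the derivatives of the phase at the
    origin alone. *)
Definition contact_jet (l : nat) f : 'M[R]_(1 + size (monomials m), l) :=
  \matrix_(r, h) ev f 0 (iter h.+1 (@L R m) (eRow r)).

(** A contact curve through the origin that satisfies the differential equation
    obtained by differentiating its defining equation. *)
Definition regular_curve e0 f X (del : R) : Prop := [/\ X 0 = 0, 0 < del &
  forall t, `|t| < del -> [/\ box e0 (pt (X t) t 0),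
    xyblock f (pt (X t) t 0) \in unitmx,
    forall j, pd (yi j) f (pt (X t) t 0) = pd (yi j) f 0 &
    forall i, is_derive t 1 (fun s => X s 0 i) (ev f (pt (X t) t 0) (vel i))]].

Lemma contact_matrixE e0 l f X del : smooth_on (box e0) f ->
  regular_curve e0 f X del -> contact_matrix l f 0 0 0 X = contact_jet l f.
Proof.
move=> sf [X0 del0 H].
have bX t : `|t| < del -> box e0 (pt (X t) t 0) by move=> /H[].
have uX t : `|t| < del -> xyblock f (pt (X t) t 0) \in unitmx by move=> /H[].
have dX t : `|t| < del -> forall i,
   is_derive t 1 (fun s => X s 0 i) (ev f (pt (X t) t 0) (vel i)) by move=> /H[].
have d0 : `|0 : R| < del by rewrite normr0.
have key (u : R -> R) e k : (forall t, `|t| < del -> u t = ev f (pt (X t) t 0) e) ->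
    derive1n k u 0 = ev f 0 (iter k (@L R m) e).
  move=> /eq_derive1n -> //.
  by rewrite (derive1n_eval (@open_box _ _ e0) sf bX uX dX) // X0 pt0.
apply/matrixP => r h; rewrite [RHS]mxE /eRow /contact_matrix.
rewrite -{1}(splitK r); case: (fintype.split r) => k /=.
  rewrite col_mxEu mxE; apply: (key _ _ h.+1) => t td; rewrite eval_eDet /Ddet; congr (\det _).
  by apply/matrixP => a b; rewrite !mxE (DentryE _ _ sf (bX t td)).
rewrite col_mxEd mxE; apply: (key _ _ h.+1) => t td; rewrite eval_eMon /Dmonomial.
by apply: eq_bigr => p _; rewrite (DentryE _ _ sf (bX t td)).
Qed.

Lemma regular_curve_contact e0 f X del : smooth_on (box e0) f ->
  regular_curve e0 f X del -> contact_curve f 0 0 0 X.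
Proof.
move=> sf [X0 del0 H]; split=> //.
have bX t : `|t| < del -> box e0 (pt (X t) t 0) by move=> /H[].
have uX t : `|t| < del -> xyblock f (pt (X t) t 0) \in unitmx by move=> /H[].
have dX t : `|t| < del -> forall i,
   is_derive t 1 (fun s => X s 0 i) (ev f (pt (X t) t 0) (vel i)) by move=> /H[].
have d0 : `|0 : R| < del by rewrite normr0.
apply: filterS (near0_lt d0) => t td; split=> [k i|j].
  exact: (derivable_derive1n_curve (@open_box _ _ e0) sf bX uX dX).
by rewrite !addr0 pt0; have [_ _] := H t td.
Qed.

Lemma regular_curve_exists e0 f : 0 < e0 -> smooth_on (box e0) f ->
  xyblock f 0 \in unitmx -> exists X del, regular_curve e0 f X del.
Proof.
move=> e00 sf uf.
have [X [del [X0 del0 H]]] := implicit_curve (@open_box _ _ e0) (box0 e00)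
   (fun j => smooth_pd (yi j) sf) uf.
exists X, del; split=> [||t td]; [exact: X0|exact: del0|].
have [b u eqs d] := H t td; split; [exact: b|exact: u|exact: eqs|move=> i].
by rewrite eval_vel; exact: d.
Qed.

Lemma cvg_curve X t : (forall i, derivable (fun s => X s 0 i) t 1) ->
  (fun s => pt (X s) s 0) @ t --> pt (X t) t 0.
Proof.
move=> dX; apply: cvg_pt => [i||i]; [|exact: cvg_id|exact: cvg_cst].
have c : {for t, continuous (fun s => X s 0 i)}.
  exact/differentiable_continuous/derivable1_diffP/dX.
exact: c.
Qed.

(** Differentiating the equation of a contact curve gives a linear system for
    its velocity, which makes sense whether or not the block is invertible. *)
Lemma contact_velocity e0 f X : 0 < e0 -> smooth_on (box e0) f ->
  contact_curve f 0 0 0 X -> exists2 del : R, 0 < del & forall t, `|t| < del ->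
    [/\ box e0 (pt (X t) t 0), forall j, pd (yi j) f (pt (X t) t 0) = pd (yi j) f 0 &
     exists2 d : 'cV[R]_m, (forall i, is_derive t 1 (fun s => X s 0 i) (d i 0)) &
       xyblock f (pt (X t) t 0) *m d = - \col_j pd ti (pd (yi j) f) (pt (X t) t 0)].
Proof.
move=> e00 sf [X0 cX].
have [r /= r0 rP] := (nbhs_ballP _ _).1 cX.
have rP' t : `|t| < r -> (forall i, derivable (fun s => X s 0 i) t 1) /\
    (forall j, pd (yi j) f (pt (X t) t 0) = pd (yi j) f 0).
  move=> tr; have [|h1 h2] := rP t; first by rewrite /ball /= sub0r normrN.
  by split=> [i|j]; [exact: (h1 0%N i)|have := h2 j; rewrite !addr0 pt0].
have cX0 t : `|t| < r -> (fun s => pt (X s) s 0) @ t --> pt (X t) t 0.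
  by move=> tr; apply: cvg_curve; exact: (rP' t tr).1.
have r00 : `|0 : R| < r by rewrite normr0.
have nb : \forall t \near (0 : R), box e0 (pt (X t) t 0).
  apply: (cX0 0 r00); apply: open_nbhs_nbhs; split; first exact: open_box.
  by rewrite X0 pt0; exact: box0.
have [r2 /= r20 r2P] := (nbhs_ballP _ _).1 nb.
exists (Num.min r r2); first by rewrite lt_min r0.
move=> t; rewrite lt_min => /andP[tr tr2].
have bt : box e0 (pt (X t) t 0) by apply: r2P; rewrite /ball /= sub0r normrN.
have [dXt eqt] := rP' t tr; split=> //.
pose d : 'cV[R]_m := \col_i derive1 (fun s => X s 0 i) t.
have dd i : is_derive t 1 (fun s => X s 0 i) (d i 0).
  by rewrite mxE derive1E; apply: DeriveDef.
exists d => //; apply/colP => j; rewrite mxE [RHS]mxE [in RHS]mxE.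
have D : is_derive t 1 (fun s => pd (yi j) f (pt (X s) s 0))
   (\sum_a pd a (pd (yi j) f) (pt (X t) t 0) * (pt d^T 1 0 : 'rV[R]_N) 0 a).
  apply: is_derive_curve.
  - apply: filterS (open_nbhs_nbhs (conj (@open_box _ _ e0) bt)) => w bw i.
    exact: (smooth_derivable i (smooth_pd (yi j) sf) bw).
  - move=> a; exact: (smooth_continuous (smooth_pd a (smooth_pd (yi j) sf)) bt).
  - apply: coord_ind => [i||k].
    + rewrite pt_x mxE (_ : (fun u => _) = (fun u => X u 0 i)); first exact: dd.
      by apply/funext => u; rewrite pt_x.
    + rewrite pt_t (_ : (fun u => _) = id); first exact: is_derive_id.
      by apply/funext => u; rewrite pt_t.
    + rewrite pt_y mxE (_ : (fun u => _) = cst 0); first exact: is_derive_cst.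
      by apply/funext => u; rewrite pt_y mxE.
have Z : is_derive t 1 (fun s => pd (yi j) f (pt (X s) s 0)) 0.
  have Zc : is_derive t 1 (cst (pd (yi j) f 0) : R -> R) 0 by exact: is_derive_cst.
  apply: near_eq_is_derive Zc.
  by apply: filterS (near0_lt tr) => s sr; have [_ ->] := rP' s sr.
have [_ E1] := D; have [_ E2] := Z.
move: E1; rewrite E2 sum_coord [X in _ + X]big1 ?addr0; last first.
  by move=> k _; rewrite pt_y mxE mulr0.
have -> : \sum_i pd (xi i) (pd (yi j) f) (pt (X t) t 0) * (pt d^T 1 0 : 'rV[R]_N) 0 (xi i) =
    \sum_i xyblock f (pt (X t) t 0) j i * d i 0.
  by apply: eq_bigr => i _; rewrite pt_x xyblockE [d^T _ _]mxE.
by rewrite pt_t mulr1 => /esym/addr0_eq <-; rewrite opprK.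
Qed.

(** Once the block is invertible, the linear system determines the velocity. *)
Lemma contact_curve_regular e0 f X : 0 < e0 -> smooth_on (box e0) f ->
  xyblock f 0 \in unitmx -> contact_curve f 0 0 0 X ->
  exists del, regular_curve e0 f X del.
Proof.
move=> e00 sf uf cX; have [del del0 H] := contact_velocity e00 sf cX.
have X0 : X 0 = 0 by case: cX.
have d0 : `|0 : R| < del by rewrite normr0.
have cX0 : (fun s : R => pt (X s) s 0) @ (0 : R) --> (0 : 'rV[R]_N).
  have [_ _ [d dd _]] := H 0 d0.
  have := @cvg_curve X 0; rewrite X0 pt0; apply => i.
  by case: (dd i).
have nu : \forall t \near (0 : R), xyblock f (pt (X t) t 0) \in unitmx.
  have cB i j : (fun s => xyblock f (pt (X s) s 0) i j) @ (0 : R) --> xyblock f 0 i j.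
    rewrite [X in _ --> X]xyblockE.
    apply: (eq_cvgl (fun s => xyblockE f (pt (X s) s 0) i j)).
    apply: (cvg_comp _ _ cX0).
    exact: (smooth_continuous (smooth_pds [:: xi j; yi i] sf) (box0 e00)).
  exact: (near_unitmx cB uf).
have [r2 /= r20 r2P] := (nbhs_ballP _ _).1 nu.
exists (Num.min del r2); split; [exact: X0|by rewrite lt_min del0|].
move=> t; rewrite lt_min => /andP[td tr2].
have ut : xyblock f (pt (X t) t 0) \in unitmx by apply: r2P; rewrite /ball /= sub0r normrN.
have [bt eqt [d dd E]] := H t td.
split; [exact: bt|exact: ut|exact: eqt|move=> i].
rewrite eval_vel.
suff <- : d i 0 = - \sum_j invmx (xyblock f (pt (X t) t 0)) i j * pd ti (pd (yi j) f) (pt (X t) t 0) by [].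
have -> : d = - (invmx (xyblock f (pt (X t) t 0)) *m \col_j pd ti (pd (yi j) f) (pt (X t) t 0)).
  by rewrite -mulmxN -E mulKmx.
by rewrite !mxE; congr (- _); apply: eq_bigr => j _; rewrite mxE.
Qed.

Lemma mixed_hessianE e0 f z : smooth_on (box e0) f -> box e0 z ->
  mixed_hessian f z = row_mx (xyblock f z) (\col_j pd ti (pd (yi j) f) z).
Proof.
move=> sf bz; apply/matrixP => j a; rewrite mxE.
rewrite (schwarz _ _ (@open_box _ _ e0) sf bz) -(splitK a).
case: (fintype.split a) => k /=; first by rewrite row_mxEl mxE.
by rewrite row_mxEr mxE (ord1 k).
Qed.

(** The existence of a contact curve forces the column of [t]-derivatives into
    the span of the others, so that [H1] makes the [x]-block invertible. *)
Lemma contact_curve_unit e0 f X : 0 < e0 -> smooth_on (box e0) f ->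
  H1 f 0 -> contact_curve f 0 0 0 X -> xyblock f 0 \in unitmx.
Proof.
move=> e00 sf h1 cX; have [del del0 H] := contact_velocity e00 sf cX.
have X0 : X 0 = 0 by case: cX.
have d0 : `|0 : R| < del by rewrite normr0.
have [_ _ [d _ E]] := H 0 d0.
rewrite X0 pt0 in E.
rewrite -row_full_unit /row_full eqn_leq rank_leq_col /=.
rewrite -{1}h1 (mixed_hessianE sf (box0 e00)).
have -> : \col_j pd ti (pd (yi j) f) 0 = xyblock f 0 *m (- d).
  by rewrite mulmxN E opprK.
by rewrite -[X in row_mx X _]mulmx1 -mul_mx_row mxrankM_maxl.
Qed.

(** The quantifier over curves disappears: a contact curve exists when the block
    is invertible, and the contact matrix is the same for all of them. *)
Theorem contact_order_leE e0 l f : 0 < e0 -> smooth_on (box e0) f -> H1 f 0 ->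
  contact_order_le l f 0 0 0 <->
  xyblock f 0 \in unitmx /\ \rank (contact_jet l f) = A m.+1.
Proof.
move=> e00 sf h1; split=> [[X [cX rk]]|[uf rk]].
  have uf := contact_curve_unit e00 sf h1 cX.
  have [del rc] := contact_curve_regular e00 sf uf cX.
  by rewrite -(contact_matrixE l sf rc).
have [X [del rc]] := regular_curve_exists e00 sf uf.
exists X; rewrite (contact_matrixE l sf rc); split=> //.
exact: regular_curve_contact rc.
Qed.

End ContactExpressions.

(** * The topology on phases *)

Section PhaseTopology.
Context {R : realType} {m : nat} {e0 : R}.
Local Notation N := (m + 1 + m)%N.
Local Notation C := (Cinfty m e0).
Implicit Types (phi psi chi : C) (alpha : {ffun 'I_N -> nat}) (r : R).

Lemma open_seminorm_ball chi alpha r : 0 < r ->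
  open (seminorm_ball chi alpha r).
Proof.
move=> r0; exists [set seminorm_ball chi alpha r]; last first.
  by rewrite predeqE => ?; split=> [[_ ->]|] //; exists (seminorm_ball chi alpha r).
move=> _ ->; exists [fset (seminorm_ball chi alpha r)]%fset.
  move=> E; rewrite in_fset1 => /eqP->; apply/mem_set.
  by exists chi, alpha, r.
rewrite predeqE=> psi; split=> [h|h E /=]; last by rewrite in_fset1 => /eqP->.
by apply: (h (seminorm_ball chi alpha r)); rewrite /= in_fset1.
Qed.

(** It is enough to test the balls of the subbase, whatever their centre. *)
Lemma cvg_phase (F : set_system C) (FF : Filter F) phi :
  (forall chi alpha r, 0 < r -> seminorm_ball chi alpha r phi ->
     F (seminorm_ball chi alpha r)) -> F --> phi.
Proof.
move=> cvFt A /=; rewrite (@nbhsE C).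
move=> [_ [[B sB <-] [D BD Ct] sUBA]].
rewrite nbhs_filterE; apply: filterS sUBA _; apply: (@filterS _ _ _ D).
  by move=> ? ?; exists D.
have /sB [G sG IGeD] := BD; rewrite -IGeD; apply: filter_bigI => E GE.
have /sG /set_mem [chi [alpha [r [r0 EE]]]] := GE.
rewrite /= EE; apply: cvFt => //; rewrite -EE.
by move: Ct; rewrite -IGeD => /(_ _ GE).
Qed.

Lemma le_supnorm (U : set 'rV[R]_N) (f : 'rV[R]_N -> R) z :
  U z -> (`|f z|%:E <= supnorm U f)%E.
Proof. by move=> Uz; apply: ereal_sup_ubound; exists z. Qed.

Lemma supnorm_le (U : set 'rV[R]_N) (f : 'rV[R]_N -> R) (M : R) :
  (forall z, U z -> `|f z| <= M) -> (supnorm U f <= M%:E)%E.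
Proof.
by move=> fM; apply: ge_ereal_sup => _ [z Uz <-]; rewrite lee_fin; exact: fM.
Qed.

Lemma nbhs_seminorm_ball phi alpha r : 0 < r -> nbhs phi (seminorm_ball phi alpha r).
Proof.
move=> r0; apply: open_nbhs_nbhs; split; first exact: open_seminorm_ball.
apply: (@le_lt_trans _ _ 0%:E); last by rewrite lte_fin.
apply: supnorm_le => z _.
have -> : (fun w : 'rV[R]_N => phi w - phi w) = cst 0.
  by apply/funext => w; rewrite subrr.
rewrite /pd_multi (_ : pds _ (cst 0) = cst 0) ?normr0 //.
elim: (flatten _) => [//|i s IH].
by rewrite /= IH; apply/funext => w; rewrite /pd derive_cst.
Qed.

Lemma pds_sub phi psi s z : box e0 z ->
  pds s (fun w => psi w - phi w) z = pds s psi z - pds s phi z.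
Proof.
move=> bz.
have -> : (fun w : 'rV[R]_N => psi w - phi w) = (fun w => psi w + (-1) * phi w).
  by apply/funext => w; rewrite mulN1r.
by rewrite (pdsDZ _ s (@open_box _ _ e0) (Cinfty_smooth psi) (Cinfty_smooth phi) (mem_set bz)) mulN1r.
Qed.

Lemma smooth_sub phi psi : smooth_on (box e0) (fun w => psi w - phi w).
Proof.
have -> : (fun w : 'rV[R]_N => psi w - phi w) = (fun w => psi w + (-1) * phi w).
  by apply/funext => w; rewrite mulN1r.
exact: smoothDZ (@open_box _ _ e0) (Cinfty_smooth psi) (Cinfty_smooth phi).
Qed.

Section Limits.
Variables (F : set_system C) (FF : Filter F) (phi : C) (Fphi : F --> phi).

(** A single seminorm controls the derivatives in any order, by the
    symmetry of mixed partial derivatives. *)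
Lemma cvg_pds s z : box e0 z -> (fun psi : C => pds s psi z) @ F --> pds s phi z.
Proof.
move=> bz; apply/cvgrPdist_lt => eps eps0.
apply: filterS (Fphi (nbhs_seminorm_ball phi [ffun i => count_mem i s] eps0)) => psi.
rewrite /seminorm_ball /= => h; rewrite distrC -pds_sub // -lte_fin.
apply: le_lt_trans h.
rewrite (pd_multiE s (@open_box _ _ e0) (smooth_sub phi psi) (mem_set bz)).
exact: le_supnorm.
Qed.

Lemma cvg_xyblock a b : 0 < e0 ->
  (fun psi : C => xyblock psi 0 a b) @ F --> xyblock phi 0 a b.
Proof.
move=> e00; rewrite [X in _ --> X]xyblockE.
apply: (eq_cvgl (fun psi : C => xyblockE psi 0 a b)).
exact/cvg_pds/box0.
Qed.

(** Wherever the [x]-block is invertible, the expressions depend continuously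
    on the phase. *)
Lemma cvg_ev (e : @expr R m) : 0 < e0 -> xyblock phi 0 \in unitmx ->
  (fun psi : C => ev psi 0 e) @ F --> ev phi 0 e.
Proof.
move=> e00 u0; elim: e => [s|s|c|e1 IH1 e2 IH2|e1 IH1 e2 IH2|i j] /=.
- exact/cvg_pds/box0.
- exact/cvg_pds/box0.
- exact: cvg_cst.
- exact: cvgD.
- exact: cvgM.
- by apply: cvg_invmx => // a b; exact: cvg_xyblock.
Qed.

(** Maximal rank is witnessed by a right inverse [D], and the product of the
    contact matrix with [D] stays invertible nearby. *)
Lemma near_contact l : 0 < e0 -> xyblock phi 0 \in unitmx ->
  \rank (contact_jet l phi) = A m.+1 ->
  \forall psi \near F, xyblock (psi : C) 0 \in unitmx /\
     \rank (contact_jet l psi) = A m.+1.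
Proof.
move=> e00 u0 rk.
have n1 : \forall psi \near F, xyblock (psi : C) 0 \in unitmx.
  by apply: near_unitmx u0 => a b; exact: cvg_xyblock.
have /row_freeP[D DE] : row_free (contact_jet l phi) by rewrite /row_free rk.
have cD a b : (fun psi : C => (contact_jet l psi *m D) a b) @ F --> (contact_jet l phi *m D) a b.
  apply: cvg_mulmx => [r h|r h]; last exact: cvg_cst.
  have E (psi : C) : contact_jet l psi r h = ev psi 0 (iter h.+1 (@L R m) (eRow r)) by rewrite mxE.
  by rewrite E; apply: (eq_cvgl E); exact: cvg_ev.
have n2 : \forall psi \near F, contact_jet l (psi : C) *m D \in unitmx.
  by apply: (near_unitmx cD); rewrite DE unitmx1.
apply: filterS2 n1 n2 => psi h1 h2; split=> //.
apply/eqP; rewrite eqn_leq rank_leq_row.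
by have := mxrankM_maxl (contact_jet l psi) D; rewrite (mxrank_unit h2).
Qed.

End Limits.

Lemma open_contact_class l (H : set C) : 0 < e0 -> H `<=` Hormander_phases m e0 ->
  open (contact_class l H : set (subspace H)).
Proof.
move=> e00 sH; rewrite openE => phi [Hphi cphi]; rewrite /interior /=.
have h1 (psi : C) : H psi -> H1 psi 0 by move=> /sH /(_ 0 (box0 e00)) [].
have [u0 rk] := (contact_order_leE l e00 (Cinfty_smooth phi) (h1 _ Hphi)).1 cphi.
case: (nbhs_subspaceP H phi) => // _.
rewrite /within /=.
apply: filterS (near_contact (nbhs_filter (phi : C)) (@cvg_id _ _) e00 u0 rk) => psi [up rp] Hpsi.
split; first exact: Hpsi.
exact: ((contact_order_leE l e00 (Cinfty_smooth psi) (h1 _ Hpsi)).2 (conj up rp)).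
Qed.

Definition perturb phi (g : 'rV[R]_N -> R) (sg : smooth_on (box e0) g) (eps : R) : C :=
  MkCinfty (smoothDZ eps (@open_box _ _ e0) (Cinfty_smooth phi) sg).

(** [phi] satisfies the strict inequality that defines a ball, which leaves room
    for [eps] times a bound of the derivative of [g]. *)
Lemma cvg_perturb phi g (sg : smooth_on (box e0) g) : 0 < e0 ->
  (forall s, exists M, forall z, box e0 z -> `|pds s g z| <= M) ->
  perturb phi sg @ (0 : R) --> phi.
Proof.
move=> e00 bg; apply: (cvg_phase (fmap_filter _ (nbhs_filter (0 : R)))) => chi alpha r r0 hphi.
set s := flatten [seq nseq (alpha i) i | i <- enum 'I_N].
have [M hM] := bg s.
move: hphi; rewrite /seminorm_ball /=.
set S := supnorm _ _ => hS.
have S0 : (0%:E <= S)%E.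
  apply: le_trans (le_supnorm _ (box0 e00)); by rewrite lee_fin.
have Sfin : S \is a fin_num.
  by rewrite ge0_fin_numE //; apply: lt_trans hS _; rewrite ltry.
set v := fine S; have Sv : S = v%:E by rewrite fineK.
have vr : v < r by rewrite -lte_fin -Sv.
have M0 : 0 <= M by apply: le_trans (hM 0 (box0 e00)).
have : \forall eps \near (0 : R), `|eps| < (r - v) / (M + 1).
  by apply: near0_lt; rewrite normr0 divr_gt0 ?subr_gt0 // ltr_wpDl.
apply: filterS => eps; rewrite ltr_pdivlMr; last by rewrite ltr_wpDl.
move=> he; apply: (@le_lt_trans _ _ (v + `|eps| * M)%:E); last first.
  rewrite lte_fin; move: he; rewrite mulrDr mulr1.
  have := normr_ge0 eps; lra.
apply: supnorm_le => z bz.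
rewrite [pd_multi _ _ z](_ : _ = pds s (fun w => phi w - chi w) z + eps * pds s g z); last first.
  rewrite -[LHS]/(pds s (fun w => perturb phi sg eps w - chi w) z).
  rewrite !pds_sub // addrAC; congr (_ - _).
  by rewrite -(pdsDZ eps s (@open_box _ _ e0) (Cinfty_smooth phi) sg (mem_set bz)).
apply: le_trans (ler_normD _ _) _; rewrite normrM lerD //; last first.
  by rewrite ler_wpM2l // hM.
by rewrite -lee_fin -Sv; exact: le_supnorm.
Qed.

End PhaseTopology.

(** * Cut-off functions *)

Section FlatFunctions.
Context {R : realType}.
Implicit Types (p : {poly R}) (x u : R).

(** The functions [p (1/x) exp (-1/x)], extended by [0] to [x <= 0]; their
    derivatives are of the same form. *)
Definition flat p x : R := if 0 < x then p.[x^-1] * expR (- x^-1) else 0.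

Lemma exprn_le_expR n : exists2 K : R, 0 <= K & forall u, 0 <= u -> u ^+ n <= K * expR u.
Proof.
case: n => [|n].
  exists 1 => // u u0; rewrite expr0 mul1r.
  by apply: le_trans (expR_ge1Dx u); rewrite lerDl.
exists (n.+1%:R ^+ n.+1) => [|u u0]; first by rewrite exprn_ge0.
have n0 : (0 : R) < n.+1%:R by rewrite ltr0n.
have h : u / n.+1%:R <= expR (u / n.+1%:R).
  by apply: le_trans (expR_ge1Dx _); rewrite lerDr.
have : (u / n.+1%:R) ^+ n.+1 <= expR (u / n.+1%:R) ^+ n.+1.
  by rewrite lerXn2r // nnegrE ?expR_ge0 // divr_ge0 // ltW.
rewrite -expRM_natl (mulrC n.+1%:R) divfK ?gt_eqF // expr_div_n.
by rewrite ler_pdivrMr ?exprn_gt0 // mulrC.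
Qed.

Lemma horner_le_expR p : exists2 K : R, 0 <= K & forall u, 0 <= u -> `|p.[u]| <= K * expR u.
Proof.
have [K KP] := boolp.choice (fun n => let: ex_intro2 K h1 h2 := exprn_le_expR n in
   ex_intro (fun K => 0 <= K /\ forall u, 0 <= u -> u ^+ n <= K * expR u) K (conj h1 h2)).
exists (\sum_(i < size p) `|p`_i| * K i) => [|u u0].
  by apply: sumr_ge0 => i _; rewrite mulr_ge0 //; case: (KP i).
rewrite horner_coef mulr_suml; apply: le_trans (ler_norm_sum _ _ _) _.
apply: ler_sum => i _; rewrite normrM -mulrA ler_wpM2l //.
by rewrite ger0_norm ?exprn_ge0 //; case: (KP i) => _; apply.
Qed.

(** Quadratic decay at [0], hence differentiability with derivative [0] there. *)
Lemma flat_bound p : exists2 K : R, 0 <= K & forall x, `|flat p x| <= K * x ^+ 2.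
Proof.
have [K K0 KP] := horner_le_expR (p * 'X^2).
exists K => // x; rewrite /flat; case: ifPn => [x0|_]; last first.
  by rewrite normr0 mulr_ge0 // sqr_ge0.
have xi0 : 0 <= x^-1 by rewrite invr_ge0 ltW.
have := KP x^-1 xi0.
rewrite hornerM hornerXn normrM [X in _ * X <= _]ger0_norm ?exprn_ge0 //.
rewrite exprVn ler_pdivrMr ?exprn_gt0 // => h.
rewrite normrM [X in _ * X]ger0_norm ?expR_ge0 // expRN ler_pdivrMr ?expR_gt0 //.
by rewrite mulrAC.
Qed.

Lemma is_derive_flat p x : is_derive x 1 (flat p) (flat ('X^2 * (p - p^`())) x).
Proof.
have [x0|x0|->] := ltgtP x 0.
- rewrite {2}/flat ltNge ltW //=.
  have E : {near x, cst 0 =1 flat p}.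
    by near=> y; rewrite /flat ltNge ltW //; near: y; exact: lt_nbhsl.
  apply: near_eq_is_derive E _; exact: is_derive_cst.
- have E : {near x, (fun y => p.[y^-1] * expR (- y^-1)) =1 flat p}.
    by near=> y; rewrite /flat ifT //; near: y; exact: lt_nbhsr.
  apply: near_eq_is_derive E _.
  have xn0 : x != 0 by rewrite gt_eqF.
  rewrite /flat x0.
  have d1 : is_derive x 1 (fun y : R => y^-1) (- x ^- 2).
    apply: is_derive_eq (is_deriveV xn0 (is_derive_id x 1)) _.
    by rewrite -[_ *: _]/(_ * _) mulr1.
  have d2 : is_derive x^-1 1 (horner p) (p^`()).[x^-1].
    apply: DeriveDef; first exact: derivable_horner.
    by rewrite derivE derive1E.
  have d3 := is_derive1_comp d2 d1.
  have d4 : is_derive x 1 (fun y : R => - y^-1) (x ^- 2).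
    by apply: is_derive_eq (is_deriveN d1) _; rewrite opprK.
  have d5 := @is_derive1_comp R expR (fun y => - y^-1) x _ _ (is_derive_expR (- x^-1)) d4.
  apply: is_derive_eq (is_deriveM d3 d5) _.
  rewrite /GRing.scale /= hornerM hornerXn hornerD hornerN exprVn; ring.
- rewrite {2}/flat ltxx.
  have [K K0 KP] := flat_bound p.
  apply/is_derive_cvg.
  have E (h : R) : h^-1 * (flat p (h + 0) - flat p 0) = h^-1 * flat p h.
    by rewrite addr0 {2}/flat ltxx subr0.
  apply: (eq_cvgl E).
  apply/norm_cvg0P.
  apply: (@squeeze_cvgr _ _ _ _ (cst 0) (fun h => K * `|h|)); last first.
  + rewrite -[X in _ --> X](mulr0 K); apply: cvgM; first exact: cvg_cst.
    have : (fun h : R => `|h|) @ 0 --> `|0 : R| by apply: cvg_norm; exact: cvg_id.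
    by rewrite normr0 => /cvg_within_filter; apply.
  + exact: cvg_cst.
  + near=> h; rewrite /= normr_ge0 /= normrM normfV.
    have h0 : 0 < `|h| by rewrite normr_gt0; near: h; exact: nbhs_dnbhs_neq.
    rewrite ler_pdivrMl //; apply: le_trans (KP h) _.
    by rewrite -real_normK ?num_real // expr2 mulrCA mulrA.
Unshelve. all: by end_near. Qed.

(** The inner [flat] vanishes for [|x| <= 1], and the argument of the outer one is
    negative for [2 <= |x|]: the value is [1] on [-1, 1] and [0] outside [-2, 2]. *)
Definition plateau x : R :=
  expR 1 * flat 1 (1 - expR 1 * flat 1 (x ^+ 2 - 1)).

Lemma plateau1 x : `|x| <= 1 -> plateau x = 1.
Proof.
move=> x1; have h : x ^+ 2 <= 1 by rewrite -real_normK ?num_real // exprn_ile1.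
rewrite /plateau /flat [0 < x ^+ 2 - 1]ltNge subr_le0 h /= mulr0 subr0 ltr01.
by rewrite hornerC mul1r invr1 -expRD subrr expR0.
Qed.

Lemma plateau0 x : 2 <= `|x| -> plateau x = 0.
Proof.
move=> x2; have h : 4 <= x ^+ 2.
  rewrite -real_normK ?num_real // (_ : 4 = 2 ^+ 2); last by rewrite -natrX.
  by rewrite lerXn2r // nnegrE.
have x0 : 0 < x ^+ 2 - 1 by lra.
rewrite /plateau {1}/flat ltNge (_ : _ <= 0) ?mulr0 // subr_le0 /flat x0 hornerC mul1r.
rewrite -expRD -[leLHS]expR0 ler_expR subr_ge0 invf_le1 //; lra.
Qed.

End FlatFunctions.

Section ElementaryFunctions.
Context {R : realType} {N : nat}.
Implicit Types (f g : 'rV[R]_N -> R) (z : 'rV[R]_N).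
Local Notation e i := (delta_mx 0 i : 'rV[R]_N).

(** A class of functions closed under partial derivatives, hence of smooth
    functions, that contains the polynomials and the cut-off functions. *)
Inductive elementary : ('rV[R]_N -> R) -> Prop :=
| elementary_cst c : elementary (fun=> c)
| elementary_coord i : elementary (fun z => z 0 i)
| elementary_add f g : elementary f -> elementary g -> elementary (fun z => f z + g z)
| elementary_mul f g : elementary f -> elementary g -> elementary (fun z => f z * g z)
| elementary_flat p f : elementary f -> elementary (fun z => flat p (f z)).

Lemma is_derive_coord z i j :
  is_derive z (e j) (fun w : 'rV[R]_N => w 0 i) ((i == j)%:R : R).
Proof.
have E : (fun h : R => h^-1 *: ((h *: e j + z) 0 i - z 0 i)) @ 0^' --> ((i == j)%:R : R).
  have : {near (0 : R)^', cst ((i == j)%:R : R) =1 (fun h : R => h^-1 *: ((h *: e j + z) 0 i - z 0 i))}.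
    near=> h; have h0 : h != 0 by near: h; exact: nbhs_dnbhs_neq.
    by rewrite (addrC (h *: _)) addeE addrAC subrr add0r -[_ *: _]/(_ * _) mulKf.
  move=> /near_eq_cvg c; apply: cvg_trans c _; exact: cvg_cst.
apply: DeriveDef; first by apply/cvg_ex; exists (i == j)%:R.
by apply/cvg_lim.
Unshelve. all: by end_near. Qed.

Lemma is_derive_flat_comp p f z v (df : R) : is_derive z v f df ->
  is_derive z v (fun w => flat p (f w)) (flat ('X^2 * (p - p^`())) (f z) * df).
Proof.
move=> [d <-].
have E (g : 'rV[R]_N -> R) (l : R) : is_derive z v g l <-> is_derive (0 : R) 1 (fun h : R => g (h *: v + z)) l.
  have Q : (fun h : R => h^-1 *: (g (h *: v + z) - g z)) =
      (fun h : R => h^-1 *: (g ((h *: (1:R) + 0) *: v + z) - g (0 *: v + z))).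
    by apply/funext => h; rewrite addr0 scale0r add0r -[h%:A]/(h * 1) mulr1.
  split=> -[d1 d2].
    apply: DeriveDef; first by move: d1; rewrite /derivable /= Q.
    by rewrite -d2 /derive /= Q.
  apply: DeriveDef; first by move: d1; rewrite /derivable /= Q.
  by rewrite -d2 /derive /= Q.
have /E d1 : is_derive z v f ('D_v f z) by apply: DeriveDef.
apply/E; have := is_derive1_comp (is_derive_flat p (f (0 *: v + z))) d1.
by rewrite scale0r add0r mulrC.
Qed.

Lemma elementary_deriv f : elementary f -> continuous f /\ forall i,
  (forall z, derivable f z (e i)) /\ elementary (pd i f).
Proof.
elim=> {f} [c|j|f g ef [cf IHf] eg [cg IHg]|f g ef [cf IHf] eg [cg IHg]|p f ef [cf IHf]].
- split=> [|i]; first exact: cst_continuous.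
  split=> [z|]; first exact: derivable_cst.
  rewrite (_ : pd i _ = fun=> 0); first exact: elementary_cst.
  by apply/funext => z; rewrite /pd derive_cst.
- split=> [z|i]; first exact: coord_continuous.
  split=> [z|]; first by case: (is_derive_coord z j i).
  rewrite (_ : pd i _ = fun=> (j == i)%:R); first exact: elementary_cst.
  by apply/funext => z; rewrite /pd; case: (is_derive_coord z j i).
- split=> [z|i]; first exact: (cvgD (cf z) (cg z)).
  have [df ef'] := IHf i; have [dg eg'] := IHg i.
  split=> [z|]; first by apply: derivableD; [exact: df|exact: dg].
  rewrite (_ : pd i _ = fun z => pd i f z + pd i g z); first exact: elementary_add.
  by apply/funext => z; rewrite /pd deriveD; [|exact: df|exact: dg].
- split=> [z|i]; first exact: (cvgM (cf z) (cg z)).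
  have [df ef'] := IHf i; have [dg eg'] := IHg i.
  split=> [z|]; first by apply: derivableM; [exact: df|exact: dg].
  rewrite (_ : pd i _ = fun z => f z * pd i g z + g z * pd i f z).
    by apply: elementary_add; exact: elementary_mul.
  by apply/funext => z; rewrite /pd deriveM; [|exact: df|exact: dg].
- have cfl : continuous (flat p).
    move=> x; apply/differentiable_continuous/derivable1_diffP.
    by case: (is_derive_flat p x).
  split=> [z|i]; first by apply: (cvg_comp _ _ (cf z)); exact: cfl.
  have [df ef'] := IHf i.
  have D z : is_derive z (e i) (fun w => flat p (f w))
      (flat ('X^2 * (p - p^`())) (f z) * pd i f z).
    by apply: is_derive_flat_comp; apply: DeriveDef; first exact: df.
  split=> [z|]; first by case: (D z).
  rewrite (_ : pd i _ = fun z => flat ('X^2 * (p - p^`())) (f z) * pd i f z).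
    by apply: elementary_mul => //; exact: elementary_flat.
  by apply/funext => z; rewrite {1}/pd; case: (D z).
Qed.

Lemma elementary_pds s f : elementary f -> elementary (pds s f).
Proof.
move=> ef; elim: s => [//|i s IH].
by have [_ /(_ i) []] := elementary_deriv IH.
Qed.

Lemma elementary_smooth U f : elementary f -> smooth_on U f.
Proof.
move=> ef s z _; have [c d] := elementary_deriv (elementary_pds s ef).
by split=> [|i]; [exact: c|have [h _] := d i; exact: h].
Qed.

Lemma elementary_sum (I : Type) (r : seq I) (F : I -> 'rV[R]_N -> R) :
  (forall i, elementary (F i)) -> elementary (fun z => \sum_(i <- r) F i z).
Proof.
move=> eF; elim: r => [|i r IH].
  rewrite (_ : (fun z => _) = fun=> 0); first exact: elementary_cst.
  by apply/funext => z; rewrite big_nil.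
rewrite (_ : (fun z => _) = fun z => F i z + \sum_(i <- r) F i z).
  exact: elementary_add.
by apply/funext => z; rewrite big_cons.
Qed.

Lemma elementary_prod (I : Type) (r : seq I) (F : I -> 'rV[R]_N -> R) :
  (forall i, elementary (F i)) -> elementary (fun z => \prod_(i <- r) F i z).
Proof.
move=> eF; elim: r => [|i r IH].
  rewrite (_ : (fun z => _) = fun=> 1); first exact: elementary_cst.
  by apply/funext => z; rewrite big_nil.
rewrite (_ : (fun z => _) = fun z => F i z * \prod_(i <- r) F i z).
  exact: elementary_mul.
by apply/funext => z; rewrite big_cons.
Qed.

Lemma elementary_horner (p : {poly R}) f : elementary f -> elementary (fun z => p.[f z]).
Proof.
move=> ef; elim/poly_ind: p => [|p c IH].
  rewrite (_ : (fun z => _) = fun=> 0); first exact: elementary_cst.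
  by apply/funext => z; rewrite horner0.
rewrite (_ : (fun z => _) = fun z => p.[f z] * f z + c).
  by apply: elementary_add; [exact: elementary_mul|exact: elementary_cst].
by apply/funext => z; rewrite hornerMXaddC.
Qed.

Definition cutoff (rho : R) z : R := \prod_i plateau (z 0 i / rho).

Lemma elementary_cutoff rho : elementary (cutoff rho).
Proof.
rewrite /cutoff; apply: elementary_prod => i; rewrite /plateau.
apply: elementary_mul; first exact: elementary_cst.
apply: elementary_flat.
rewrite (_ : (fun z => _) = fun z : 'rV[R]_N =>
  1 + (- expR 1) * flat 1 ((z 0 i * rho^-1) * (z 0 i * rho^-1) + (- 1))).
  have ec : elementary (fun z => z 0 i * rho^-1).
    by apply: elementary_mul; [exact: elementary_coord|exact: elementary_cst].
  apply: elementary_add; first exact: elementary_cst.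
  apply: elementary_mul; first exact: elementary_cst.
  apply: elementary_flat; apply: elementary_add; last exact: elementary_cst.
  exact: elementary_mul.
by apply/funext => z; rewrite mulNr expr2.
Qed.

Lemma cutoff1 rho z : 0 < rho -> (forall i, `|z 0 i| <= rho) -> cutoff rho z = 1.
Proof.
move=> r0 h; apply: big1 => i _; apply: plateau1.
by rewrite normrM normfV (gtr0_norm r0) ler_pdivrMr // mul1r.
Qed.

Lemma cutoff0 rho z i : 0 < rho -> 2 * rho <= `|z 0 i| -> cutoff rho z = 0.
Proof.
move=> r0 h; rewrite /cutoff (bigD1 i) //= plateau0 ?mul0r //.
by rewrite normrM normfV (gtr0_norm r0) ler_pdivlMr.
Qed.

Section CompactSupport.
Variables (f : 'rV[R]_N -> R) (r : R).
Hypotheses (ef : elementary f) (fr : forall z i, r <= `|z 0 i| -> f z = 0).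

Lemma pds_support s z i : r < `|z 0 i| -> pds s f z = 0.
Proof.
move=> rz.
pose O : set 'rV[R]_N := (fun w : 'rV[R]_N => `|w 0 i|) @^-1` [set u | r < u].
have oO : open O.
  apply: open_comp; last exact: open_gt.
  move=> w _; have c : (fun w : 'rV[R]_N => w 0 i) @ w --> w 0 i by exact: coord_continuous.
  exact: cvg_norm c.
have f0 : {in O, f =1 fun=> 0} by move=> w /set_mem Ow; apply: (fr (ltW Ow)).
rewrite (eq_pds_open s oO f0 (mem_set rz)).
suff -> : pds s (fun=> 0) = (fun=> 0) :> ('rV[R]_N -> R) by [].
elim: s => [//|j s IH] /=; rewrite IH; apply/funext => w.
by rewrite /pd derive_cst.
Qed.

Lemma pds_bounded s : exists M, forall z, `|pds s f z| <= M.
Proof.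
pose K : set 'rV[R]_N := [set z | forall i, `|z 0 i| <= `|r|].
have cK : compact K := @compact_cube R N `|r|.
have cf : {within K, continuous (fun z => `|pds s f z|)}.
  apply: continuous_in_subspaceT => z _.
  have [c _] := elementary_deriv (elementary_pds s ef); exact: cvg_norm (c z).
have K0 : K !=set0 by exists 0 => i; rewrite mxE normr0.
have [c _ cmax] := EVT_max_rV K0 cK cf.
exists `|pds s f c| => z.
have [Kz|/existsNP[i /negP]] := pselect (K z); first exact/cmax/mem_set.
rewrite -ltNge => zi; rewrite (@pds_support s z i) ?normr0 //.
by apply: le_lt_trans zi; exact: ler_norm.
Qed.

End CompactSupport.

End ElementaryFunctions.

(** * Jets of functions of one variable *)

Section Jets.
Context {R : realType}.
Variable del : R.
Hypothesis del0 : 0 < del.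
Implicit Types (u v : R -> R) (p q : {poly R}).

(** [u] is [n] times differentiable on ]-del, del[ with the Taylor coefficients of
    [p]. The recursion follows the derivatives, so that Leibniz' rule for
    jets is an induction from the rule for first derivatives. *)
Fixpoint jet n u p : Prop := u 0 = p`_0 /\
  if n is k.+1 then (forall t, `|t| < del -> derivable u t 1) /\ jet k (derive1 u) p^`()
  else True.

Let d0 : `|0 : R| < del. Proof. by rewrite normr0. Qed.

Lemma eq_jet n u v p : (forall t, `|t| < del -> u t = v t) -> jet n u p -> jet n v p.
Proof.
elim: n u v p => [|n IH] u v p uv [h0 h]; split; rewrite -?(uv 0 d0) //.
case: h => du h; split.
  move=> t td; apply: near_eq_derivable (du t td).
  by apply: filterS (near0_lt td) => s /uv.
apply: IH h => t td; exact: (eq_derive1n uv 1 td).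
Qed.

Lemma jetW n u p : jet n.+1 u p -> jet n u p.
Proof.
elim: n u p => [|n IH] u p [h0 [du h]]; first by split.
by split=> //; split=> //; exact: IH.
Qed.

Lemma jetD n u v p q : jet n u p -> jet n v q -> jet n (fun t => u t + v t) (p + q).
Proof.
elim: n u v p q => [|n IH] u v p q [u0 hu] [v0 hv]; split; rewrite ?coefD ?u0 ?v0 //.
case: hu => du hu; case: hv => dv hv; split.
  by move=> t td; apply: derivableD; [exact: du|exact: dv].
rewrite derivD; apply: eq_jet (IH _ _ _ _ hu hv) => t td.
by rewrite [RHS]derive1E !derive1E deriveD; [|exact: du|exact: dv].
Qed.

Lemma jetM n u v p q : jet n u p -> jet n v q -> jet n (fun t => u t * v t) (p * q).
Proof.
elim: n u v p q => [|n IH] u v p q hu0 hv0.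
  by case: hu0 => u0 _; case: hv0 => v0 _; split=> //; rewrite coef0M u0 v0.
have hu1 := jetW hu0; have hv1 := jetW hv0.
case: hu0 => u0 [du hu]; case: hv0 => v0 [dv hv]; split; first by rewrite coef0M u0 v0.
split; first by move=> t td; apply: derivableM; [exact: du|exact: dv].
rewrite derivM; apply: eq_jet (jetD (IH _ _ _ _ hu hv1) (IH _ _ _ _ hu1 hv)) => t td.
rewrite [RHS]derive1E !derive1E deriveM; [|exact: du|exact: dv].
by rewrite addrC [_ * v t]mulrC.
Qed.

Lemma jet_poly n p : jet n (fun t => p.[t]) p.
Proof.
elim: n p => [|n IH] p; split=> //; rewrite ?horner_coef0 //.
split; first by move=> t _; exact: derivable_horner.
by apply: eq_jet (IH p^`()) => t _; rewrite derivE.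
Qed.

Lemma jet_sum n (I : Type) (s : seq I) (u : I -> R -> R) (p : I -> {poly R}) :
  (forall i, jet n (u i) (p i)) -> jet n (fun t => \sum_(i <- s) u i t) (\sum_(i <- s) p i).
Proof.
move=> h; elim: s => [|i s IH].
  rewrite big_nil; apply: eq_jet (jet_poly n 0) => t _.
  by rewrite big_nil horner0.
by rewrite big_cons; apply: eq_jet (jetD (h i) IH) => t _; rewrite big_cons.
Qed.

Lemma jet_prod n (I : Type) (s : seq I) (u : I -> R -> R) (p : I -> {poly R}) :
  (forall i, jet n (u i) (p i)) -> jet n (fun t => \prod_(i <- s) u i t) (\prod_(i <- s) p i).
Proof.
move=> h; elim: s => [|i s IH].
  rewrite big_nil; apply: eq_jet (jet_poly n 1) => t _.
  by rewrite big_nil hornerC.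
by rewrite big_cons; apply: eq_jet (jetM (h i) IH) => t _; rewrite big_cons.
Qed.

Lemma jetX n k u p : jet n u p -> jet n (fun t => u t ^+ k) (p ^+ k).
Proof.
move=> h; elim: k => [|k IH].
  by apply: eq_jet (jet_poly n 1) => t _; rewrite hornerC.
by rewrite exprS; apply: eq_jet (jetM h IH) => t _; rewrite exprS.
Qed.

Lemma jet_det n m (u : 'I_m -> 'I_m -> R -> R) (p : 'I_m -> 'I_m -> {poly R}) :
  (forall i j, jet n (u i j) (p i j)) ->
  jet n (fun t => \det (\matrix_(i, j) u i j t)) (\det (\matrix_(i, j) p i j)).
Proof.
move=> h; apply: jet_sum => s.
have := jetM (jet_poly n (((-1) ^+ s : R)%:P)) (jet_prod (index_enum _) (fun i => h i (s i))).
congr (jet _ _ _).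
  apply/funext => t; rewrite hornerC; congr (_ * _).
  by apply: eq_bigr => i _; rewrite mxE.
by congr (_ * _); [rewrite rmorph_sign|apply: eq_bigr => i _; rewrite mxE].
Qed.

Lemma jet_derive1n n u p k : jet n u p -> (k <= n)%N -> derive1n k u 0 = p`_k *+ k`!.
Proof.
elim: n u p k => [|n IH] u p [|k] [h0 h] //; rewrite ?mulr1n // => kn.
case: h => _ /IH h; rewrite derive1Sn h // coef_deriv -mulrnA.
by rewrite factS.
Qed.

Definition taylor n u : {poly R} := \poly_(k < n.+1) (derive1n k u 0 / k`!%:R).

Lemma taylor_jet n u : (forall k t, `|t| < del -> derivable (derive1n k u) t 1) ->
  jet n u (taylor n u).
Proof.
move=> du; have : forall k, (k <= n)%N -> derive1n k u 0 = (taylor n u)`_k *+ k`!.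
  move=> k kn; rewrite coef_poly ltnS kn -[RHS]mulr_natr divfK //.
move: (taylor n u) => p.
elim: n u p du => [|n IH] u p du h; split=> //; do ?exact: (h 0%N).
split; first by move=> t; exact: (du 0%N).
apply: IH => [k t td|k kn]; first by rewrite -derive1Sn; exact: (du k.+1).
by rewrite -derive1Sn (h k.+1) // coef_deriv -mulrnA factS.
Qed.

End Jets.

Section JetComparison.
Context {R : realType}.
Implicit Types (u v : R -> R) (p : {poly R}).

Lemma eq_taylor (del : R) n (u v : R -> R) : 0 < del ->
  (forall t, `|t| < del -> u t = v t) -> taylor n u = taylor n v.
Proof.
move=> del0 uv; apply/polyP => k; rewrite !coef_poly (eq_derive1n uv) //.
by rewrite normr0.
Qed.

Lemma jet_mono (d del : R) n u p : d <= del -> jet del n u p -> jet d n u p.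
Proof.
move=> le; elim: n u p => [//|n IH] u p [h0 [du h]]; split=> //; split; last exact: IH.
by move=> t td; apply: du; exact: lt_le_trans le.
Qed.

End JetComparison.

(** * Full rank along segments of jets *)

Section PolynomialFamilies.
Context {R : realType}.

Definition polyfun (F : R -> R) : Prop := exists P : {poly R}, forall s, F s = P.[s].

Lemma polyfun_cst c : polyfun (fun=> c).
Proof. by exists c%:P => s; rewrite hornerC. Qed.

Lemma polyfun_id : polyfun id.
Proof. by exists 'X => s; rewrite hornerX. Qed.

Lemma polyfunD F G : polyfun F -> polyfun G -> polyfun (fun s => F s + G s).
Proof. by move=> [P hP] [Q hQ]; exists (P + Q) => s; rewrite hornerD hP hQ. Qed.

Lemma polyfunM F G : polyfun F -> polyfun G -> polyfun (fun s => F s * G s).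
Proof. by move=> [P hP] [Q hQ]; exists (P * Q) => s; rewrite hornerM hP hQ. Qed.

Lemma polyfun_sum (I : Type) (r : seq I) (F : I -> R -> R) :
  (forall i, polyfun (F i)) -> polyfun (fun s => \sum_(i <- r) F i s).
Proof.
by move=> /boolp.choice[P hP]; exists (\sum_(i <- r) P i) => s; rewrite horner_sum; apply: eq_bigr => i _.
Qed.

Lemma polyfun_prod (I : Type) (r : seq I) (F : I -> R -> R) :
  (forall i, polyfun (F i)) -> polyfun (fun s => \prod_(i <- r) F i s).
Proof.
by move=> /boolp.choice[P hP]; exists (\prod_(i <- r) P i) => s; rewrite horner_prod; apply: eq_bigr => i _.
Qed.

Lemma polyfun_det k (F : R -> 'M[R]_k) :
  (forall i j, polyfun (fun s => F s i j)) -> polyfun (fun s => \det (F s)).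
Proof.
move=> h; apply: polyfun_sum => s; apply: polyfunM; first exact: polyfun_cst.
by apply: polyfun_prod => i.
Qed.

(** After division by a power of [X] the polynomial is non-zero at [0] itself. *)
Lemma near_polyfun F s0 : polyfun F -> F s0 != 0 -> \forall s \near (0 : R)^', F s != 0.
Proof.
move=> [P FP] Fs; have P0 : P != 0 by apply: contraNneq Fs => P0; rewrite FP P0 horner0.
have [n [Q /implyP Q0 PE]] := multiplicity_XsubC P 0.
have {}Q0 := Q0 P0.
have nQ : \forall s \near (0 : R)^', Q.[s] != 0.
  apply: (@cvg_within _ (nbhs (0 : R)) _).
  have c : (fun s => Q.[s]) @ (0 : R) --> Q.[0] by exact: continuous_horner.
  by apply: (c [set u | u != 0]); apply: open_nbhs_nbhs; split; [exact: open_neq|].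
near=> s; rewrite FP PE hornerM mulf_neq0 //; first by near: s.
rewrite horner_exp hornerXsubC subr0 expf_neq0 //; near: s; exact: nbhs_dnbhs_neq.
Unshelve. all: by end_near. Qed.

Definition polyfam (F : R -> {poly R}) : Prop := forall k, polyfun (fun s => (F s)`_k).

Lemma polyfam_cst c : polyfam (fun=> c).
Proof. by move=> k; exact: polyfun_cst. Qed.

Lemma polyfamD F G : polyfam F -> polyfam G -> polyfam (fun s => F s + G s).
Proof.
move=> hF hG k; have [P hP] := polyfunD (hF k) (hG k).
by exists P => s; rewrite coefD hP.
Qed.

Lemma polyfamM F G : polyfam F -> polyfam G -> polyfam (fun s => F s * G s).
Proof.
move=> hF hG k.
have [P hP] := polyfun_sum (index_enum 'I_k.+1) (fun i => polyfunM (hF i) (hG (k - i)%N)).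
by exists P => s; rewrite coefM hP.
Qed.

Lemma polyfamZ (c : {poly R}) : polyfam (fun s => s *: c).
Proof.
move=> k; have [P hP] := polyfunM polyfun_id (polyfun_cst c`_k).
by exists P => s; rewrite coefZ -hP.
Qed.

Lemma polyfam_sum (I : Type) (r : seq I) (F : I -> R -> {poly R}) :
  (forall i, polyfam (F i)) -> polyfam (fun s => \sum_(i <- r) F i s).
Proof.
move=> h; elim: r => [|i r IH].
  by under eq_fun do rewrite big_nil; exact: polyfam_cst.
by under eq_fun do rewrite big_cons; exact: polyfamD.
Qed.

Lemma polyfam_prod (I : Type) (r : seq I) (F : I -> R -> {poly R}) :
  (forall i, polyfam (F i)) -> polyfam (fun s => \prod_(i <- r) F i s).
Proof.
move=> h; elim: r => [|i r IH].
  by under eq_fun do rewrite big_nil; exact: polyfam_cst.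
by under eq_fun do rewrite big_cons; exact: polyfamM.
Qed.

Lemma polyfamX k F : polyfam F -> polyfam (fun s => F s ^+ k).
Proof.
move=> h; elim: k => [|k IH]; first exact: polyfam_cst.
by under eq_fun do rewrite exprS; exact: polyfamM.
Qed.

(** The determinant of the product with a right inverse of the matrix at [q] is a
    polynomial on the segment, with value [1] at [q]: it has finitely many roots. *)
Lemma near_row_free_segment m l (T q : 'I_m -> 'I_m -> {poly R}) :
  row_free (jetmx l q) ->
  \forall s \near (0 : R)^', row_free (jetmx l (fun i j => T i j + s *: (q i j - T i j))).
Proof.
move=> /row_freeP[D DE].
pose S (s : R) i j := T i j + s *: (q i j - T i j).
have pS i j : polyfam (fun s => S s i j) by apply: polyfamD; [exact: polyfam_cst|exact: polyfamZ].
have pJ r h : polyfun (fun s => jetmx l (S s) r h).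
  have pn (F : R -> {poly R}) k n : polyfam F -> polyfun (fun s => (F s)`_k *+ n).
    move=> /(_ k) hF; have [P hP] := polyfunM hF (polyfun_cst n%:R).
    by exists P => s; rewrite -mulr_natr hP.
  rewrite -(splitK r); case: (fintype.split r) => k /=.
    under eq_fun do rewrite col_mxEu mxE; apply: pn.
    apply: polyfam_sum => s; apply: polyfamM; first exact: polyfam_cst.
    apply: polyfam_prod => i; under eq_fun do rewrite mxE; exact: pS.
  under eq_fun do rewrite col_mxEd mxE; apply: pn.
  by apply: polyfam_prod => p; apply: polyfamX.
have pdet : polyfun (fun s => \det (jetmx l (S s) *m D)).
  apply: polyfun_det => r c; under eq_fun do rewrite mxE.
  by apply: polyfun_sum => h; apply: polyfunM => //; exact: polyfun_cst.
have D1 : \det (jetmx l (S 1) *m D) != 0.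
  suff -> : S 1 = q by rewrite DE det1 oner_neq0.
  by apply/funext => i; apply/funext => j; rewrite /S scale1r addrC subrK.
apply: filterS (near_polyfun pdet D1) => s hs.
have u : jetmx l (S s) *m D \in unitmx by rewrite unitmxE unitfE.
rewrite /row_free eqn_leq rank_leq_row.
by have := mxrankM_maxl (jetmx l (S s)) D; rewrite (mxrank_unit u).
Qed.

End PolynomialFamilies.

(** * Stability of the conditions [H1] and [H2] *)

Section Curvature.
Context {R : realType} {m : nat}.
Local Notation N := (m + 1 + m)%N.
Implicit Types (f g : 'rV[R]_N -> R) (z : 'rV[R]_N) (P : seq 'I_N -> R).

Definition jet_mixed P : 'M[R]_(m, m + 1) := \matrix_(j, a) P [:: yi j; bxi a].

Definition jet_gauss P (a : 'I_(m + 1)) : R := \det (col_mx (jet_mixed P) (delta_mx 0 a)).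

(** The determinant of the condition [H2], as a polynomial in the derivatives
    of the phase at a single point. *)
Definition jet_curvature P : R :=
  \det (\matrix_(j < m, k < m) \sum_a P [:: yi j; yi k; bxi a] * jet_gauss P a).

Lemma eq_jet_curvature P P' : P =1 P' -> jet_curvature P = jet_curvature P'.
Proof. by move=> /funext ->. Qed.

Lemma cvg_jet_curvature (T : Type) (F : set_system T) (FF : Filter F)
    (P : T -> seq 'I_N -> R) P0 : (forall s, (fun w => P w s) @ F --> P0 s) ->
  (fun w => jet_curvature (P w)) @ F --> jet_curvature P0.
Proof.
move=> cP; apply: cvg_det => j k.
rewrite mxE; under eq_fun do rewrite mxE.
apply: cvg_sumR => a _; apply: cvgM; first exact: cP.
apply: cvg_det => i b.
rewrite -(splitK i); case: (fintype.split i) => c /=.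
  rewrite col_mxEu mxE; under eq_fun do rewrite col_mxEu mxE; exact: cP.
rewrite col_mxEd; under eq_fun do rewrite col_mxEd; exact: cvg_cst.
Qed.

Lemma is_derive_sumr (z v : 'rV[R]_N) (I : Type) (r : seq I)
    (F : I -> 'rV[R]_N -> R) (d : I -> R) : (forall i, is_derive z v (F i) (d i)) ->
  is_derive z v (fun w => \sum_(i <- r) F i w) (\sum_(i <- r) d i).
Proof.
move=> h; elim: r => [|i r IH].
  by rewrite big_nil; under eq_fun do rewrite big_nil; exact: is_derive_cst.
rewrite big_cons; under eq_fun do rewrite big_cons.
exact: (is_deriveD (h i) IH).
Qed.

Lemma is_derive_mulr (z v : 'rV[R]_N) f c (d : R) : is_derive z v f d ->
  is_derive z v (fun w => f w * c) (d * c).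
Proof.
move=> h; under eq_fun do rewrite mulrC.
by rewrite mulrC; exact: (is_deriveZ c h).
Qed.

Lemma H2E e0 f z : smooth_on (box e0) f -> box e0 z ->
  H2 f z <-> jet_curvature (fun s => pds s f z) != 0.
Proof.
move=> sf bz; rewrite /H2 /jet_curvature.
have gE a z' : grad_bx f z' 0 a = pd (bxi a) f z' by rewrite mxE.
have GE a : G0 f z 0 a = jet_gauss (fun s => pds s f z) a by rewrite mxE.
suff -> : (\matrix_(j < m, k < m)
    pd (yi j) (pd (yi k) (fun z' => dotp (grad_bx f z') (G0 f z))) z) =
  (\matrix_(j < m, k < m) \sum_a pds [:: yi j; yi k; bxi a] f z *
     jet_gauss (fun s => pds s f z) a) by [].
apply/matrixP => j k; rewrite mxE [RHS]mxE.
have D s i w : box e0 w -> is_derive w (delta_mx 0 i)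
    (fun z' => \sum_a pds (rcons s (bxi a)) f z' * G0 f z 0 a)
    (\sum_a pds (i :: rcons s (bxi a)) f w * G0 f z 0 a).
  move=> bw; apply: is_derive_sumr => a; apply: is_derive_mulr.
  apply: DeriveDef; last by [].
  exact: (smooth_derivable i (smooth_pds (rcons s (bxi a)) sf) bw).
have E1 w : box e0 w -> pd (yi k) (fun z' => dotp (grad_bx f z') (G0 f z)) w =
    \sum_a pds [:: yi k; bxi a] f w * G0 f z 0 a.
  move=> bw; have [_ E] := D [::] (yi k) w bw; rewrite -[RHS]E /pd.
  suff -> : (fun z' => dotp (grad_bx f z') (G0 f z)) =
      (fun z' => \sum_a pds (rcons [::] (bxi a)) f z' * G0 f z 0 a) by [].
  apply/funext => z'; apply: eq_bigr => a _; congr (_ * _).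
  exact: gE.
rewrite (eq_pd_open (yi j) (@open_box _ _ e0) (fun w h => E1 w (set_mem h)) bz).
have [_ E2] := D [:: yi k] (yi j) z bz.
rewrite [LHS]E2; apply: eq_bigr => a _; congr (_ * _); exact: GE.
Qed.

(** A degenerate mixed Hessian has vanishing maximal minors, so that [H2]
    contains [H1]. *)
Lemma H1_of_H2 e0 f z : (0 < m)%N -> smooth_on (box e0) f -> box e0 z ->
  H2 f z -> H1 f z.
Proof.
move=> m0 sf bz /(H2E sf bz) h; apply/eqP; rewrite eqn_leq rank_leq_row /=.
rewrite leqNgt; apply/negP => rk; move/eqP: h; apply.
rewrite /jet_curvature [X in \det X](_ : _ = 0); first by rewrite -(scale0r 1%:M) detZ expr0n gtn_eqF // mul0r.
apply/matrixP => j k; rewrite mxE [RHS]mxE; apply: big1 => a _.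
  suff -> : jet_gauss (fun s => pds s f z) a = 0 by rewrite mulr0.
  apply/eqP; apply: contraTT rk => h; rewrite -leqNgt.
  have : col_mx (mixed_hessian f z) (delta_mx 0 a) \in unitmx by rewrite unitmxE unitfE.
  move=> /mxrank_unit rc.
  have := mxrank_adds_leqif (mixed_hessian f z) (delta_mx 0 a : 'rV_(m + 1)) => -[+ _].
  rewrite addsmxE rc => h1; have := leq_trans h1 (leq_add (leqnn _) (rank_leq_row _)).
by rewrite leq_add2r.
Qed.

Section Stability.
Variables (e0 : R) (phi : Cinfty m e0) (g : 'rV[R]_N -> R) (r : R).
Hypothesis (gr : forall z i, r <= `|z 0 i| -> g z = 0).
Hypothesis rbox : forall z, (forall i, `|z 0 i| <= r) -> box e0 z.
Variable sg : smooth_on (box e0) g.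

Lemma pds_perturb s (eps : R) z : box e0 z ->
  pds s (perturb phi sg eps) z = pds s phi z + eps * pds s g z.
Proof.
move=> bz.
by rewrite -(pdsDZ eps s (@open_box _ _ e0) (Cinfty_smooth phi) sg (mem_set bz)).
Qed.

(** The condition [H2] is open at each point, hence persists for small
    perturbations on the compact support of [g]; elsewhere nothing changes. *)
Lemma near_Hormander : (0 < m)%N -> Hormander_phases m e0 phi ->
  \forall eps \near (0 : R), Hormander_phases m e0 (perturb phi sg eps).
Proof.
move=> m0 hphi.
pose K : set 'rV[R]_N := [set z | forall i, `|z 0 i| <= r].
pose V (eps : R) z := jet_curvature (fun s => pds s phi z + eps * pds s g z) != 0.
have cov : near_covering K by apply/compact_near_coveringP; exact: compact_cube.
have nK : \forall eps \near (0 : R), K `<=` V eps.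
  apply: (cov R (nbhs (0 : R)) V (nbhs_filter _)) => z Kz; have bz := rbox Kz.
  have [_ /(H2E (Cinfty_smooth phi) bz) h2] := hphi z bz.
  pose F : set_system ('rV[R]_N * R) := filter_prod (nbhs z) (nbhs (0 : R)).
  have c : (fun w : 'rV[R]_N * R => jet_curvature (fun s => pds s phi w.1 + w.2 * pds s g w.1)) @ F
     --> jet_curvature (fun s => pds s phi z).
    apply: cvg_jet_curvature => s.
    rewrite -[X in _ --> X]addr0 -(mul0r (pds s g z)).
    have c1 : (fun w : 'rV[R]_N * R => w.1) @ F --> z by exact: cvg_fst.
    have c2 : (fun w : 'rV[R]_N * R => w.2) @ F --> (0 : R) by exact: cvg_snd.
    apply: cvgD.
      apply: (cvg_comp _ _ c1); exact: (smooth_continuous (smooth_pds s (Cinfty_smooth phi)) bz).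
    apply: cvgM; first exact: c2.
    apply: (cvg_comp _ _ c1); exact: (smooth_continuous (smooth_pds s sg) bz).
  apply: (c [set u | u != 0]); apply: open_nbhs_nbhs; split; [exact: open_neq|exact: h2].
apply: filterS nK => eps nK z bz.
have h2 : H2 (perturb phi sg eps) z.
  apply/(H2E (Cinfty_smooth _) bz).
  rewrite (eq_jet_curvature (fun s => pds_perturb s eps bz)).
  have [Kz|/existsNP[i /negP]] := pselect (K z); first exact: nK.
  rewrite -ltNge => zi.
  have [_ /(H2E (Cinfty_smooth phi) bz) h2] := hphi z bz.
  rewrite (@eq_jet_curvature _ (fun s => pds s phi z)) // => s.
  by rewrite (pds_support gr s zi) mulr0 addr0.
by split=> //; exact: (H1_of_H2 m0 (Cinfty_smooth _) bz h2).
Qed.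

End Stability.

End Curvature.

(** * Localized quadratic forms *)

Section TestFunctions.
Context {R : realType} {m : nat}.
Local Notation N := (m + 1 + m)%N.
Local Notation e i := (delta_mx 0 i : 'rV[R]_N).
Implicit Types (z : 'rV[R]_N) (r : 'I_m -> 'I_m -> {poly R}).

Lemma sum_deltar (V : pzSemiRingType) (k : 'I_m) (F : 'I_m -> V) :
  \sum_j F j * (j == k)%:R = F k.
Proof.
rewrite (bigD1 k) //= eqxx mulr1 big1 ?addr0 // => j /negbTE ->.
by rewrite mulr0.
Qed.

Lemma half_double (a : R) : 2^-1 * (a + a) = a.
Proof. by lra. Qed.

Lemma eq_xi_yi (i j : 'I_m) : (xi i == yi j) = false.
Proof. by rewrite /xi /bxi /yi eq_lrshift. Qed.
Lemma eq_ti_yi (j : 'I_m) : (ti == yi j) = false.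
Proof. by rewrite /ti /bxi /yi eq_lrshift. Qed.
Lemma eq_yi_yi (i j : 'I_m) : (yi i == yi j) = (i == j).
Proof. by rewrite /yi eq_rshift. Qed.
Lemma eq_xi_xi (i j : 'I_m) : (xi i == xi j) = (i == j).
Proof. by rewrite /xi /bxi !eq_lshift. Qed.

Definition xydot z : R := \sum_i z 0 (xi i) * z 0 (yi i).

Lemma elementary_xydot : elementary xydot.
Proof.
apply: elementary_sum => i.
by apply: elementary_mul; exact: elementary_coord.
Qed.

Lemma pd_xydot j : pd (yi j) xydot = fun z => z 0 (xi j).
Proof.
apply/funext => z.
have D i : is_derive z (e (yi j)) (fun w : 'rV[R]_N => w 0 (xi i) * w 0 (yi i)) (z 0 (xi i) * (i == j)%:R).
  apply: is_derive_eq (is_deriveM (is_derive_coord z (xi i) (yi j)) (is_derive_coord z (yi i) (yi j))) _.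
  by rewrite eq_xi_yi eq_yi_yi scaler0 addr0.
have [_ E] := is_derive_sumr (index_enum 'I_m) D.
by rewrite /pd [LHS]E sum_deltar.
Qed.

Lemma pds_xydot i j z : pds [:: xi i; yi j] xydot z = (i == j)%:R.
Proof.
rewrite /= pd_xydot /pd; have [_ ->] := is_derive_coord z (xi j) (xi i).
by rewrite eq_xi_xi eq_sym.
Qed.

Definition linf r i z : R := \sum_j (r i j).[z 0 ti] * z 0 (yi j).

(** With the factor 1/2 the Hessian in [y] is the matrix of the [r_ij(t)]. *)
Definition quadf r z : R := 2^-1 * \sum_i z 0 (yi i) * linf r i z.

Lemma elementary_quadf r : elementary (quadf r).
Proof.
apply: elementary_mul; first exact: elementary_cst.
apply: elementary_sum => i; apply: elementary_mul; first exact: elementary_coord.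
apply: elementary_sum => j; apply: elementary_mul; last exact: elementary_coord.
by apply: elementary_horner; exact: elementary_coord.
Qed.

Lemma is_derive_linf r i k z : is_derive z (e (yi k)) (linf r i) (r i k).[z 0 ti].
Proof.
rewrite -(sum_deltar k (fun j => (r i j).[z 0 ti])); apply: is_derive_sumr => j.
have D0 : is_derive z (e (yi k)) (fun w : 'rV[R]_N => (r i j).[w 0 ti]) 0.
  have Q : (fun h : R => h^-1 *: ((r i j).[(h *: e (yi k) + z) 0 ti] - (r i j).[z 0 ti])) = fun=> 0.
    by apply/funext => h; rewrite (addrC (h *: _)) addeE eq_ti_yi mulr0 addr0 subrr scaler0.
  apply: DeriveDef; first by rewrite /derivable /= Q; apply/cvg_ex; exists 0; exact: cvg_cst.
  by rewrite /derive /= Q; apply/cvg_lim => //; exact: cvg_cst.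
apply: is_derive_eq (is_deriveM D0 (is_derive_coord z (yi j) (yi k))) _.
by rewrite eq_yi_yi scaler0 addr0.
Qed.

Lemma pd_quadf r k : (forall i j, r i j = r j i) -> pd (yi k) (quadf r) = linf r k.
Proof.
move=> rsym; apply/funext => z.
have D i : is_derive z (e (yi k)) (fun w : 'rV[R]_N => w 0 (yi i) * linf r i w)
    (z 0 (yi i) * (r i k).[z 0 ti] + linf r i z * (i == k)%:R).
  apply: is_derive_eq (is_deriveM (is_derive_coord z (yi i) (yi k)) (is_derive_linf r i k z)) _.
  by rewrite eq_yi_yi.
have [_ E] := is_deriveZ (2^-1 : R) (is_derive_sumr (index_enum 'I_m) D).
rewrite /pd [LHS]E big_split /= sum_deltar.
have -> : \sum_i z 0 (yi i) * (r i k).[z 0 ti] = linf r k z.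
  by apply: eq_bigr => i _; rewrite mulrC rsym.
exact: half_double.
Qed.

Lemma pds_quadf r i k z : (forall i j, r i j = r j i) ->
  pds [:: yi i; yi k] (quadf r) z = (r k i).[z 0 ti].
Proof.
by move=> rsym; rewrite /= pd_quadf // /pd; have [_ ->] := is_derive_linf r k i z.
Qed.

Lemma linf0 r k z : (forall j, z 0 (yi j) = 0) -> linf r k z = 0.
Proof. by move=> h; apply: big1 => j _; rewrite h mulr0. Qed.

Definition localize rho (h : 'rV[R]_N -> R) z : R := cutoff rho z * h z.

Lemma elementary_localize rho h : elementary h -> elementary (localize rho h).
Proof. by move=> eh; apply: elementary_mul; [exact: elementary_cutoff|]. Qed.

Lemma localize_support rho h z i : 0 < rho -> 2 * rho <= `|z 0 i| -> localize rho h z = 0.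
Proof. by move=> r0 zi; rewrite /localize (cutoff0 r0 zi) mul0r. Qed.

Definition cube (rho : R) : set 'rV[R]_N := [set z | forall i, `|z 0 i| < rho].

Lemma nbhs_cube rho : 0 < rho -> nbhs (0 : 'rV[R]_N) (cube rho).
Proof.
move=> r0; apply/nbhs_cubeP; exists rho => // w hw i.
by have := hw i; rewrite mxE subr0.
Qed.

Lemma open_cube rho : open (cube rho).
Proof.
rewrite openE => z hz; rewrite /interior.
apply: (near_forall (x := z)) => i; apply: near_norm_lt (hz i).
exact: coord_continuous.
Qed.

Lemma pds_localize rho h s z : 0 < rho -> cube rho z ->
  pds s (localize rho h) z = pds s h z.
Proof.
move=> r0 hz; apply: (eq_pds_open s (@open_cube rho)) (mem_set hz) => w /set_mem hw.
by rewrite /localize cutoff1 ?mul1r // => i; exact/ltW/hw.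
Qed.

Lemma box_cube e0 : 0 < e0 ->
  exists2 rho : R, 0 < rho & forall z, (forall i, `|z 0 i| <= 2 * rho) -> box e0 z.
Proof.
move=> e00.
have /nbhs_cubeP[r r0 h] := open_nbhs_nbhs (conj (@open_box R m e0) (box0 e00)).
exists (r / 4); first by rewrite divr_gt0.
move=> z hz; apply: h => i; rewrite mxE subr0; apply: le_lt_trans (hz i) _; lra.
Qed.

End TestFunctions.

(** * Contact order of perturbed phases *)

Lemma det_add_scalar (R : comNzRingType) k (B : 'M[R]_k) s :
  \det (B + s%:M) = (char_poly (- B)).[s].
Proof.
rewrite /char_poly -horner_evalE -det_map_mx; congr (\det _).
apply/matrixP => j i; rewrite !mxE /= /horner_eval hornerD hornerMn hornerX hornerN hornerC.
by rewrite opprK addrC.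
Qed.

Section Density.
Context {R : realType} {m : nat} {e0 : R}.
Hypotheses (e00 : 0 < e0) (m0 : (0 < m)%N).
Local Notation N := (m + 1 + m)%N.
Local Notation C := (Cinfty m e0).
Implicit Types (phi : C).

Lemma closure_perturb phi (A : set C) (g : 'rV[R]_N -> R) (r : R) (sg : smooth_on (box e0) g) :
  elementary g -> (forall (z : 'rV[R]_N) i, r <= `|z 0 i| -> g z = 0) ->
  (\forall s \near (0 : R)^', A (perturb phi sg s)) -> closure A phi.
Proof.
move=> eg gr nA B nB.
have c : perturb phi sg @ (0 : R) --> phi.
  by apply: cvg_perturb => // s; have [M hM] := pds_bounded eg gr s; exists M => z _.
have nB' : \forall s \near (0 : R)^', B (perturb phi sg s).
  by apply: cvg_within; exact: (c B nB).
have [s [h1 h2]] : exists s, A (perturb phi sg s) /\ B (perturb phi sg s).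
  exact: (@filter_ex _ ((0 : R)^') _ _ (filterI nA nB')).
by exists (perturb phi sg s).
Qed.

Lemma smooth_localize rho h : elementary h -> smooth_on (box e0) (localize rho h : 'rV[R]_N -> R).
Proof. by move=> eh; apply: elementary_smooth; exact: elementary_localize. Qed.

(** Adding [s <x, y>] near the origin adds [s] to the diagonal of the block, whose
    determinant is then a characteristic polynomial in [s]. *)
Lemma closure_xyblock_unit phi : Hormander_phases m e0 phi ->
  closure (Hormander_phases m e0 `&` [set psi : C | xyblock psi 0 \in unitmx]) phi.
Proof.
move=> hphi; have [rho r0 hrho] := @box_cube R m e0 e00.
pose sg := smooth_localize rho elementary_xydot.
have gr (z : 'rV[R]_N) i : 2 * rho <= `|z 0 i| -> localize rho xydot z = 0 by exact: localize_support.
apply: (closure_perturb (sg := sg) (elementary_localize rho elementary_xydot) gr).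
have n1 : \forall s \near (0 : R)^', Hormander_phases m e0 (perturb phi sg s).
  by apply: cvg_within; exact: (near_Hormander gr hrho sg m0 hphi).
have E s : xyblock (perturb phi sg s) 0 = xyblock phi 0 + s%:M.
  apply/matrixP => j i; rewrite xyblockE (pds_perturb _ _ _ _ (box0 e00)).
  rewrite pds_localize ?pds_xydot //; last exact: (nbhs_singleton (nbhs_cube r0)).
  by rewrite [RHS]mxE xyblockE [s%:M j i]mxE eq_sym mulr_natr.
have dE := det_add_scalar (xyblock phi 0).
have pd : polyfun (fun s : R => \det (xyblock phi 0 + s%:M)) by exists (char_poly (- xyblock phi 0)).
have [s1 hs1] : exists s1, \det (xyblock phi 0 + s1%:M) != 0.
  have /poly_nonroot[s hs] : char_poly (- xyblock phi 0) != 0.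
    exact/monic_neq0/char_poly_monic.
  by exists s; rewrite dE.
apply: filterS2 n1 (near_polyfun pd hs1) => s h1 h2; split; first exact: h1.
by rewrite /= E unitmxE unitfE.
Qed.

End Density.

Section ContactJets.
Context {R : realType} {m : nat}.
Local Notation N := (m + 1 + m)%N.
Implicit Types (f : 'rV[R]_N -> R) (X : R -> 'rV[R]_m).

Lemma contact_matrix_jet (del : R) l f X (S : 'I_m -> 'I_m -> {poly R}) : 0 < del ->
  (forall i j, jet del l (Dentry f 0 0 0 X i j) (S i j)) ->
  contact_matrix l f 0 0 0 X = jetmx l S.
Proof.
move=> del0 jS; apply/matrixP => k h; rewrite /contact_matrix /jetmx -(splitK k).
case: (fintype.split k) => c /=; [rewrite !col_mxEu|rewrite !col_mxEd]; rewrite mxE [RHS]mxE.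
  have K := jet_derive1n (jet_det del0 jS) (ltn_ord h); exact: K.
pose be := tnth (in_tuple (monomials m)) c.
have J : jet del l (Dmonomial f 0 0 0 X be) (\prod_p S p.1 p.2 ^+ be p).
  by apply: jet_prod => // p; apply: jetX => //; exact: jS.
have K := jet_derive1n J (ltn_ord h); exact: K.
Qed.

(** The symmetry is that of second derivatives; the constant terms vanish by the
    normalization of [phi0]. *)
Lemma taylor_Dentry e0 f X (del : R) l : smooth_on (box e0) f -> regular_curve e0 f X del ->
  exists T : 'I_m -> 'I_m -> {poly R}, [/\ forall i j, T i j = T j i,
    forall i j, (T i j)`_0 = 0 & forall i j, jet del l (Dentry f 0 0 0 X i j) (T i j)].
Proof.
move=> sf [X0 del0 H].
have bX t : `|t| < del -> box e0 (pt (X t) t 0) by move=> /H[].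
have uX t : `|t| < del -> xyblock f (pt (X t) t 0) \in unitmx by move=> /H[].
have dX (t : R) : `|t| < del -> forall i,
   is_derive t 1 (fun s => X s 0 i) (ev f (pt (X t) t 0) (vel i)) by move=> /H[].
have d0 : `|0 : R| < del by rewrite normr0.
have b0 := bX 0 d0; rewrite X0 pt0 in b0.
pose u i j (t : R) := ev f (pt (X t) t 0) (eD i j).
have usym i j t : `|t| < del -> u i j t = u j i t.
  move=> td; have sw z : box e0 z -> pds [:: yi i; yi j] f z = pds [:: yi j; yi i] f z.
    by move=> bz; exact: (schwarz _ _ (@open_box _ _ e0) sf bz).
  by rewrite /u /eD /eneg /ev (sw _ (bX t td)) (sw _ b0).
exists (fun i j => taylor l (u i j)); split=> [i j|i j|i j].
- exact: (eq_taylor l del0 (usym i j)).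
- by rewrite coef_poly /= /u X0 pt0 /= mulN1r subrr mul0r.
- have J : jet del l (u i j) (taylor l (u i j)).
    apply: taylor_jet => k t td.
    exact: (derivable_derive1n_eval (@open_box _ _ e0) sf bX uX dX).
  by apply: eq_jet J => // t td; rewrite (DentryE _ _ sf (bX t td)).
Qed.

End ContactJets.

Section ContactPerturbation.
Context {R : realType} {m : nat} {e0 : R}.
Hypotheses (e00 : 0 < e0) (m0 : (0 < m)%N).
Local Notation N := (m + 1 + m)%N.
Local Notation C := (Cinfty m e0).
Implicit Types (phi : C).

(** The quadratic form vanishes to second order at [y = 0], so the contact curve of
    [phi] is also one of the perturbed phase, whose Taylor polynomials are
    on the segment from [T] to a generic jet [q]. *)
Lemma near_contact_perturb phi l : (1 + size (monomials m) <= l)%N ->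
  xyblock phi 0 \in unitmx ->
  exists r : 'I_m -> 'I_m -> {poly R}, [/\ forall i j, r i j = r j i,
    forall i j, (r i j)`_0 = 0 &
    forall rho (sg : smooth_on (box e0) (localize rho (quadf r))), 0 < rho ->
      \forall s \near (0 : R)^', contact_order_le l (perturb phi sg s) 0 0 0].
Proof.
move=> hl u0; have [X [del rc]] := regular_curve_exists e00 (Cinfty_smooth phi) u0.
have [T [Tsym T0 TJ]] := taylor_Dentry l (Cinfty_smooth phi) rc.
have [q [qsym q0 qfree]] := @generic_jets R m l m0 hl.
pose r i j := q i j - T i j.
have rsym i j : r i j = r j i by rewrite /r qsym Tsym.
have r0 i j : (r i j)`_0 = 0 by rewrite coefB q0 T0 subrr.
exists r; split=> // rho sg rho0.
have [X0 del0 H] := rc.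
have d0 : `|0 : R| < del by rewrite normr0.
have cX : (fun t => pt (X t) t 0) @ (0 : R) --> (0 : 'rV[R]_N).
  have := @cvg_curve R m X 0; rewrite X0 pt0; apply => i.
  by have [_ _ _ /(_ i) []] := H 0 d0.
have ncube : \forall t \near (0 : R), cube rho (pt (X t) t (0 : 'rV[R]_m)).
  by apply: cX; exact: nbhs_cube.
have [d2 /= d20 d2P] := (nbhs_ballP _ _).1 ncube.
pose d := Num.min del d2.
have dpos : 0 < d by rewrite lt_min del0.
have cube0 : cube rho (0 : 'rV[R]_N) by exact: (nbhs_singleton (nbhs_cube rho0)).
have dP t : `|t| < d -> `|t| < del /\ cube rho (pt (X t) t (0 : 'rV[R]_m)).
  rewrite lt_min => /andP[td td2]; split=> //.
  by apply: d2P; rewrite /ball /= sub0r normrN.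
have g1 j z : cube rho z -> ypart z = 0 -> pds [:: yi j] (localize rho (quadf r)) z = 0.
  move=> cz yz; rewrite pds_localize // /= pd_quadf // linf0 // => k.
  by rewrite -ypartE yz mxE.
have g2 i j z : cube rho z -> pds [:: yi i; yi j] (localize rho (quadf r)) z = (r i j).[z 0 ti].
  by move=> cz; rewrite pds_localize // pds_quadf // rsym.
apply: filterS (near_row_free_segment T qfree) => s free.
exists X; split.
  have [_ nX] := regular_curve_contact (Cinfty_smooth phi) rc; split; first exact: X0.
  apply: filterS2 nX (near0_lt (_ : `|0 : R| < d)) => [t [dXt eqt] td|]; last by rewrite normr0.
  split=> [|j]; first exact: dXt.
  have [tdel tc] := dP t td; have [bt _ _ _] := H t tdel.
  have := eqt j; rewrite !addr0 pt0 => E.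
  have P (z : 'rV[R]_N) : box e0 z -> cube rho z -> ypart z = 0 ->
      pd (yi j) (perturb phi sg s) z = pd (yi j) phi z.
    move=> bz cz yz; have E1 := pds_perturb phi sg [:: yi j] s bz.
    by rewrite (g1 j z cz yz) mulr0 addr0 in E1.
  rewrite (P _ bt tc (ypart_pt _ _ _)) (P _ (box0 e00) cube0) //.
  by apply/rowP => k; rewrite ypartE !mxE.
rewrite (@contact_matrix_jet _ _ d l _ X (fun i j => T i j + s *: r i j)) //.
  by move: free; rewrite /row_free => /eqP.
move=> i j.
pose u := Dentry phi 0 0 0 X i j.
have D (f : 'rV[R]_N -> R) z : ev f z (eD i j) =
    pd (yi i) (pd (yi j) f) z + -1 * pd (yi i) (pd (yi j) f) 0 by [].
have J : jet d l (fun t => u t + (s *: r i j).[t]) (T i j + s *: r i j).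
  apply: (jetD dpos); last exact: jet_poly.
  by apply: jet_mono (TJ i j); rewrite ge_min lexx.
apply: eq_jet J => // t td; have [tdel tc] := dP t td; have [bt _ _ _] := H t tdel.
rewrite /u (DentryE _ _ (Cinfty_smooth phi) bt) (DentryE _ _ (Cinfty_smooth (perturb phi sg s)) bt).
have P (z : 'rV[R]_N) : box e0 z -> cube rho z ->
  pd (yi i) (pd (yi j) (perturb phi sg s)) z = pd (yi i) (pd (yi j) phi) z + s * (r i j).[z 0 ti].
  move=> bz cz; rewrite -(g2 i j z cz).
  exact: (pds_perturb phi sg [:: yi i; yi j] s bz).
have P1 : pd (yi i) (pd (yi j) (perturb phi sg s)) (pt (X t) t 0) =
    pd (yi i) (pd (yi j) phi) (pt (X t) t 0) + (s *: r i j).[t].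
  by rewrite (P _ bt tc) pt_t hornerZ.
have P2 : pd (yi i) (pd (yi j) (perturb phi sg s)) 0 = pd (yi i) (pd (yi j) phi) 0.
  by rewrite (P _ (box0 e00) cube0) [_ 0 ti]mxE horner_coef0 r0 mulr0 addr0.
rewrite [X in _ = X]D P1 P2 D addrAC; reflexivity.
Qed.

End ContactPerturbation.

(** * Normal form *)

Section NormalForm.
Context {R : realType} {m : nat}.
Local Notation N := (m + 1 + m)%N.

Lemma enorm_ge0 k (v : 'rV[R]_k) : 0 <= enorm v.
Proof. exact: sqrtr_ge0. Qed.

Lemma le_enorm k (v : 'rV[R]_k) i : `|v 0 i| <= enorm v.
Proof.
rewrite -sqrtr_sqr ler_wsqrtr // (bigD1 i) //= lerDl.
by apply: sumr_ge0 => j _; exact: sqr_ge0.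
Qed.

Lemma enorm_delta k (s : R) (i : 'I_k) : enorm (s *: delta_mx 0 i) = `|s|.
Proof.
rewrite /enorm (bigD1 i) //= big1 => [|j ji]; last first.
  by rewrite !mxE (negbTE ji) andbF mulr0 expr0n.
by rewrite !mxE !eqxx mulr1 addr0 sqrtr_sqr.
Qed.

(** The quotient of the remainder by [t ^ 2] is a polynomial. *)
Lemma poly_second_order (p : {poly R}) (rho : R) : 0 <= rho -> p`_0 = 0 ->
  exists2 K, 0 <= K & forall t, `|t| <= rho -> `|p.[t] - p`_1 * t| <= K * t ^+ 2.
Proof.
move=> rho0 p0; pose d := drop_poly 2 p.
exists (\sum_(i < size d) `|d`_i| * rho ^+ i) => [|t tr].
  by apply: sumr_ge0 => i _; rewrite mulr_ge0 // exprn_ge0.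
have E : p.[t] - p`_1 * t = d.[t] * t ^+ 2.
  rewrite -{1}(poly_take_drop 2 p) hornerD hornerM hornerXn.
  rewrite /take_poly horner_poly !big_ord_recl big_ord0 /= p0 /bump /=.
  ring.
rewrite E normrM (ger0_norm (sqr_ge0 t)) ler_wpM2r ?sqr_ge0 //.
rewrite horner_coef; apply: le_trans (ler_norm_sum _ _ _) _.
apply: ler_sum => i _; rewrite normrM normrX ler_wpM2l //.
by rewrite lerXn2r ?nnegrE // (le_trans _ tr).
Qed.

Variable e0 : R.
Local Notation C := (Cinfty m e0).

Section Perturbation.
Variables (phi : C) (rho : R) (r : 'I_m -> 'I_m -> {poly R}).
Hypotheses (rho0 : 0 < rho) (r0 : forall i j, (r i j)`_0 = 0).
Variable sg : smooth_on (box e0) (localize rho (quadf r)).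

(** The linear part in [t] of the perturbation is absorbed in the matrix [M],
    the rest in the error term [O(|bx|^2 |y|^2)]. *)
Lemma near_normal_form : normal_form e0 phi ->
  \forall s \near (0 : R), normal_form e0 (perturb phi sg s).
Proof.
move=> [M [uM [e [D [/andP[epos ee0] hphi]]]]].
pose a : 'M[R]_m := \matrix_(i, j) (r i j)`_1.
pose M' (s : R) := M + (2^-1 * s) *: a.
have cM i j : (fun s => M' s i j) @ (0 : R) --> M i j.
  have c : (fun s : R => M i j + 2^-1 * s * a i j) @ (0 : R) --> M i j + 2^-1 * 0 * a i j.
    apply: cvgD; first exact: cvg_cst.
    by apply: cvgM; [apply: cvgM; [exact: cvg_cst|exact: cvg_id]|exact: cvg_cst].
  rewrite mulr0 mul0r addr0 in c.
  by apply: eq_cvgl c => s; rewrite !mxE.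
apply: filterS (near_unitmx cM uM) => s uM'.
have [K hK] := boolp.choice (fun p : 'I_m * 'I_m => let: ex_intro2 K h1 h2 :=
  poly_second_order (ltW rho0) (r0 p.1 p.2) in ex_intro (fun K => 0 <= K /\
   forall t, `|t| <= rho -> `|(r p.1 p.2).[t] - (r p.1 p.2)`_1 * t| <= K * t ^+ 2) K (conj h1 h2)).
pose S := \sum_i \sum_j K (i, j).
have S0 : 0 <= S.
  by apply: sumr_ge0 => i _; apply: sumr_ge0 => j _; case: (hK (i, j)).
exists (M' s); split=> //; exists (Num.min e rho), (D + `|s| * (2^-1 * S)).
split; first by rewrite lt_min epos rho0 ge_min ee0.
move=> z [zx zt zy].
have bz : box e z.
  by move: zx zt zy; rewrite !lt_min => /andP[? _] /andP[? _] /andP[? _].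
have zr : cube rho z.
  move: zx zt zy; rewrite !lt_min => /andP[_ zx] /andP[_ zt] /andP[_ zy].
  apply: coord_ind => [i||j].
  - by rewrite -xpartE; apply: le_lt_trans zx; exact: le_enorm.
  - by rewrite -tpartE.
  - by rewrite -ypartE; apply: le_lt_trans zy; exact: le_enorm.
set y := ypart z; set t := tpart z.
have yM : dotp y (y *m (M' s)^T) = dotp y (y *m M^T) + 2^-1 * s * \sum_i \sum_j y 0 i * (a i j * y 0 j).
  rewrite /M' linearD linearZ /= mulmxDr -scalemxAr /dotp mulr_sumr -big_split /=.
  apply: eq_bigr => i _; rewrite [(_ + _ : 'rV_m) 0 i]mxE mulrDr; congr (_ + _).
  rewrite [(_ *: _ : 'rV_m) 0 i]mxE mulrCA; congr (_ * _); rewrite [(_ *m _ : 'rV_m) 0 i]mxE mulr_sumr; apply: eq_bigr => j _.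
  by rewrite [a^T _ _]mxE (mulrC (y 0 j)).
have qE : quadf r z = 2^-1 * \sum_i \sum_j y 0 i * ((r i j).[t] * y 0 j).
  congr (_ * _); apply: eq_bigr => i _; rewrite -ypartE mulr_sumr.
  by apply: eq_bigr => j _; rewrite -ypartE -tpartE.
have gE : localize rho (quadf r) z = quadf r z.
  by rewrite /localize cutoff1 ?mul1r // => i; exact/ltW/zr.
have -> : perturb phi sg s z - (dotp (xpart z) y + t * dotp y (y *m (M' s)^T)) =
   (phi z - (dotp (xpart z) y + t * dotp y (y *m M^T))) +
   s * (2^-1 * \sum_i \sum_j y 0 i * (((r i j).[t] - (r i j)`_1 * t) * y 0 j)).
  have pE : perturb phi sg s z = phi z + s * quadf r z by rewrite -gE.
  rewrite pE qE yM.
  have -> : \sum_i \sum_j y 0 i * (((r i j).[t] - (r i j)`_1 * t) * y 0 j) =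
     \sum_i \sum_j y 0 i * ((r i j).[t] * y 0 j) - t * \sum_i \sum_j y 0 i * (a i j * y 0 j).
    rewrite mulr_sumr -sumrB; apply: eq_bigr => i _.
    rewrite mulr_sumr -sumrB; apply: eq_bigr => j _; rewrite [a i j]mxE; ring.
  ring.
apply: le_trans (ler_normD _ _) _.
have h1 := hphi z bz.
have h2 : `|\sum_i \sum_j y 0 i * (((r i j).[t] - (r i j)`_1 * t) * y 0 j)| <=
    S * (enorm (bxpart z) ^+ 2 * enorm y ^+ 2).
  rewrite /S mulr_suml; apply: le_trans (ler_norm_sum _ _ _) _; apply: ler_sum => i _.
  rewrite mulr_suml; apply: le_trans (ler_norm_sum _ _ _) _; apply: ler_sum => j _.
  have [K0 Kt] := hK (i, j).
  have tr : `|t| <= rho by rewrite /t tpartE; exact/ltW/zr.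
  have {}Kt := Kt t tr.
  have tb : t ^+ 2 <= enorm (bxpart z) ^+ 2.
    rewrite -[t ^+ 2]real_normK ?num_real // lerXn2r ?nnegrE ?enorm_ge0 //.
    have := le_enorm (bxpart z) (rshift m 0); by rewrite /t /tpart [X in `|X| <= _ -> _]mxE [X in _ -> `|X| <= _]mxE mxE.
  rewrite !normrM mulrCA mulrA.
  apply: (@le_trans _ _ (K (i, j) * t ^+ 2 * (enorm y ^+ 2))).
    rewrite expr2 -mulrA; apply: ler_pM => //.
    by apply: ler_pM => //; exact: le_enorm.
  by rewrite -mulrA ler_wpM2l // ler_wpM2r // sqr_ge0.
have h3 : 0 <= `|t| * enorm y ^+ 3 by rewrite mulr_ge0 // exprn_ge0 // enorm_ge0.
rewrite mulrDl; apply: lerD; first exact: h1.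
rewrite normrM -mulrA ler_wpM2l // normrM ger0_norm ?invr_ge0 //.
rewrite -mulrA ler_wpM2l ?invr_ge0 //.
by apply: le_trans h2 _; rewrite ler_wpM2l // lerDl.
Qed.

End Perturbation.

(** The error term is quadratic both in [x] and in [y] when [t = 0], and does not
    contribute to the second derivatives in [x] and [y] at the origin. *)
Lemma normal_form_xyblock (phi : C) : 0 < e0 -> normal_form e0 phi ->
  xyblock phi 0 = 1%:M.
Proof.
move=> e00 [M [uM [e [D [/andP[epos ee0] hphi]]]]].
have bxE (x : 'rV[R]_m) (t : R) y : bxpart (pt x t y) = row_mx x (const_mx t).
  by rewrite /bxpart /pt row_mxKl.
have bpt (x y : 'rV[R]_m) : enorm x < e -> enorm y < e -> box e (pt x (0 : R) y).
  by move=> hx hy; rewrite /box /= xpart_pt tpart_pt ypart_pt normr0.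
have dE (x : 'rV[R]_m) j : enorm x < e -> pd (yi j) phi (pt x 0 0) = x 0 j.
  move=> hx; have z0 : phi (pt x 0 0) = 0.
    have := hphi _ (bpt x 0 hx _); rewrite enorm0 => /(_ epos).
    rewrite xpart_pt tpart_pt ypart_pt enorm0 normr0 !mul0r !expr0n /= !mulr0 !addr0 ?mulr0.
    rewrite normr_le0 /dotp big1 ?subr0 => [/eqP //|i _].
    by rewrite [X in _ * X]mxE mulr0.
  set B := enorm (bxpart (pt x (0 : R) (0 : 'rV[R]_m))) ^+ 2.
  have est (h : R) : `|h| < e -> `|phi (pt x 0 (h *: delta_mx 0 j)) - h * x 0 j| <= D * B * h ^+ 2.
    move=> he; have := hphi _ (bpt x (h *: delta_mx 0 j) hx _).
    rewrite enorm_delta => /(_ he).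
    rewrite bxE -(bxE x 0 0) -/B xpart_pt tpart_pt ypart_pt enorm_delta normr0 !mul0r !addr0.
    rewrite real_normK ?num_real // mulrA.
    suff -> : dotp x (h *: delta_mx 0 j) = h * x 0 j by [].
    rewrite /dotp (bigD1 j) //= big1 ?addr0 => [|i ij].
      by rewrite !mxE !eqxx mulr1 mulrC.
    by rewrite !mxE (negbTE ij) andbF !mulr0.
  rewrite /pd /derive; apply/cvg_lim => //.
  have E (h : R) : h^-1 *: (phi (h *: delta_mx 0 (yi j) + pt x 0 0) - phi (pt x 0 0)) =
      h^-1 * phi (pt x 0 (h *: delta_mx 0 j)).
    rewrite z0 subr0; congr (_ * phi _); apply/rowP; apply: coord_ind => [i||i].
    - by rewrite addrC addeE eq_xi_yi mulr0 addr0 !pt_x.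
    - by rewrite addrC addeE eq_ti_yi mulr0 addr0 !pt_t.
    - by rewrite addrC addeE eq_yi_yi !pt_y !mxE add0r eqxx.
  apply: (eq_cvgl E); apply/cvgrPdist_lt => eps eps0; near=> h.
  have hn0 : h != 0 by near: h; exact: nbhs_dnbhs_neq.
  have he : `|h| < e.
    by near: h; apply: cvg_within; apply: near0_lt; rewrite normr0.
  have hB : `|h| < eps / (`|D * B| + 1).
    near: h; apply: cvg_within; apply: near0_lt; rewrite normr0 divr_gt0 // ltr_wpDl.
  rewrite distrC (_ : _ - _ = h^-1 * (phi (pt x 0 (h *: delta_mx 0 j)) - h * x 0 j)); last first.
    by rewrite mulrBr mulKf.
  rewrite normrM normfV ltr_pdivrMl ?normr_gt0 //.
  apply: le_lt_trans (est h he) _; rewrite -[h ^+ 2]real_normK ?num_real //.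
  rewrite expr2 mulrCA ltr_pM2l ?normr_gt0 //.
  move: hB; rewrite ltr_pdivlMr ?ltr_wpDl // => hB; apply: le_lt_trans hB.
  rewrite mulrC mulrDr mulr1; apply: ler_wpDr => //; rewrite ler_wpM2l //; exact: ler_norm.
apply/matrixP => j i; rewrite xyblockE /= {1}/pd /derive; apply/cvg_lim => //.
have z0 : pd (yi j) phi 0 = 0.
  by rewrite -pt0 dE ?mxE // enorm0.
rewrite z0; apply: cvg_near_cst.
near=> h.
have hn0 : h != 0 by near: h; exact: nbhs_dnbhs_neq.
have he : `|h| < e by near: h; apply: cvg_within; apply: near0_lt; rewrite normr0.
rewrite /=; have -> : h *: delta_mx 0 (xi i) + 0 = pt (h *: delta_mx 0 i) 0 0 :> 'rV[R]_N.
  rewrite addr0; apply/rowP; apply: coord_ind => [k||k].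
  - by rewrite pt_x !mxE eq_xi_xi.
  - by rewrite pt_t !mxE /ti /xi /bxi eq_lshift eq_rlshift mulr0.
  - by rewrite pt_y !mxE eq_sym eq_xi_yi mulr0.
rewrite dE ?enorm_delta // subr0 !mxE eqxx /= -[_ *: _]/(_ * _) mulKf //.
Unshelve. all: by end_near. Qed.

End NormalForm.

(** * Openness and density of the contact classes *)

Section Closures.
Context {R : realType} {m : nat} {e0 : R}.
Hypotheses (e00 : 0 < e0) (m0 : (0 < m)%N).
Local Notation C := (Cinfty m e0).

(** Both classes of phases are treated at once: [H] only needs to be kept by the
    small perturbations that are used. *)
Lemma closure_contact_class (H : set C) (phi : C) l : (1 + size (monomials m) <= l)%N ->
  Hormander_phases m e0 phi -> xyblock phi 0 \in unitmx ->
  (forall r rho (sg : smooth_on (box e0) (localize rho (quadf r))), 0 < rho ->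
     (forall i j, (r i j)`_0 = 0) ->
     (\forall s \near (0 : R)^', Hormander_phases m e0 (perturb phi sg s)) ->
     \forall s \near (0 : R)^', H (perturb phi sg s)) ->
  closure (contact_class l H) phi.
Proof.
move=> hl hphi u0 hH; have [r [_ r0 nr]] := near_contact_perturb e00 m0 hl u0.
have [rho rho0 hrho] := @box_cube R m e0 e00.
pose sg := @smooth_localize R m e0 rho _ (elementary_quadf r).
have gr (z : 'rV[R]_(m + 1 + m)) i : 2 * rho <= `|z 0 i| -> localize rho (quadf r) z = 0.
  exact: localize_support.
apply: (closure_perturb e00 (sg := sg) (elementary_localize rho (elementary_quadf r)) gr).
have nH : \forall s \near (0 : R)^', H (perturb phi sg s).
  apply: hH => //; apply: cvg_within; exact: (near_Hormander gr hrho sg m0 hphi).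
by apply: filterS2 nH (nr rho sg rho0) => s h1 h2.
Qed.

End Closures.

Theorem proposition7p1 (R : realType) (n l : nat) (e0 : R)
    (hn : (3 <= n)%N) (he0 : 0 < e0 < 1) (hl : (A n <= l)%N) :
  let H := Hormander_phases n.-1 e0 in
  let Hnf := normal_phases n.-1 e0 in
  [/\ open (contact_class l H : set (subspace H)),
      H `<=` closure (contact_class l H),
      open (contact_class l Hnf : set (subspace Hnf))
    & Hnf `<=` closure (contact_class l Hnf)].
Proof.
move=> H Hnf; have e00 : 0 < e0 by case/andP: he0.
have m0 : (0 < n.-1)%N by case: n hn {hl H Hnf} => [|[|]].
split.
- exact: open_contact_class.
- have sub : H `&` [set psi : Cinfty n.-1 e0 | xyblock psi 0 \in unitmx] `<=` closure (contact_class l H).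
    move=> psi [hpsi upsi].
    by apply: closure_contact_class => // r rho sg _ _.
  move=> phi hphi.
  have := closure_subset sub (closure_xyblock_unit e00 m0 hphi).
  by rewrite -(closure_id _).1 //; exact: closed_closure.
- by apply: open_contact_class => // phi [].
- move=> phi [hphi nphi].
  apply: closure_contact_class => //; first by rewrite (normal_form_xyblock e00 nphi) unitmx1.
  move=> r rho sg rho0 r0 nH; apply: filterS2 nH _ => [s h1 h2|]; first by split; [exact: h1|exact: h2].
  by apply: cvg_within; exact: near_normal_form.
Qed.
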